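(* Let $f$ be a transcendental entire function and let $(a_n)_{n\in\mathbb{N}}$ be a sequence of positive real numbers with $a_n\to\infty$ as $n\to\infty$. Let $$I(f,(a_n))=\{z\in\mathbb{C}: |f^n(z)|\geq a_n\ \text{ for all } n\in\mathbb{N}\}.$$ Suppose that, for every $n\in\mathbb{N}$, the disc $D(0,a_n)$ contains a periodic cycle of $f$, and that the complement $I(f,(a_n))^c=\mathbb{C}\setminus I(f,(a_n))$ has a bounded component. Then the escaping set $I(f)=\{z\in\mathbb{C}: f^n(z)\to\infty\text{ as }n\to\infty\}$ is a spider's web.
   Context: $f^n$ denotes the $n$th iterate of $f$, $\mathbb{N}=\{1,2,\dots\}$, $D(0,r)=\{z:|z|<r\}$, and ''component'' means connected component. A set $E\subset\mathbb{C}$ is an (infinite) spider's web if $E$ is connected and there exists a sequence $(G_n)_{n\in\mathbb{N}}$ of bounded simply connected domains with $G_n\subset G_{n+1}$ and $\partial G_n\subset E$ for all $n\in\mathbb{N}$, and $\bigcup_{n\in\mathbb{N}}G_n=\mathbb{C}$. *)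

(* Defs.v *)
From mathcomp Require Export all_boot all_order all_algebra.
From mathcomp Require Export all_classical all_reals all_analysis.
From mathcomp Require Export complex.
Export Order.TTheory GRing.Theory Num.Theory.
Export numFieldNormedType.Exports.

Set Implicit Arguments.
Unset Strict Implicit.
Unset Printing Implicit Defensive.

Global Open Scope classical_set_scope.
Global Open Scope ring_scope.
Global Open Scope complex_scope.

(* The topology, norm and complex-linear structure of the plane are those of
   the field R[i] regarded as a one-dimensional normed module over itself; the
   norm `|z| is R[i]-valued, hence the embeddings r%:C of real bounds below. *)
Notation cplane R := (R[i]^o)%type (only parsing).

Section Topology.
Variables (R : realType) (T : topologicalType).
Implicit Types A G : set T.

Definition boundary A : set T := closure A `\` interior A.

Definition is_component A C :=
  exists2 x, A x & C = connected_component A x.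

Definition domain G := [/\ G !=set0, open G & connected G].

Definition loop_in G (gamma : R -> T) :=
  [/\ {within `[0, 1], continuous gamma},
      forall t : R, t \in `[0, 1] -> G (gamma t) & gamma 0 = gamma 1].

(* Homotopy with fixed base point; the first argument of H is the homotopy
   parameter. *)
Definition null_homotopic_in G (gamma : R -> T) :=
  exists H : R * R -> T,
    [/\ {within `[0, 1] `*` `[0, 1], continuous H},
        forall s t : R, s \in `[0, 1] -> t \in `[0, 1] -> G (H (s, t)),
        forall t : R, t \in `[0, 1] -> H (0, t) = gamma t,
        forall t : R, t \in `[0, 1] -> H (1, t) = gamma 0 &
        forall s : R, s \in `[0, 1] -> H (s, 0) = gamma 0 /\ H (s, 1) = gamma 0].

End Topology.

Section Plane.
Variable R : realType.
Local Notation C := (cplane R).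
Implicit Types (f : C -> C) (E G : set C).

(* Planar domains are path connected, so contractibility of loops is the only
   further requirement. *)
Definition simply_connected_domain G :=
  domain G /\ forall gamma : R -> C, loop_in G gamma -> null_homotopic_in G gamma.

Definition spiders_web E :=
  connected E /\
  exists G : nat -> set C,
    [/\ forall n, bounded_set (G n) /\ simply_connected_domain (G n),
        forall n, G n `<=` G n.+1,
        forall n, boundary (G n) `<=` E &
        \bigcup_n G n = setT].

Definition entire f := forall z : C, derivable f z 1.

Definition transcendental_entire f :=
  entire f /\ ~ exists p : {poly R[i]}, forall z, f z = p.[z].

Definition escaping_set f : set C :=
  [set z | `|iter n f z| @[n --> \oo] --> +oo].

(* Only the values a n with n >= 1 matter. *)
Definition escaping_above f (a : nat -> R) : set C :=
  [set z | forall n, (0 < n)%N -> (a n)%:C <= `|iter n f z|].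

(* p need not be the least period: the orbit is the same for any period. *)
Definition periodic_cycle f (O : set C) :=
  exists z p, [/\ (0 < p)%N, iter p f z = z & O = [set iter k f z | k in `I_p]].

End Plane.

(* Main.v *)
(* Write E for the set of points z with |f^n z| >= a n for all n, and K for the
   bounded component of its complement.  Some f^m(K) meets the disc D(0, a m)
   while f^m maps the boundary of K outside it, so f^m(K) contains that disc by
   the open mapping theorem, hence a cycle; therefore f^n(K) meets D(0, a n) for
   all large n.  Filling the compact set f^n(boundary K), which escapes, gives
   the simply connected domains of the web.

   The escaping set is connected because otherwise an open set U would separate
   two escaping points p and q, with no escaping point on its boundary.  Cutting
   U by a domain G of the web, (w - p) / (w - q) has a continuous logarithm on
   the boundary of G (as G is connected) and also on the boundary of U inside G:
   near a nonescaping point z some f^n z lies in a domain of the web which f^n p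
   and f^n q have already left, and the maximum principle shows that the
   preimage of that domain cannot enclose p or q.  But such a logarithm cannot
   exist on the boundary of a bounded open set containing p whose closure
   misses q (Borsuk).

   Simple connectivity of a filled domain is also obtained from logarithms: a
   loop is pushed onto rectangles stacked in vertical strips, and a cycle in
   their adjacency graph would wind around a point outside the domain. *)

(* Boundaries here may be arbitrarily irregular, so nothing is argued with curves. For a compact
   [S], a continuous logarithm of [z - p] on [S] replaces the statement that [S] does not wind
   around [p]. Such logarithms multiply, survive small deformations, and glue over disjoint closed
   sets without any compatibility.

   The cycle is needed because [a] may fail to be monotone. A point of [K] that lands at time m on a
   cycle inside D(0, a m) stays in that disc at all later times, and a n > a m for all large n.

   That the domains of the web have no holes serves two ends: simple connectivity, and the
   connectedness of the escaping set, where the property has to be pulled back along iterates.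

   Differentiability is pointwise, without continuity of the derivative, so the maximum principle
   starts from Goursat's theorem. *)
Require Import Defs.
From mathcomp Require Import ring lra zify.

Set Implicit Arguments.
Unset Strict Implicit.
Unset Printing Implicit Defensive.

Local Notation Re := complex.Re.
Local Notation Im := complex.Im.

(** * Metric topology of the complex plane *)

Section Basics.
Variable R : realType.
Local Notation C := (cplane R).
Implicit Types (z w : C) (A : set C) (x y e r : R).

Definition nrm (z : C) : R := Re `|z|.

Lemma norm_nrm z : `|z| = (nrm z)%:C.
Proof. by rewrite /nrm normc_def. Qed.

Lemma nrmE z : nrm z = Num.sqrt (Re z ^+ 2 + Im z ^+ 2).
Proof. by rewrite /nrm normc_def. Qed.

Lemma nrm_ge0 z : 0 <= nrm z.
Proof. by rewrite nrmE sqrtr_ge0. Qed.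

Lemma nrm0 : nrm 0 = 0.
Proof. by rewrite /nrm normr0. Qed.

Lemma nrm1 : nrm 1 = 1.
Proof. by rewrite /nrm normr1. Qed.

Lemma nrmM z w : nrm (z * w) = nrm z * nrm w.
Proof. by apply: (@complexI R); rewrite rmorphM /= -!norm_nrm normrM. Qed.

Lemma nrmN z : nrm (- z) = nrm z.
Proof. by rewrite /nrm normrN. Qed.

Lemma nrmB z w : nrm (z - w) = nrm (w - z).
Proof. by rewrite -nrmN opprB. Qed.

Lemma nrm_real x : nrm (x%:C : C) = `|x|.
Proof. by rewrite nrmE /= expr0n addr0 sqrtr_sqr. Qed.

Lemma nrmV z : nrm z^-1 = (nrm z)^-1.
Proof. by apply: (@complexI R); rewrite fmorphV /= -!norm_nrm normfV. Qed.

Lemma nrm_eq0 z : (nrm z == 0) = (z == 0).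
Proof.
by rewrite -(inj_eq (@complexI R)) -norm_nrm normr_eq0.
Qed.

Lemma nrm_gt0 z : (0 < nrm z) = (z != 0).
Proof. by rewrite lt0r nrm_eq0 nrm_ge0 andbT. Qed.

Lemma ler_nrmD z w : nrm (z + w) <= nrm z + nrm w.
Proof. by rewrite -lecR rmorphD /= -!norm_nrm ler_normD. Qed.

Lemma ler_nrm_dist u z w : nrm (z - w) <= nrm (z - u) + nrm (u - w).
Proof. by rewrite (le_trans _ (ler_nrmD _ _)) // subrKA. Qed.

Lemma ler_nrmB z w : nrm z - nrm w <= nrm (z - w).
Proof. by rewrite lerBlDr -{1}(subrK w z) ler_nrmD. Qed.

Lemma sqr_nrm z : nrm z ^+ 2 = Re z ^+ 2 + Im z ^+ 2.
Proof. by rewrite nrmE sqr_sqrtr // addr_ge0 ?sqr_ge0. Qed.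

Lemma normRe_le z : `|Re z| <= nrm z.
Proof.
by rewrite -(ler_pXn2r (n := 2)) ?nnegrE ?nrm_ge0 // sqr_nrm real_normK ?num_real // lerDl sqr_ge0.
Qed.

Lemma normIm_le z : `|Im z| <= nrm z.
Proof.
by rewrite -(ler_pXn2r (n := 2)) ?nnegrE ?nrm_ge0 // sqr_nrm real_normK ?num_real // lerDr sqr_ge0.
Qed.

Lemma Re_le z : Re z <= nrm z.
Proof. exact: le_trans (ler_norm _) (normRe_le z). Qed.

Lemma nrm_le_ReIm z : nrm z <= `|Re z| + `|Im z|.
Proof.
rewrite -(ler_pXn2r (n := 2)) ?nnegrE ?nrm_ge0 ?addr_ge0 // sqr_nrm sqrrD !real_normK ?num_real //.
by rewrite lerD2r lerDl mulrn_wge0 // mulr_ge0.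
Qed.

Lemma ReD z w : Re (z + w) = Re z + Re w. Proof. by case: z w => [? ?] [? ?]. Qed.
Lemma ImD z w : Im (z + w) = Im z + Im w. Proof. by case: z w => [? ?] [? ?]. Qed.
Lemma ReN z : Re (- z) = - Re z. Proof. by case: z. Qed.
Lemma ImN z : Im (- z) = - Im z. Proof. by case: z. Qed.
Lemma ReB z w : Re (z - w) = Re z - Re w. Proof. by rewrite ReD ReN. Qed.
Lemma ImB z w : Im (z - w) = Im z - Im w. Proof. by rewrite ImD ImN. Qed.
Lemma ReM z w : Re (z * w) = Re z * Re w - Im z * Im w. Proof. by case: z w => [? ?] [? ?]. Qed.
Lemma ImM z w : Im (z * w) = Re z * Im w + Im z * Re w. Proof. by case: z w => [? ?] [? ?]. Qed.

Lemma complex_ext z w : Re z = Re w -> Im z = Im w -> z = w.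
Proof. by case: z w => [? ?] [? ?] /= -> ->. Qed.

Lemma nbhsC z A :
  nbhs z A <-> exists2 e, 0 < e & forall w, nrm (w - z) < e -> A w.
Proof.
split.
- move=> /nbhs_ballP[e /= e0 zeA].
  have [eR eIm] : 0 < Re e /\ Im e = 0.
    by move: e0; rewrite ltcE /= => /andP[/eqP -> ->].
  exists (Re e) => // w wz; apply: zeA; rewrite /ball /= norm_nrm.
  have -> : e = (Re e)%:C by apply: complex_ext.
  by rewrite ltcR nrmB.
- move=> [e e0 h]; apply/nbhs_ballP; exists e%:C => /=; first by rewrite ltcR.
  by move=> w; rewrite /ball /= norm_nrm ltcR nrmB; exact: h.
Qed.

Lemma openC A :
  open A <-> forall z, A z -> exists2 e, 0 < e & forall w, nrm (w - z) < e -> A w.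
Proof.
rewrite openE; split=> h z /h; first by move/nbhsC.
by move=> ?; apply/nbhsC.
Qed.

Lemma closureC A z :
  closure A z <-> forall e, 0 < e -> exists2 w, A w & nrm (w - z) < e.
Proof.
split=> [h e e0|h B /nbhsC[e e0 eB]].
  have /h[w [Aw /= we]] : nbhs z [set w | nrm (w - z) < e] by apply/nbhsC; exists e.
  by exists w.
by have [w Aw we] := h e e0; exists w; split => //; exact: eB.
Qed.

Lemma continuousCC (f : C -> C) z : {for z, continuous f} <->
  forall e, 0 < e -> exists2 d, 0 < d & forall w, nrm (w - z) < d -> nrm (f w - f z) < e.
Proof.
split=> [h e e0|h B /nbhsC[e e0 eB]].
  have /h/nbhsC[d d0 hd] : nbhs (f z) [set w | nrm (w - f z) < e] by apply/nbhsC; exists e.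
  by exists d.
have [d d0 hd] := h e e0; apply/nbhsC; exists d => // w /hd; exact: eB.
Qed.

Lemma nbhsR (x : R) (B : set R) :
  nbhs x B <-> exists2 e, 0 < e & forall y, `|y - x| < e -> B y.
Proof.
split=> [/nbhs_ballP[e /= e0 h]|[e e0 h]].
  by exists e => // y yx; apply: h; rewrite /ball /= distrC.
by apply/nbhs_ballP; exists e => // y; rewrite /ball /= distrC; exact: h.
Qed.

Lemma continuousRC (f : R -> C) x : {for x, continuous f} <->
  forall e, 0 < e -> exists2 d, 0 < d & forall y, `|y - x| < d -> nrm (f y - f x) < e.
Proof.
split=> [h e e0|h B /nbhsC[e e0 eB]].
  have /h/nbhsR[d d0 hd] : nbhs (f x) [set w | nrm (w - f x) < e] by apply/nbhsC; exists e.
  by exists d.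
have [d d0 hd] := h e e0; apply/nbhsR; exists d => // w /hd; exact: eB.
Qed.

Lemma continuousCR (f : C -> R) z : {for z, continuous f} <->
  forall e, 0 < e -> exists2 d, 0 < d & forall w, nrm (w - z) < d -> `|f w - f z| < e.
Proof.
split=> [h e e0|h B /nbhsR[e e0 eB]].
  have /h/nbhsC[d d0 hd] : nbhs (f z) [set y | `|y - f z| < e] by apply/nbhsR; exists e.
  by exists d.
have [d d0 hd] := h e e0; apply/nbhsC; exists d => // w /hd; exact: eB.
Qed.

(** Phrased for an arbitrary distance function, so that one proof of the epsilon-delta form of
    continuity within a set, [within_eps], serves the combinations of [R] and [C]. *)
Definition metrized (X : topologicalType) (d : X -> X -> R) :=
  forall (p : X) (B : set X), nbhs p B <-> exists2 e, 0 < e & forall q, d q p < e -> B q.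

Definition distC (z w : C) : R := nrm (z - w).
Definition distR (x y : R) : R := `|x - y|.

Lemma metrizedC : metrized distC.
Proof. exact: nbhsC. Qed.

Lemma metrizedR : metrized distR.
Proof. exact: nbhsR. Qed.

Lemma within_eps (X Y : topologicalType) (dX : X -> X -> R) (dY : Y -> Y -> R) :
  metrized dX -> metrized dY -> forall (S : set X) (f : X -> Y),
  {within S, continuous f} <->
  forall p, S p -> forall e, 0 < e ->
    exists2 d, 0 < d & forall q, S q -> dX q p < d -> dY (f q) (f p) < e.
Proof.
move=> mX mY S f; rewrite subspace_continuousP; split.
  move=> h x Sx e e0.
  have /(h x Sx)/mX[d d0 hd] : nbhs (f x) [set w | dY w (f x) < e] by apply/mY; exists e.
  by exists d => // y Sy /hd; exact.
move=> h x Sx B /mY[e e0 eB]; have [d d0 hd] := h x Sx e e0.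
by apply/mX; exists d => // y yd Sy; apply: eB; exact: hd.
Qed.

Definition within_continuousCC := within_eps metrizedC metrizedC.
Definition within_continuousRC := within_eps metrizedR metrizedC.
Definition within_continuousCR := within_eps metrizedC metrizedR.

Lemma nrm_continuous : continuous nrm.
Proof.
move=> z; apply/continuousCR => e e0; exists e => // w; apply: le_lt_trans.
by rewrite ler_norml ler_nrmB lerNl opprB nrmB ler_nrmB.
Qed.

Lemma Re_continuous : continuous (@Re R : C -> R).
Proof.
move=> z; apply/continuousCR => e e0; exists e => // w; apply: le_lt_trans.
by rewrite -ReB normRe_le.
Qed.

Lemma Im_continuous : continuous (@Im R : C -> R).
Proof.
move=> z; apply/continuousCR => e e0; exists e => // w; apply: le_lt_trans.
by rewrite -ImB normIm_le.
Qed.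

Definition ofpair (p : R * R) : C := p.1 +i* p.2.

Lemma ofpair_continuous : continuous ofpair.
Proof.
move=> [x y] B /nbhsC[e e0 eB].
exists (ball x (e / 2), ball y (e / 2)) => /=.
  by split; exact: nbhsx_ballx (divr_gt0 e0 _).
move=> [u v] /= [xu yv]; apply: eB.
apply: le_lt_trans (nrm_le_ReIm _) _; rewrite ReB ImB /=.
by rewrite distrC (distrC v) [e]splitr ltrD.
Qed.

Lemma bounded_setC A : bounded_set A <-> exists M, forall z, A z -> nrm z <= M.
Proof.
split.
- rewrite /= /bounded_near => -[M [Mr h]].
  have /complex_realP[m mE] := Mr.
  exists (m + 1) => z Az; rewrite -lecR -norm_nrm; apply: h => //.
  by rewrite mE ltcR ltrDl.
- move=> [M h]; exists M%:C; split; first by rewrite complex_real.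
  move=> x; rewrite ltcE /= => /andP[/eqP xi xr] z Az.
  by rewrite norm_nrm lecE /= xi eqxx /= (le_trans (h z Az)) // ltW.
Qed.

Lemma compactC A : closed A -> bounded_set A -> compact A.
Proof.
move=> cA /bounded_setC[M hM].
apply: (subclosed_compact cA (B := ofpair @` (`[- M, M] `*` `[- M, M]))).
  apply: continuous_compact; last by apply: compact_setX; exact: segment_compact.
  exact/continuous_subspaceT/ofpair_continuous.
move=> z Az; exists (Re z, Im z); last by case: (z).
by split => /=; rewrite in_itv /= -ler_norml;
  [exact: le_trans (normRe_le _) (hM z Az)|exact: le_trans (normIm_le _) (hM z Az)].
Qed.

Lemma hausdorffC : hausdorff_space C.
Proof.
move=> p q pq; apply/eqP; rewrite -subr_eq0 -nrm_eq0; apply/negP => /negP.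
rewrite nrm_eq0 -nrm_gt0 => pq0; have e0 := divr_gt0 pq0 (ltr0n R 2).
have np : nbhs p [set w | nrm (w - p) < nrm (p - q) / 2] by apply/nbhsC; eexists; first exact: e0.
have nq : nbhs q [set w | nrm (w - q) < nrm (p - q) / 2] by apply/nbhsC; eexists; first exact: e0.
have [w [/= wp wq]] := pq _ _ np nq.
by have := ler_nrm_dist w p q; rewrite (nrmB p w) leNgt [ltRHS]splitr ltrD.
Qed.

Lemma compact_closedC A : compact A -> closed A.
Proof. by apply: compact_closed; exact: hausdorffC. Qed.

Lemma closureE_open A z : open A -> closure A z -> ~ A z -> boundary A z.
Proof. by move=> oA cz nz; split => //; rewrite /interior => /nbhs_singleton. Qed.

Lemma closed_boundary A : closed (boundary A).
Proof.
rewrite /boundary setDE; apply: closedI; first exact: closed_closure.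
exact/open_closedC/open_interior.
Qed.

Lemma boundary_open A z : open A -> boundary A z -> ~ A z.
Proof. by move=> oA [_ nz] Az; apply: nz; exact: open_nbhs_nbhs. Qed.

Lemma bounded_closure A : bounded_set A -> bounded_set (closure A).
Proof.
move=> /bounded_setC[M hM]; apply/bounded_setC; exists (M + 1) => z /closureC/(_ 1 ltr01)[w Aw wz].
rewrite -(subrK w z) (le_trans (ler_nrmD _ _)) // addrC lerD ?hM //.
by rewrite nrmB ltW.
Qed.

Lemma sub_bounded A B : A `<=` B -> bounded_set B -> bounded_set A.
Proof. by move=> AB /bounded_setC[M hM]; apply/bounded_setC; exists M => z /AB/hM. Qed.

Lemma compact_closureC A : bounded_set A -> compact (closure A).
Proof. by move=> bA; apply: compactC; [exact: closed_closure|exact: bounded_closure]. Qed.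

Lemma compact_boundary A : bounded_set A -> compact (boundary A).
Proof.
move=> bA; apply: compactC; first exact: closed_boundary.
by apply: sub_bounded (bounded_closure bA) => z [].
Qed.

Lemma compact_boundedC A : compact A -> bounded_set A.
Proof.
move=> cA; apply/bounded_setC.
have [->|A0] := eqVneq A set0; first by exists 0.
have cn : {within A, continuous nrm} by exact/continuous_subspaceT/nrm_continuous.
have /set0P/(compact_EVT_max)/(_ cA cn)[c _ h] := A0.
by exists (nrm c) => z Az; apply: h; rewrite inE.
Qed.

Lemma compact_dist A z : compact A -> ~ A z ->
  exists2 e, 0 < e & forall w, A w -> e <= nrm (w - z).
Proof.
move=> /compact_closedC/closed_openC/openC oA /oA[e e0 h]; exists e => // w Aw.
by rewrite leNgt; apply/negP => /h.
Qed.

Lemma openC_setC A : closed A -> forall z, ~ A z ->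
  exists2 e, 0 < e & forall w, nrm (w - z) < e -> ~ A w.
Proof. by move=> /closed_openC/openC. Qed.

(** The points of [D] satisfying [P] form a relatively clopen set. This serves as a continuation
    principle: for branches of logarithms, for the existence of a logarithm along a parameter, and
    for the attained values of a holomorphic map. *)
Lemma connected_locally_constant (X : topologicalType) (D : set X) (P : X -> Prop) :
  connected D ->
  (forall p, D p -> \forall q \near p, D q -> (P p <-> P q)) ->
  forall p q, D p -> D q -> P p -> P q.
Proof.
move=> cD h p q Dp Dq Pp.
suff DE : D `&` P = D by move: Dq; rewrite -DE => -[].
apply: cD; first by exists p.
(* An open set of the whole space is required whose trace on [D] is cut out by [P]; the interior of
   the union of [P] with the complement of [D] is one. *)
- exists (interior (~` D `|` P)); first exact: open_interior.
  rewrite predeqE => x; split=> -[Dx Px]; split => //.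
    rewrite /interior /=; have := h x Dx; apply: filterS => y hy.
    by have [Dy|nDy] := pselect (D y); [right; apply/(hy Dy)|left].
  by case: (interior_subset Px).
- exists (~` interior (~` D `|` ~` P)); first exact/open_closedC/open_interior.
  rewrite predeqE => x; split=> -[Dx Px]; split => //.
    by move=> /interior_subset[].
  apply: contrapT => nPx; apply: Px; rewrite /interior /=.
  have := h x Dx; apply: filterS => y hy.
  by have [Dy|nDy] := pselect (D y); [right => /(hy Dy)|left].
Qed.

End Basics.

(** * Connected components of plane sets *)

Section PlaneConnected.
Variable R : realType.
Local Notation C := (cplane R).
Implicit Types (z w p q : C) (A B D S : set C) (x y e r t : R).

Definition seg z w (t : R) : C := z + t%:C * (w - z).

Lemma seg0 z w : seg z w 0 = z.
Proof. by rewrite /seg mul0r addr0. Qed.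

Lemma seg1 z w : seg z w 1 = w.
Proof. by rewrite /seg mul1r addrC subrK. Qed.

Lemma segxx z t : seg z z t = z.
Proof. by rewrite /seg subrr mulr0 addr0. Qed.

Lemma seg_dist z w s t : nrm (seg z w s - seg z w t) = `|s - t| * nrm (w - z).
Proof. by rewrite /seg opprD addrACA subrr add0r -mulrBl nrmM -rmorphB nrm_real. Qed.

Lemma seg_continuous z w : continuous (seg z w).
Proof.
move=> t; apply/continuousRC => e e0.
exists (e / (nrm (w - z) + 1)); first by rewrite divr_gt0 // ltr_wpDl ?nrm_ge0.
move=> s st; rewrite seg_dist.
have n0 := nrm_ge0 (w - z).
rewrite (le_lt_trans (y := `|s - t| * (nrm (w - z) + 1))) ?ler_wpM2l ?lerDl //.
by rewrite -ltr_pdivlMr // ltr_wpDl.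
Qed.

Lemma Re_seg z w t : Re (seg z w t) = Re z + t * (Re w - Re z).
Proof. by rewrite /seg ReD ReM ReB /= mul0r subr0. Qed.

Lemma Im_seg z w t : Im (seg z w t) = Im z + t * (Im w - Im z).
Proof. by rewrite /seg ImD ImM ImB /= mul0r addr0. Qed.

Lemma in01 t : `[0, 1]%classic t = (0 <= t <= 1) :> Prop.
Proof. by rewrite /= in_itv. Qed.

Definition starlike A z := A z /\ forall w t, A w -> 0 <= t <= 1 -> A (seg z w t).

Lemma starlike_connected A z : starlike A z -> connected A.
Proof.
move=> [Az sA].
have -> : A = \bigcup_(w in A) (seg z w @` `[0, 1]).
  rewrite predeqE => w; split=> [Aw|[u Au [t]]].
    by exists w => //; exists 1; rewrite ?seg1 // in01 ler01 lexx.
  by rewrite in01 => t01 <-; exact: sA.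
apply: bigcup_connected.
  by exists z => w Aw; exists 0; rewrite ?seg0 // in01 lexx ler01.
move=> w Aw; apply: connected_continuous_connected.
  exact: segment_connected.
exact/continuous_subspaceT/seg_continuous.
Qed.

Definition cconvex A := forall z w t, A z -> A w -> 0 <= t <= 1 -> A (seg z w t).

Definition cball z r : set C := [set w | nrm (w - z) < r].

Lemma cball_convex z r : cconvex (cball z r).
Proof.
move=> u w t; rewrite /cball /= => uz wz /andP[t0 t1].
have -> : seg u w t - z = (1 - t)%:C * (u - z) + t%:C * (w - z).
  by rewrite /seg rmorphB /= rmorph1; ring.
apply: le_lt_trans (ler_nrmD _ _) _; rewrite !nrmM !nrm_real.
rewrite (ger0_norm t0) ger0_norm ?subr_ge0 //.
have [->|tn0] := eqVneq t 0; first by rewrite subr0 mul0r addr0 mul1r.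
have tp : 0 < t by rewrite lt_neqAle eq_sym tn0.
have -> : r = (1 - t) * r + t * r by ring.
by rewrite ler_ltD ?ltr_pM2l // ler_wpM2l ?subr_ge0 // ltW.
Qed.

Lemma cball_center z r : 0 < r -> cball z r z.
Proof. by rewrite /cball /= subrr nrm0. Qed.

Lemma cball_connected z r : connected (cball z r).
Proof.
have [r0|r0] := ltP 0 r.
  apply: (@starlike_connected _ z); split; first exact: cball_center.
  by move=> w t ? ?; apply: cball_convex => //; exact: cball_center.
suff -> : cball z r = set0 by exact: connected0.
rewrite -subset0 => w /= wr; have := nrm_ge0 (w - z).
by rewrite leNgt (lt_le_trans wr).
Qed.

Lemma cball_open z r : open (cball z r).
Proof.
apply/openC => w /= wz; exists (r - nrm (w - z)); first by rewrite subr_gt0.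
move=> u; rewrite ltrBrDr; apply: le_lt_trans; exact: ler_nrm_dist.
Qed.

Lemma component_absorb A B z : connected B -> B `<=` A ->
  (connected_component A z `&` B) !=set0 -> B `<=` connected_component A z.
Proof.
move=> cB BA [w [Azw Bw]].
rewrite (same_connected_component Azw).
exact: connected_component_max.
Qed.

Lemma open_component A z : open A -> open (connected_component A z).
Proof.
move=> /openC oA; apply/openC => w Kw.
have [e e0 he] := oA w (connected_component_sub Kw).
exists e => // u uw; apply: (@component_absorb A (cball w e)) => //.
  exact: cball_connected.
by exists w; split => //; exact: cball_center.
Qed.

Lemma boundary_component A z : open A ->
  boundary (connected_component A z) `<=` ~` A.
Proof.
move=> oA w bw Aw; have := boundary_open (open_component oA) bw; apply.
have [cw _] := bw; have /openC/(_ w Aw)[e e0 he] := oA.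
have /closureC/(_ e e0)[u Ku uw] := cw.
apply: (@component_absorb A (cball w e)) => //; first exact: cball_connected.
- by exists u.
- exact: cball_center.
Qed.

(** The ray from [z] away from the origin never comes closer to the origin than [z], so it avoids
    [S] and lies in the component. *)
Lemma unbounded_component S z M : 0 <= M -> (forall w, S w -> nrm w <= M) -> M < nrm z ->
  ~ bounded_set (connected_component (~` S) z).
Proof.
move=> M0 hS Mz; pose D : set C := [set w | exists2 t, 1 <= t & w = t%:C * z].
have nz0 := le_lt_trans M0 Mz.
have cD : connected D.
  apply: (@starlike_connected _ z); split; first by exists 1; rewrite ?mul1r.
  move=> w t [s s1 ->] /andP[t0 t1]; exists (1 + t * (s - 1)).
    by rewrite lerDl mulr_ge0 // subr_ge0.
  by rewrite /seg rmorphD rmorphM rmorphB /= rmorph1; ring.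
have DS : D `<=` ~` S.
  move=> w [t t1 ->] /hS; rewrite nrmM nrm_real leNgt => /negP; apply.
  rewrite ger0_norm ?(le_trans ler01) // (lt_le_trans Mz) //.
  by rewrite ler_peMl // ltW.
have Dz : D z by exists 1; rewrite ?mul1r.
move=> /(sub_bounded (connected_component_max Dz DS cD))/bounded_setC[K hK].
pose t := 1 + `|K| / nrm z.
have t1 : 1 <= t by rewrite lerDl divr_ge0 // ltW.
have /hK : D (t%:C * z) by exists t.
rewrite nrmM nrm_real ger0_norm ?(le_trans ler01) // /t mulrDl mul1r.
rewrite divfK ?gt_eqF // => h; have := ler_norm K; lra.
Qed.

End PlaneConnected.

(** * Antiderivatives of real continuous functions *)

Section Primitive.
Variable R : realType.
Implicit Types (f g P : R -> R) (a b c x y M : R).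

Definition primitive f P := forall x, is_derive x (1 : R) P (f x).

Lemma derive0_const P a : (forall x, a < x -> is_derive x (1 : R) P 0) ->
  forall x y, a < x -> a < y -> P x = P y.
Proof.
move=> h; suff H x y : x <= y -> a < x -> P x = P y.
  by move=> x y ax ay; have [/H->//|/ltW/H->] := leP x y.
move=> xy ax; have D z : x <= z -> is_derive z (1 : R) P 0.
  by move=> xz; exact: h (lt_le_trans ax xz).
have [z|z|c _] := @MVT_segment R P (fun=> 0) x y xy.
- by rewrite in_itv /= => /andP[/ltW xz _]; exact: D.
- apply: derivable_within_continuous => z'; rewrite in_itv /= => /andP[xz _].
  by have [] := D z' xz.
by rewrite mul0r => /eqP; rewrite subr_eq0 => /eqP.
Qed.

(** The integral from [b] is an antiderivative only to the right of [b], so the base point has to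
    move with [x]. Normalizing the value at 0 makes the base point immaterial as long as it lies to
    the left of both 0 and [x]. *)
Lemma primitive_exists f : continuous f -> exists P, primitive f P.
Proof.
move=> cf.
pose mu := @lebesgue_measure R.
pose F b x := (\int[mu]_(t in [set` `[b, x]]) f t)%R.
have dF b x : b < x -> is_derive x (1 : R) (F b) (f x).
  move=> bx; have [] := @continuous_FTC1_closed R f b x (x + 1) _ _ bx (cf x).
  - by rewrite ltrDl.
  - apply: continuous_compact_integrable; first exact: segment_compact.
    exact: continuous_subspaceT.
  - by move=> d <-; rewrite derive1E; exact: derivableP.
have FE b b' x y : b < x -> b' < x -> b < y -> b' < y -> F b x - F b y = F b' x - F b' y.
  move=> bx b'x bY b'y; suff : F b x - F b' x = F b y - F b' y by lra.
  apply: (@derive0_const (fun x => F b x - F b' x) (Num.max b b')).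
  - move=> z; rewrite gt_max => /andP[bz b'z].
    by rewrite -(subrr (f z)); apply: is_deriveB; exact: dF.
  - by rewrite gt_max bx.
  - by rewrite gt_max bY.
pose B x := - `|x| - 1.
exists (fun x => F (B x) x - F (B x) 0) => x.
have Blt y z : `|y| < `|z| + 1 -> B z < y.
  by rewrite /B; have := ler_norm (- y); rewrite normrN; lra.
(* The 2 leaves room for every [y] within distance 1 of [x]. *)
pose b := - `|x| - 2.
have bx : b < x by rewrite /b; have := ler_norm (- x); rewrite normrN; lra.
have b0 : b < 0 by rewrite /b; have := normr_ge0 x; lra.
apply: (@near_eq_is_derive _ _ _ (fun y => F b y - F b 0)).
  apply/nbhsR; exists 1 => // y yx.
  apply: FE => //.
  - rewrite /b; have := ler_norm (- y); have := ler_norm (- (y - x)).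
    by have := ler_normD (y - x) x; rewrite !normrN subrK; lra.
  - by apply: Blt; lra.
  - by apply: Blt; rewrite normr0 ltr_wpDl.
by rewrite -[f x]subr0; apply: is_deriveB; exact: dF.
Qed.

(** A chosen antiderivative, the zero function if there is none. Integrals defined as its increments
    are additive over intervals unconditionally, and their estimates reduce to the mean value
    theorem. *)
Definition prim f : R -> R := xget (fun=> 0) [set P | primitive f P].

Definition itg f a b := prim f b - prim f a.

Lemma primP f : continuous f -> primitive f (prim f).
Proof. by move=> /primitive_exists[P fP]; rewrite /prim; case: xgetP => //= /(_ P). Qed.

Lemma itgE f P a b : primitive f P -> itg f a b = P b - P a.
Proof.
move=> fP.
have pr : primitive f (prim f) by rewrite /prim; case: xgetP => //= /(_ P).
rewrite /itg; suff : prim f b - P b = prim f a - P a by lra.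
apply: (@is_derive_0_is_cst _ (fun x => prim f x - P x)) => x.
by rewrite -(subrr (f x)); apply: is_deriveB.
Qed.

Lemma itg_split f a b c : itg f a b = itg f a c + itg f c b.
Proof. by rewrite /itg; ring. Qed.

Lemma itgD f g a b : continuous f -> continuous g ->
  itg (fun x => f x + g x) a b = itg f a b + itg g a b.
Proof.
move=> cf cg; rewrite (@itgE _ (fun x => prim f x + prim g x)).
  by rewrite /itg; ring.
by move=> x; apply: is_deriveD; exact: primP.
Qed.

Lemma itgB f g a b : continuous f -> continuous g ->
  itg (fun x => f x - g x) a b = itg f a b - itg g a b.
Proof.
move=> cf cg; rewrite (@itgE _ (fun x => prim f x - prim g x)).
  by rewrite /itg; ring.
by move=> x; apply: is_deriveB; exact: primP.
Qed.

Lemma itgZ f k a b : continuous f -> itg (fun x => k * f x) a b = k * itg f a b.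
Proof.
move=> cf; rewrite (@itgE _ (fun x => k * prim f x)).
  by rewrite /itg; ring.
by move=> x; have := primP cf x => ?; apply: is_deriveZ.
Qed.

Lemma itg_cst k a b : itg (fun=> k) a b = k * (b - a).
Proof.
rewrite (@itgE _ (fun x => k * x)); first by ring.
move=> x; rewrite -[k in is_derive _ _ _ k]mulr1.
by apply: is_deriveZ; exact: is_derive_id.
Qed.

Lemma itg_id a b : itg id a b = (b ^+ 2 - a ^+ 2) / 2.
Proof.
rewrite (@itgE _ (fun x => 2^-1 * (x * x))); first by field.
move=> x; apply: is_derive_eq => /=.
by rewrite /GRing.scale /=; field.
Qed.

Lemma itg_MVT f a b : a <= b -> continuous f ->
  exists2 c, a <= c <= b & itg f a b = f c * (b - a).
Proof.
move=> ab cf; have dP := primP cf.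
have [z _|z|c] := @MVT_segment R (prim f) f a b ab; first exact: dP.
  by apply: derivable_within_continuous => z' _; have [] := dP z'.
by rewrite in_itv /= => cab E; exists c.
Qed.

Lemma itg_le f a b M : a <= b -> continuous f ->
  (forall x, a <= x <= b -> `|f x| <= M) -> `|itg f a b| <= M * (b - a).
Proof.
move=> ab cf h; have [c cab ->] := itg_MVT ab cf.
by rewrite normrM (ger0_norm (x := b - a)) ?subr_ge0 // ler_wpM2r ?subr_ge0 // h.
Qed.

Lemma itg_ge0 f a b : a <= b -> continuous f ->
  (forall x, a <= x <= b -> 0 <= f x) -> 0 <= itg f a b.
Proof.
move=> ab cf h; have [c cab ->] := itg_MVT ab cf.
by rewrite mulr_ge0 ?subr_ge0 // h.
Qed.

(** Positivity at [a] would persist on a short interval and contribute a positive amount there. Only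
    the left endpoint is concluded: it is the one value that the maximum principle reads off. *)
Lemma itg_eq0 f a b : a < b -> continuous f ->
  (forall x, a <= x <= b -> 0 <= f x) -> itg f a b = 0 -> f a = 0.
Proof.
move=> ab cf h E; apply/eqP/negPn/negP => fa0.
have fa : 0 < f a by rewrite lt_neqAle eq_sym fa0 h ?lexx // ltW.
have /nbhsR[e e0 he] : nbhs a [set y | 0 < f y].
  apply: (cf a [set y | 0 < y]); apply/nbhsR; exists (f a) => // y.
  by rewrite ltr_norml => /andP[] /=; lra.
pose c := a + Num.min (e / 2) (b - a).
have m0 : 0 < Num.min (e / 2) (b - a) by rewrite lt_min divr_gt0 // subr_gt0.
have ac : a < c by rewrite ltrDl.
have cb : c <= b by rewrite /c -lerBrDl ge_min lexx orbT.
have ce : c - a < e.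
  by rewrite /c addrC addKr gt_min; apply/orP; left; rewrite ltr_pdivrMr //; lra.
have [x /andP[ax xc] I1] := itg_MVT (ltW ac) cf.
have I2 : 0 <= itg f c b.
  by apply: itg_ge0 => // y /andP[cy yb]; apply: h; rewrite yb (le_trans (ltW ac)).
have : 0 < itg f a c.
  rewrite I1 mulr_gt0 ?subr_gt0 //; apply: he.
  by rewrite ger0_norm ?subr_ge0 // (le_lt_trans _ ce) // lerB.
by have := itg_split f a b c; lra.
Qed.

End Primitive.

(** * Complex derivatives and the exponential *)

Section ComplexDerivative.
Variable R : realType.
Local Notation C := (cplane R).
Implicit Types (z w p q d : C) (x y e r t : R) (f g h : C -> C).

(** Written with an error term instead of a quotient, so that compositions and the point [w = z]
    need no case distinction. *)
Definition cderive f z d := forall e, 0 < e -> exists2 r, 0 < r &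
  forall w, nrm (w - z) < r -> nrm (f w - f z - d * (w - z)) <= e * nrm (w - z).

Definition cdiff f z := exists d, cderive f z d.

Lemma derivable_cdiff f z : derivable f z 1 -> cdiff f z.
Proof.
move=> /cvg_ex[/= d hd]; exists d => e e0.
have : nbhs d [set w | nrm (w - d) < e] by apply/nbhsC; exists e.
move=> /hd /=; rewrite /fmap /= /dnbhs /within /= => /nbhsC[r r0 hr].
exists r => // w wz.
have [->|wz0] := eqVneq w z; first by rewrite !subrr mulr0 subr0 nrm0 mulr0.
have u0 : w - z != 0 by rewrite subr_eq0.
have /= := hr (w - z); rewrite subr0 => /(_ wz u0).
rewrite /GRing.scale /= mulr1 subrK => /ltW hle.
have -> : f w - f z - d * (w - z) = ((w - z)^-1 * (f w - f z) - d) * (w - z).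
  by rewrite mulrBl mulrAC mulVf // mul1r.
by rewrite nrmM ler_wpM2r ?nrm_ge0.
Qed.

Lemma cdiff_continuous f z : cdiff f z -> {for z, continuous f}.
Proof.
move=> [d hd]; apply/continuousCC => e e0; have [r r0 hr] := hd 1 ltr01.
have K0 : 0 < 1 + nrm d by rewrite ltr_wpDr ?nrm_ge0.
exists (Num.min r (e / (1 + nrm d))); first by rewrite lt_min r0 divr_gt0.
move=> w; rewrite lt_min => /andP[/hr wr we].
have -> : f w - f z = (f w - f z - d * (w - z)) + d * (w - z) by rewrite subrK.
apply: le_lt_trans (ler_nrmD _ _) _; rewrite nrmM.
apply: (@le_lt_trans _ _ ((1 + nrm d) * nrm (w - z))).
  by rewrite mulrDl lerD.
by rewrite mulrC -ltr_pdivlMr.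
Qed.

Lemma cderive_comp f g z d d' : cderive f z d -> cderive g (f z) d' ->
  cderive (g \o f) z (d' * d).
Proof.
move=> fd gd e e0.
have cf : cdiff f z by exists d.
have K0 : 0 < 1 + nrm d by rewrite ltr_wpDr ?nrm_ge0.
have K0' : 0 < 1 + nrm d' by rewrite ltr_wpDr ?nrm_ge0.
have [r r0 hr] := fd (e / 2 / (1 + nrm d')) (divr_gt0 (divr_gt0 e0 (ltr0n _ 2)) K0').
have [r1 r10 hr1] := fd 1 ltr01.
have [s s0 hs] := gd (e / 2 / (1 + nrm d)) (divr_gt0 (divr_gt0 e0 (ltr0n _ 2)) K0).
have /continuousCC/(_ s s0)[t t0 ht] := cdiff_continuous cf.
exists (Num.min t (Num.min r r1)); first by rewrite !lt_min t0 r0.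
move=> w; rewrite !lt_min => /and3P[wt wr wr1] /=.
have -> : g (f w) - g (f z) - d' * d * (w - z) =
  (g (f w) - g (f z) - d' * (f w - f z)) + d' * (f w - f z - d * (w - z)) by ring.
apply: le_trans (ler_nrmD _ _) _; rewrite nrmM.
have h1 := hs _ (ht _ wt); have h2 := hr _ wr; have h3 := hr1 _ wr1.
have h4 : nrm (f w - f z) <= (1 + nrm d) * nrm (w - z).
  have -> : f w - f z = (f w - f z - d * (w - z)) + d * (w - z) by rewrite subrK.
  by apply: le_trans (ler_nrmD _ _) _; rewrite nrmM mulrDl lerD.
have E1 : e * nrm (w - z) =
    e / 2 / (1 + nrm d) * ((1 + nrm d) * nrm (w - z)) +
    (1 + nrm d') * (e / 2 / (1 + nrm d') * nrm (w - z)).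
  by field; rewrite !gt_eqF.
rewrite E1; apply: lerD.
  apply: le_trans h1 _; rewrite ler_wpM2l // ltW //.
  by rewrite !divr_gt0.
apply: ler_pM => //; rewrite ?nrm_ge0 //.
by rewrite lerDr.
Qed.

Lemma cdiff_comp f g z : cdiff f z -> cdiff g (f z) -> cdiff (g \o f) z.
Proof. by move=> [d fd] [d' gd]; exists (d' * d); exact: cderive_comp. Qed.

Lemma cdiff_near f g z r : 0 < r -> (forall w, nrm (w - z) < r -> f w = g w) ->
  cdiff f z -> cdiff g z.
Proof.
move=> r0 fg [d hd]; exists d => e e0; have [s s0 hs] := hd e e0.
exists (Num.min r s); first by rewrite lt_min r0.
move=> w; rewrite lt_min => /andP[wr ws].
by rewrite -!fg ?subrr ?nrm0 //; exact: hs.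
Qed.

Lemma cderive_affine z p q : cderive (fun w => p + q * w) z q.
Proof.
move=> e e0; exists 1 => // w _.
have -> : p + q * w - (p + q * z) - q * (w - z) = 0 by ring.
by rewrite nrm0 mulr_ge0 ?nrm_ge0 // ltW.
Qed.

Lemma cdiff_affine z p q : cdiff (fun w => p + q * w) z.
Proof. by exists q; exact: cderive_affine. Qed.

Lemma cdiff_inv z : z != 0 -> cdiff (fun w => w^-1) z.
Proof.
move=> z0; exists (- z ^- 2) => e e0; have nz0 : 0 < nrm z by rewrite nrm_gt0.
exists (Num.min (nrm z / 2) (e * nrm z ^+ 3 / 2)).
  by rewrite lt_min !divr_gt0 // mulr_gt0 // exprn_gt0.
move=> w; rewrite lt_min => /andP[w1 w2].
have nw : nrm z / 2 <= nrm w.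
  have := ler_nrmB z w; rewrite (nrmB z); lra.
have w0 : w != 0 by rewrite -nrm_gt0 (lt_le_trans _ nw) // divr_gt0.
have -> : w^-1 - z^-1 - - z ^- 2 * (w - z) = (w - z) ^+ 2 * (z ^- 2 * w^-1).
  by field; rewrite w0 z0.
have W0 : 0 < nrm w by rewrite nrm_gt0.
have -> : nrm ((w - z) ^+ 2 * (z ^- 2 * w^-1)) =
    nrm (w - z) / (nrm z ^+ 2 * nrm w) * nrm (w - z).
  by rewrite !expr2 !nrmM !nrmV nrmM; field; rewrite !gt_eqF.
apply: ler_wpM2r; first exact: nrm_ge0.
rewrite ler_pdivrMr ?mulr_gt0 ?exprn_gt0 //; apply: le_trans (ltW w2) _.
have -> : e * nrm z ^+ 3 / 2 = e * (nrm z ^+ 2 * (nrm z / 2)) by ring.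
by rewrite ler_wpM2l ?(ltW e0) // ler_wpM2l // exprn_ge0 // ltW.
Qed.

Lemma cdiff_shift f z p : cdiff f z -> cdiff (fun w => f w - p) z.
Proof.
move=> fz; have := @cdiff_comp f (fun w => - p + 1 * w) z fz (cdiff_affine _ _ _).
by apply: (@cdiff_near _ _ _ 1) => // w _ /=; rewrite mul1r addrC.
Qed.

Lemma cdiff_invB f z p : f z != p -> cdiff f z -> cdiff (fun w => (f w - p)^-1) z.
Proof.
move=> fp fz; apply: (@cdiff_comp (fun w => f w - p) (fun w => w^-1)).
  exact: cdiff_shift.
by apply: cdiff_inv; rewrite subr_eq0.
Qed.

Lemma cdiff_iter f n : (forall z, cdiff f z) -> forall z, cdiff (iter n f) z.
Proof.
move=> hf; elim: n => [|n IH] z.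
  by apply: cdiff_near (cdiff_affine z 0 1) => // w _; rewrite add0r mul1r.
exact: (@cdiff_comp (iter n f) f).
Qed.

Lemma is_derive_eps (f : R -> R) x (d : R) : is_derive x (1 : R) f d ->
  forall e, 0 < e -> exists2 r, 0 < r &
    forall y, `|y - x| < r -> `|f y - f x - d * (y - x)| <= e * `|y - x|.
Proof.
move=> [df <-] e e0.
have : nbhs ('D_1 f x) [set w | `|w - 'D_1 f x| < e] by apply/nbhsR; exists e.
move=> /df /=; rewrite /fmap /= /dnbhs /within /= => /nbhsR[r r0 hr].
exists r => // w wz.
have [->|wz0] := eqVneq w x; first by rewrite !subrr mulr0 subr0 normr0 mulr0.
have u0 : w - x != 0 by rewrite subr_eq0.
have /= := hr (w - x); rewrite subr0 => /(_ wz u0).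
rewrite /GRing.scale /= mulr1 subrK => /ltW hle.
have -> : f w - f x - 'D_1 f x * (w - x) =
   ((w - x)^-1 * (f w - f x) - 'D_1 f x) * (w - x).
  by rewrite mulrBl mulrAC mulVf // mul1r.
by rewrite normrM ler_wpM2r.
Qed.

Definition cexp (z : C) : C := (expR (Re z))%:C * (cos (Im z) +i* sin (Im z)).

Lemma cexpD z w : cexp (z + w) = cexp z * cexp w.
Proof.
rewrite /cexp ReD ImD expRD cosD sinD; apply: complex_ext; rewrite !(ReM, ImM) /=; ring.
Qed.

Lemma cexp0 : cexp 0 = 1.
Proof. by rewrite /cexp /= expR0 cos0 sin0; apply: complex_ext => /=; ring. Qed.

Lemma nrm_cis t : nrm (cos t +i* sin t : C) = 1.
Proof. by rewrite nrmE /= cos2Dsin2 sqrtr1. Qed.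

Lemma nrm_cexp z : nrm (cexp z) = expR (Re z).
Proof. by rewrite /cexp nrmM nrm_cis mulr1 nrm_real ger0_norm // expR_ge0. Qed.

Lemma cexp_neq0 z : cexp z != 0.
Proof. by rewrite -nrm_gt0 nrm_cexp expR_gt0. Qed.

Lemma cexpN z : cexp (- z) = (cexp z)^-1.
Proof.
apply: (mulfI (cexp_neq0 z)); rewrite -cexpD subrr cexp0 divff //.
exact: cexp_neq0.
Qed.

Lemma cexpB z w : cexp (z - w) = cexp z / cexp w.
Proof. by rewrite cexpD cexpN. Qed.

Lemma cderive_cexp0 : cderive cexp 0 1.
Proof.
(* Nine errors of size [e / 16 * N] add up below, four in the real part and five in the imaginary
   part. *)
move=> e e0; have e4 : 0 < e / 16 by rewrite divr_gt0.
have [r1 r10 h1] := is_derive_eps (is_derive_expR (0 : R)) e4.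
have [r2 r20 h2] := is_derive_eps (is_derive_cos (0 : R)) e4.
have [r3 r30 h3] := is_derive_eps (is_derive_sin (0 : R)) e4.
have [r4 r40 h4] := is_derive_eps (is_derive_expR (0 : R)) (@ltr01 R).
pose r := Num.min (Num.min r1 r2) (Num.min r3 (Num.min r4 (Num.min 1 (e / 16)))).
exists r; first by rewrite /r !lt_min r10 r20 r30 r40 e4 ltr01.
move=> w; rewrite !subr0 /r !lt_min => /andP[/andP[w1 w2] /and4P[w3 w4 w5 w6]].
rewrite cexp0 mul1r; set N := nrm w in w1 w2 w3 w4 w5 w6 *.
have Rw : `|Re w| <= N := normRe_le w.
have Iw : `|Im w| <= N := normIm_le w.
have N0 : 0 <= N := nrm_ge0 w.
have := h1 (Re w); rewrite subr0 expR0 mul1r => /(_ (le_lt_trans Rw w1)) k1.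
have := h2 (Im w); rewrite subr0 cos0 sin0 oppr0 mul0r subr0 => /(_ (le_lt_trans Iw w2)) k2.
have := h3 (Im w); rewrite subr0 cos0 sin0 subr0 mul1r => /(_ (le_lt_trans Iw w3)) k3.
have := h4 (Re w); rewrite subr0 expR0 mul1r => /(_ (le_lt_trans Rw w4)) k4.
set E := expR (Re w) in k1 k4 *.
set c := cos (Im w) in k2 *; set s := sin (Im w) in k3 *.
have EN : `|E - 1| <= 2 * N.
  have -> : E - 1 = (E - 1 - Re w) + Re w by ring.
  by apply: le_trans (ler_normD _ _) _; lra.
have E3 : 0 <= E <= 3.
  by rewrite expR_ge0 /=; have := ler_norm (E - 1); lra.
apply: le_trans (nrm_le_ReIm _) _.
have -> : Re (cexp w - 1 - w) = E * (c - 1) + (E - 1 - Re w).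
  by rewrite !ReB ReM /= -/E -/c -/s; ring.
have -> : Im (cexp w - 1 - w) = E * (s - Im w) + Im w * (E - 1).
  by rewrite !ImB ImM /= -/E -/c -/s; ring.
have eN : e / 16 * `|Re w| <= e / 16 * N by rewrite ler_wpM2l // ltW.
have eN' : e / 16 * `|Im w| <= e / 16 * N by rewrite ler_wpM2l // ltW.
have b1 : `|E * (c - 1)| <= 3 * (e / 16 * N).
  rewrite normrM; apply: ler_pM => //; last lra.
  by rewrite ger0_norm; lra.
have b2 : `|E * (s - Im w)| <= 3 * (e / 16 * N).
  rewrite normrM; apply: ler_pM => //; last lra.
  by rewrite ger0_norm; lra.
have b3 : `|Im w * (E - 1)| <= (e / 16) * (2 * N).
  rewrite normrM; apply: ler_pM => //; lra.
have eN0 : 0 <= e * N by rewrite mulr_ge0 // ltW.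
have := ler_normD (E * (c - 1)) (E - 1 - Re w).
have := ler_normD (E * (s - Im w)) (Im w * (E - 1)).
lra.
Qed.

Lemma cdiff_cexp z : cdiff cexp z.
Proof.
exists (cexp z) => e e0; have K0 : 0 < nrm (cexp z) by rewrite nrm_gt0 cexp_neq0.
have [r r0 hr] := cderive_cexp0 (divr_gt0 e0 K0); exists r => // w wz.
have := hr (w - z); rewrite !subr0 cexp0 mul1r => /(_ wz) h.
have -> : cexp w - cexp z - cexp z * (w - z) = cexp z * (cexp (w - z) - 1 - (w - z)).
  by rewrite !mulrBr -cexpD [z + _]addrC subrK mulr1.
rewrite nrmM mulrC; apply: le_trans (ler_wpM2r (ltW K0) h) _.
by rewrite mulrAC divfK ?gt_eqF.
Qed.

Lemma cexp_continuous : continuous cexp.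
Proof. by move=> z; apply: cdiff_continuous; exact: cdiff_cexp. Qed.

End ComplexDerivative.

(** * Goursat's theorem on rectangles *)

Section Goursat.
Variable R : realType.
Local Notation C := (cplane R).
Implicit Types (z w p q d : C) (x y e r t a b c M : R) (f g h H : C -> C) (u v : R -> C).

Definition citg u a b : C :=
  itg (fun t => Re (u t)) a b +i* itg (fun t => Im (u t)) a b.

Lemma Re_comp_continuous u : continuous u -> continuous (fun t => Re (u t)).
Proof. by move=> cu t; apply: continuous_comp; [exact: cu|exact: Re_continuous]. Qed.

Lemma Im_comp_continuous u : continuous u -> continuous (fun t => Im (u t)).
Proof. by move=> cu t; apply: continuous_comp; [exact: cu|exact: Im_continuous]. Qed.

Lemma citg_split u a b c : citg u a b = citg u a c + citg u c b.
Proof. by rewrite /citg (itg_split _ a b c) (itg_split (fun t => Im _) a b c). Qed.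

Lemma citgB u v a b : continuous u -> continuous v ->
  citg (fun t => u t - v t) a b = citg u a b - citg v a b.
Proof.
move=> cu cv; have [cu1 cu2] := (Re_comp_continuous cu, Im_comp_continuous cu).
have [cv1 cv2] := (Re_comp_continuous cv, Im_comp_continuous cv).
apply: complex_ext; rewrite ?ReB ?ImB /= -itgB //;
  by congr itg; apply/funext => t; rewrite ?ReB ?ImB.
Qed.

Lemma citg_le u a b M : a <= b -> continuous u ->
  (forall t, a <= t <= b -> nrm (u t) <= M) -> nrm (citg u a b) <= 2 * M * (b - a).
Proof.
move=> ab cu h; apply: le_trans (nrm_le_ReIm _) _ => /=.
rewrite -mulrA mulr_natl mulr2n lerD //; apply: itg_le => //.
- exact: Re_comp_continuous.
- by move=> x /h; apply: le_trans; exact: normRe_le.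
- exact: Im_comp_continuous.
- by move=> x /h; apply: le_trans; exact: normIm_le.
Qed.

Lemma itg_lin (k l : R) a b :
  itg (fun t => k + l * t) a b = k * (b - a) + l * (b ^+ 2 - a ^+ 2) / 2.
Proof.
rewrite itgD; last 2 first.
- exact: cst_continuous.
- by move=> t; apply: continuousM; [exact: cst_continuous|exact: cvg_id].
rewrite itg_cst itgZ; last by move=> t; exact: cvg_id.
by rewrite itg_id; ring.
Qed.

Definition hline H y x := H (x +i* y).
Definition vline H x y := H (x +i* y).

Lemma horizontal_continuous y : continuous (fun x : R => (x +i* y : C)).
Proof.
move=> x; apply/continuousRC => e e0; exists e => // t; apply: le_lt_trans.
by apply: le_trans (nrm_le_ReIm _) _; rewrite ReB ImB /= subrr normr0 addr0.
Qed.

Lemma vertical_continuous x : continuous (fun y : R => (x +i* y : C)).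
Proof.
move=> y; apply/continuousRC => e e0; exists e => // t; apply: le_lt_trans.
by apply: le_trans (nrm_le_ReIm _) _; rewrite ReB ImB /= subrr normr0 add0r.
Qed.

Lemma hline_continuous H y : continuous H -> continuous (hline H y).
Proof. by move=> cH x; exact: continuous_comp (@horizontal_continuous y x) (cH _). Qed.

Lemma vline_continuous H x : continuous H -> continuous (vline H x).
Proof. by move=> cH y; exact: continuous_comp (@vertical_continuous x y) (cH _). Qed.

(** The counterclockwise integral along the boundary of the rectangle with lower left corner
    [a +i* c], width [s] and height [t]; bisection halves these two lengths. *)
Definition rectJ H a s c t : C :=
  citg (hline H c) a (a + s) - citg (hline H (c + t)) a (a + s)
  + 'i%C * (citg (vline H (a + s)) c (c + t) - citg (vline H a) c (c + t)).

Lemma rectJ_quarter H a s c t :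
  rectJ H a s c t =
    rectJ H a (s / 2) c (t / 2) + rectJ H (a + s / 2) (s / 2) c (t / 2) +
    (rectJ H a (s / 2) (c + t / 2) (t / 2) +
     rectJ H (a + s / 2) (s / 2) (c + t / 2) (t / 2)).
Proof.
have E (x y : R) : x + y / 2 + y / 2 = x + y by field.
rewrite /rectJ !E.
rewrite (citg_split (hline H c) a (a + s) (a + s / 2)).
rewrite (citg_split (hline H (c + t)) a (a + s) (a + s / 2)).
rewrite (citg_split (vline H a) c (c + t) (c + t / 2)).
rewrite (citg_split (vline H (a + s)) c (c + t) (c + t / 2)).
by ring.
Qed.

Lemma rectJ_affine p q a s c t : rectJ (fun z => p + q * z) a s c t = 0.
Proof.
have hE y (u v : R) : citg (hline (fun z => p + q * z) y) u v =
  Complex ((Re p - Im q * y) * (v - u) + Re q * (v ^+ 2 - u ^+ 2) / 2)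
  ((Im p + Re q * y) * (v - u) + Im q * (v ^+ 2 - u ^+ 2) / 2).
  rewrite -!itg_lin /citg; congr Complex; congr itg;
    by apply/funext => x; rewrite /hline ?(ReD, ImD, ReM, ImM) /=; ring.
have vE x (u v : R) : citg (vline (fun z => p + q * z) x) u v =
  Complex ((Re p + Re q * x) * (v - u) + (- Im q) * (v ^+ 2 - u ^+ 2) / 2)
  ((Im p + Im q * x) * (v - u) + Re q * (v ^+ 2 - u ^+ 2) / 2).
  rewrite -!itg_lin /citg; congr Complex; congr itg;
    by apply/funext => y; rewrite /vline ?(ReD, ImD, ReM, ImM) /=; ring.
rewrite /rectJ !hE !vE.
by apply: complex_ext; rewrite ?(ReD, ImD, ReN, ImN, ReM, ImM) /=; field.
Qed.

Lemma rectJB H1 H2 a s c t : continuous H1 -> continuous H2 ->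
  rectJ (fun z => H1 z - H2 z) a s c t = rectJ H1 a s c t - rectJ H2 a s c t.
Proof.
move=> c1 c2; rewrite /rectJ.
have hB y (u v : R) : citg (hline (fun z => H1 z - H2 z) y) u v =
    citg (hline H1 y) u v - citg (hline H2 y) u v.
  by rewrite -citgB //; exact: hline_continuous.
have vB x (u v : R) : citg (vline (fun z => H1 z - H2 z) x) u v =
    citg (vline H1 x) u v - citg (vline H2 x) u v.
  by rewrite -citgB //; exact: vline_continuous.
by rewrite !hB !vB; ring.
Qed.

Lemma rectJ_le H a s c t M : 0 <= s -> 0 <= t -> continuous H ->
  (forall x y, a <= x <= a + s -> c <= y <= c + t -> nrm (H (x +i* y)) <= M) ->
  nrm (rectJ H a s c t) <= 4 * M * (s + t).
Proof.
move=> s0 t0 cH h; rewrite /rectJ.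
have ni : nrm ('i%C : C) = 1 by rewrite nrmE /= expr0n expr1n add0r sqrtr1.
have hb y : c <= y <= c + t -> nrm (citg (hline H y) a (a + s)) <= 2 * M * s.
  move=> cy; rewrite -[s in leRHS](addKr a) [- a + _]addrC.
  apply: citg_le; rewrite ?lerDl //; first exact: hline_continuous.
  by move=> x ax; exact: h.
have vb x : a <= x <= a + s -> nrm (citg (vline H x) c (c + t)) <= 2 * M * t.
  move=> cy; rewrite -[t in leRHS](addKr c) [- c + _]addrC.
  apply: citg_le; rewrite ?lerDl //; first exact: vline_continuous.
  by move=> y ay; exact: h.
have := hb c; have := hb (c + t); have := vb a; have := vb (a + s).
rewrite !lexx !lerDl s0 t0 /= => /(_ isT) h1 /(_ isT) h2 /(_ isT) h3 /(_ isT) h4.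
apply: le_trans (ler_nrmD _ _) _; rewrite nrmM ni mul1r.
have := ler_nrmD (citg (hline H c) a (a + s)) (- citg (hline H (c + t)) a (a + s)).
have := ler_nrmD (citg (vline H (a + s)) c (c + t)) (- citg (vline H a) c (c + t)).
rewrite !nrmN; lra.
Qed.

Lemma half_pow_lt M r : 0 <= M -> 0 < r -> exists n, M / 2 ^+ n < r.
Proof.
move=> M0 r0; exists (Num.bound (M / r)).
have := archi_boundP (divr_ge0 M0 (ltW r0)); set n := Num.bound _ => h.
rewrite ltr_pdivrMr ?exprn_gt0 // mulrC -ltr_pdivrMr // (lt_trans h) //.
by rewrite -natrX ltr_nat ltn_expl.
Qed.

Lemma nested_point (u s : nat -> R) : (forall n, 0 <= s n) ->
  (forall n, u n <= u n.+1) -> (forall n, u n.+1 + s n.+1 <= u n + s n) ->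
  exists x, forall n, u n <= x <= u n + s n.
Proof.
move=> s0 uS vS.
have um n m : (n <= m)%N -> u n <= u m.
  elim: m => [|m IH]; first by rewrite leqn0 => /eqP ->.
  by rewrite leq_eqVlt => /predU1P[->//|/IH h]; exact: le_trans (uS m).
have vm n m : (n <= m)%N -> u m + s m <= u n + s n.
  elim: m => [|m IH]; first by rewrite leqn0 => /eqP ->.
  by rewrite leq_eqVlt => /predU1P[->//|/IH h]; exact: le_trans (vS m) _.
have uv n m : u n <= u m + s m.
  have [/um h|/ltnW/vm h] := leqP n m; first by rewrite (le_trans h) // lerDl.
  by apply: le_trans h; rewrite lerDl.
exists (sup (range u)) => n; apply/andP; split.
  apply: ub_le_sup; last by exists n.
  by exists (u 0 + s 0) => _ [m _ <-].
by apply: ge_sup; [exists (u 0); exists 0|move=> _ [m _ <-]].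
Qed.

(** Some quarter keeps at least a fourth of the integral. Near the common point of the nested
    rectangles [H] is affine up to an error small compared with their size, and affine maps have
    integral 0. Continuity is asked on the whole plane because integrals come from global
    antiderivatives. *)
Lemma goursat H a s c t : 0 <= s -> 0 <= t -> continuous H ->
  (forall x y, a <= x <= a + s -> c <= y <= c + t -> cdiff H (x +i* y)) ->
  rectJ H a s c t = 0.
Proof.
move=> s0 t0 cH dH.
have step (p : R * R) n : exists q : R * R,
    [/\ p.1 <= q.1, q.1 + s / 2 ^+ n.+1 <= p.1 + s / 2 ^+ n,
        p.2 <= q.2, q.2 + t / 2 ^+ n.+1 <= p.2 + t / 2 ^+ n &
        nrm (rectJ H p.1 (s / 2 ^+ n) p.2 (t / 2 ^+ n)) <=
        4 * nrm (rectJ H q.1 (s / 2 ^+ n.+1) q.2 (t / 2 ^+ n.+1))].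
  have E (k : R) : k / 2 ^+ n / 2 = k / 2 ^+ n.+1 by rewrite exprSr invfM mulrA.
  have E2 (k : R) : k / 2 ^+ n = k / 2 ^+ n.+1 + k / 2 ^+ n.+1 by rewrite -E -splitr.
  have P (k : R) : 0 <= k -> 0 <= k / 2 ^+ n.+1 by move=> ?; rewrite divr_ge0 // exprn_ge0.
  rewrite (rectJ_quarter H p.1) !E.
  set J1 := rectJ _ _ _ _ _; set J2 := rectJ _ _ _ _ _; set J3 := rectJ _ _ _ _ _; set J4 := rectJ _ _ _ _ _.
  set N := nrm _.
  have NE : N <= nrm J1 + nrm J2 + nrm J3 + nrm J4.
    have := ler_nrmD (J1 + J2) (J3 + J4); have := ler_nrmD J1 J2; have := ler_nrmD J3 J4.
    by rewrite -/N; lra.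
  have {P} [Ps Pt] := (P s s0, P t t0).
  have [h|h1] := leP N (4 * nrm J1).
    by exists p; split => //; rewrite E2; lra.
  have [h|h2] := leP N (4 * nrm J2).
    by exists (p.1 + s / 2 ^+ n.+1, p.2); split => //=; rewrite ?[s / 2 ^+ n]E2 ?[t / 2 ^+ n]E2; lra.
  have [h|h3] := leP N (4 * nrm J3).
    by exists (p.1, p.2 + t / 2 ^+ n.+1); split => //=; rewrite ?[s / 2 ^+ n]E2 ?[t / 2 ^+ n]E2; lra.
  have [h|h4] := leP N (4 * nrm J4).
    by exists (p.1 + s / 2 ^+ n.+1, p.2 + t / 2 ^+ n.+1); split => //=; rewrite ?[s / 2 ^+ n]E2 ?[t / 2 ^+ n]E2; lra.
  lra.
have /choice [F FP] : forall pn : (R * R) * nat, exists q : R * R,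
    [/\ pn.1.1 <= q.1, q.1 + s / 2 ^+ pn.2.+1 <= pn.1.1 + s / 2 ^+ pn.2,
        pn.1.2 <= q.2, q.2 + t / 2 ^+ pn.2.+1 <= pn.1.2 + t / 2 ^+ pn.2 &
        nrm (rectJ H pn.1.1 (s / 2 ^+ pn.2) pn.1.2 (t / 2 ^+ pn.2)) <=
        4 * nrm (rectJ H q.1 (s / 2 ^+ pn.2.+1) q.2 (t / 2 ^+ pn.2.+1))].
  by move=> [p n]; exact: step.
pose fix U n := if n is n.+1 then F (U n, n) else (a, c).
have US n := FP (U n, n).
have sn n : 0 <= s / 2 ^+ n by rewrite divr_ge0 // exprn_ge0.
have tn n : 0 <= t / 2 ^+ n by rewrite divr_ge0 // exprn_ge0.
have [x hx] : exists x, forall n, (U n).1 <= x <= (U n).1 + s / 2 ^+ n.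
  by apply: nested_point => // n; have [] := US n.
have [y hy] : exists y, forall n, (U n).2 <= y <= (U n).2 + t / 2 ^+ n.
  by apply: nested_point => // n; have [] := US n.
have JU n : nrm (rectJ H a s c t) <=
    4 ^+ n * nrm (rectJ H (U n).1 (s / 2 ^+ n) (U n).2 (t / 2 ^+ n)).
  elim: n => [|n IH]; first by rewrite expr0 mul1r !divr1.
  apply: le_trans IH _; rewrite exprSr -mulrA ler_wpM2l ?exprn_ge0 //.
  by have [] := US n.
have [d hd] : cdiff H (x +i* y).
  by apply: dH; [have := hx 0|have := hy 0]; rewrite /= divr1.
apply/eqP; rewrite -nrm_eq0 eq_le nrm_ge0 andbT.
set K := s + t; have K0 : 0 <= K by rewrite addr_ge0.
apply/ler_addgt0Pl => e e0; rewrite addr0.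
(* The factor [4 ^+ n] cancels against the size of the [n]-th rectangle, leaving [4 * K ^+ 2] times
   this constant; the summand 1 avoids a division by 0 for a degenerate rectangle. *)
have e1 : 0 < e / (4 * K ^+ 2 + 1).
  by rewrite divr_gt0 // ltr_wpDl // mulr_ge0 // sqr_ge0.
have [r r0 hr] := hd _ e1.
have [n nr] := half_pow_lt K0 r0.
apply: le_trans (JU n) _.
pose A z := (H (x +i* y) - d * (x +i* y)) + d * z.
have cA : continuous A by move=> z; apply: cdiff_continuous; exact: cdiff_affine.
have -> : rectJ H (U n).1 (s / 2 ^+ n) (U n).2 (t / 2 ^+ n) =
    rectJ (fun z => H z - A z) (U n).1 (s / 2 ^+ n) (U n).2 (t / 2 ^+ n).
  by rewrite rectJB // /A rectJ_affine subr0.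
set M := e / (4 * K ^+ 2 + 1) * (K / 2 ^+ n).
have KE : K / 2 ^+ n = s / 2 ^+ n + t / 2 ^+ n by rewrite /K mulrDl.
have hM : nrm (rectJ (fun z => H z - A z) (U n).1 (s / 2 ^+ n) (U n).2 (t / 2 ^+ n))
    <= 4 * M * (K / 2 ^+ n).
  rewrite [X in _ <= _ * X]KE; apply: (rectJ_le (sn n) (tn n)).
    by move=> z; apply: continuousB; [exact: cH|exact: cA].
  move=> x' y' hx' hy'.
  have dK : nrm ((x' +i* y') - (x +i* y)) <= K / 2 ^+ n.
    apply: le_trans (nrm_le_ReIm _) _; rewrite ReB ImB KE /=.
    have := hx n; have := hy n => hyn hxn.
    by apply: lerD; rewrite ler_norml; lra.
  have -> : H (x' +i* y') - A (x' +i* y') =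
     H (x' +i* y') - H (x +i* y) - d * ((x' +i* y') - (x +i* y)).
    by rewrite /A; ring.
  apply: le_trans (hr _ (le_lt_trans dK nr)) _.
  by rewrite ler_wpM2l // ltW.
apply: le_trans (ler_wpM2l _ hM) _; first by rewrite exprn_ge0.
have -> : 4 ^+ n = 2 ^+ n * 2 ^+ n :> R by rewrite -exprMn; congr (_ ^+ _); ring.
have -> : 2 ^+ n * 2 ^+ n * (4 * M * (K / 2 ^+ n)) = e * (4 * K ^+ 2 / (4 * K ^+ 2 + 1)).
  rewrite /M; field.
  by rewrite expf_neq0 // gt_eqF // ltr_wpDl // mulr_ge0 // sqr_ge0.
rewrite -[leRHS]mulr1 ler_wpM2l ?(ltW e0) // ler_pdivrMr ?mul1r ?lerDl //.
by rewrite ltr_wpDl // mulr_ge0 // sqr_ge0.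
Qed.

End Goursat.

(** * Maximum principle and open mapping *)

Section MaximumPrinciple.
Variable R : realType.
Local Notation C := (cplane R).
Implicit Types (z w p q d : C) (x y e r t a b c M : R) (f g h H : C -> C) (W D : set C).

(** Capping the real part keeps [z0 + cexp z] in a disc around [z0], so that composing [h] with it
    gives a function continuous on the whole plane, as [goursat] demands, and unaltered to the left
    of [X]. *)
Let clamp (X : R) z : C := Num.min (Re z) X +i* Im z.

Let clamp_continuous X : continuous (clamp X).
Proof.
move=> z; apply/continuousCC => e e0; exists (e / 2); first by rewrite divr_gt0.
move=> w wz; apply: le_lt_trans (nrm_le_ReIm _) _; rewrite ReB ImB /= -ImB.
have := normIm_le (w - z); have := normRe_le (w - z); rewrite ReB => h1 h2.
suff : `|Num.min (Re w) X - Num.min (Re z) X| <= `|Re w - Re z| by lra.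
have [wX|wX] := leP (Re w) X; have [zX|zX] := leP (Re z) X => //.
- by rewrite ler_norml; have := ler_norm (Re w - Re z);
    have := ler_norm (Re z - Re w); rewrite distrC; lra.
- by rewrite ler_norml; have := ler_norm (Re w - Re z);
    have := ler_norm (Re z - Re w); rewrite distrC; lra.
- by rewrite subrr normr0.
Qed.

(* The circular mean of h at z0 is a vertical integral of h (z0 + cexp z); by
   Goursat and periodicity it does not depend on the radius. *)
Lemma local_max_real h z0 r0 (m : R) : h z0 = m%:C ->
  (forall w, nrm (w - z0) < r0 -> cdiff h w) ->
  (forall w, nrm (w - z0) < r0 -> Re (h w) <= m) ->
  forall r, 0 < r < r0 -> Re (h (z0 + r%:C)) = m.
Proof.
move=> hz0 dh hm r /andP[r_gt0 rr0].
(* The cap sits at the radius halfway between [r] and [r0], so the circle of radius [r] lies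
   strictly inside the unaltered region. *)
pose X := ln ((r + r0) / 2).
have mid0 : 0 < (r + r0) / 2 by rewrite divr_gt0 // addr_gt0 // (lt_trans r_gt0).
have eX : expR X = (r + r0) / 2 by rewrite lnK.
pose u z := z0 + cexp (clamp X z).
have ux z : nrm (u z - z0) < r0.
  rewrite /u addrC addKr nrm_cexp /=; apply: (@le_lt_trans _ _ (expR X)).
    by rewrite ler_expR ge_min lexx orbT.
  by rewrite eX; lra.
pose H z := h (u z).
have cu : continuous u.
  move=> z; apply: (@continuousD _ _ _ (fun=> z0) (fun z => cexp (clamp X z))).
    exact: cst_continuous.
  by apply: continuous_comp; [exact: clamp_continuous|exact: cexp_continuous].
have cH : continuous H.
  by move=> z; apply: continuous_comp; [exact: cu|exact/cdiff_continuous/dh].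
have dH z : Re z < X -> cdiff H z.
  move=> zX; apply: (@cdiff_near _ (fun w => h (z0 + 1 * cexp w)) _ _ (X - Re z)).
  - by rewrite subr_gt0.
  - move=> w wz; rewrite /H /u mul1r; congr (h (z0 + cexp _)).
    have := Re_le (w - z); rewrite ReB => k.
    have wX : Re w <= X by lra.
    by apply: complex_ext => //=; rewrite /Num.min; case: ltP => //; lra.
  - apply: (@cdiff_comp _ (fun w => z0 + 1 * cexp w) h).
      apply: (@cdiff_comp _ (@cexp R) (fun w => z0 + 1 * w)); last exact: cdiff_affine.
      exact: cdiff_cexp.
    apply: dh; rewrite mul1r addrC addKr nrm_cexp (@lt_trans _ _ (expR X)) ?ltr_expR //.
    by rewrite eX; lra.
pose x2 := ln r.
have x2X : x2 < X by rewrite ltr_ln ?posrE //; lra.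
pose T : R := pi *+ 2.
have T0 : 0 < T by rewrite /T pmulrn_rgt0 // pi_gt0.
have vE x1 : x1 <= x2 -> citg (vline H x2) 0 T = citg (vline H x1) 0 T.
  move=> x12; have : rectJ H x1 (x2 - x1) 0 T = 0.
    apply: goursat => //; [by rewrite subr_ge0|exact: ltW|].
    move=> x y /andP[_]; rewrite addrC subrK => xx2 _; apply: dH => /=.
    exact: le_lt_trans x2X.
  rewrite /rectJ !add0r [x1 + _]addrC subrK.
  (* The horizontal sides of the rectangle are one period of [cexp] apart and cancel. *)
  have -> : hline H T = hline H 0.
    apply/funext => x; rewrite /hline /H /u /cexp /=.
    by rewrite -[T]add0r cosD2pi sinD2pi.
  rewrite subrr add0r => /eqP; rewrite mulf_eq0 subr_eq0 => /orP[|/eqP //].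
  by rewrite eq_complex /= oner_eq0 andbF.
pose phi y := m - Re (vline H x2 y).
have cR x : continuous (fun y => Re (vline H x y)).
  by apply: Re_comp_continuous; exact: vline_continuous.
have cphi : continuous phi.
  by move=> y; apply: (@continuousB _ R^o R (fun=> m) (fun y => Re (vline H x2 y)));
    [exact: cst_continuous|exact: cR].
have itgphi : itg phi 0 T = 0.
  have ge0 : 0 <= itg phi 0 T.
    apply: itg_ge0 => //; first exact: ltW.
    by move=> y _; rewrite subr_ge0; apply: hm; exact: ux.
  apply/eqP; rewrite eq_le ge0 andbT; apply/ler_addgt0Pl => e e0; rewrite addr0.
  have ch : {for z0, continuous h}.
    by apply: cdiff_continuous; apply: dh; rewrite subrr nrm0 (lt_trans r_gt0).
  have /continuousCC/(_ (e / T))[|s s0 hs] := ch; first by rewrite divr_gt0.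
  (* The vertical line at [x1] traces a circle so small that [h] stays within [e / T] of [h z0] on
     it. *)
  pose x1 := Num.min x2 (ln (s / 2)).
  have x12 : x1 <= x2 by rewrite ge_min lexx.
  have s20 : 0 < s / 2 by rewrite divr_gt0.
  have : `|itg (fun y => m - Re (vline H x1 y)) 0 T| <= e / T * (T - 0).
    apply: itg_le; first exact: ltW.
      by move=> y; apply: (@continuousB _ R^o R (fun=> m) (fun y => Re (vline H x1 y)));
        [exact: cst_continuous|exact: cR].
    move=> y _; have -> : m = Re (h z0) by rewrite hz0.
    rewrite -ReB (le_trans (normRe_le _)) // nrmB ltW // /vline /H; apply: hs.
    rewrite /u addrC addKr nrm_cexp /=; apply: (@le_lt_trans _ _ (s / 2)); last by lra.
    rewrite -[s / 2]lnK ?posrE // ler_expR ge_min; apply/orP; left.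
    by rewrite /x1 ge_min lexx orbT.
  rewrite subr0 divfK ?gt_eqF // => le; apply: le_trans le.
  apply: le_trans (ler_norm _); rewrite /phi !itgB //; try exact: cst_continuous.
  by have := vE _ x12 => -[-> _].
have phi0 : phi 0 = 0.
  apply: (itg_eq0 T0 cphi) => // y _.
  by rewrite subr_ge0; apply: hm; exact: ux.
have <- : Re (vline H x2 0) = m by move: phi0; rewrite /phi; lra.
rewrite /vline /H /u /cexp /= cos0 sin0; congr (Re (h (_ + _))).
rewrite /Num.min x2X lnK //; by apply: complex_ext => /=; ring.
Qed.

(** Multiplication by the conjugate of [h z0] turns the central value into the real number
    [nrm (h z0) ^+ 2], which bounds the real part of the product on the disc. *)
Lemma local_max h z0 r0 :
  (forall w, nrm (w - z0) < r0 -> cdiff h w) ->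
  (forall w, nrm (w - z0) < r0 -> nrm (h w) <= nrm (h z0)) ->
  forall r, 0 < r < r0 -> nrm (h (z0 + r%:C)) = nrm (h z0).
Proof.
move=> dh hm r rr.
have rz0 : nrm (z0 + r%:C - z0) < r0.
  by rewrite addrC addKr nrm_real; case/andP: rr => r_gt0 ?; rewrite gtr0_norm.
apply/eqP; rewrite eq_le hm //=.
pose k : C := (h z0)^*.
have nk : nrm k = nrm (h z0) by rewrite !nrmE /k; case: (h z0) => x y /=; rewrite sqrrN.
have kh : k * h z0 = (nrm (h z0) ^+ 2)%:C.
  by apply: complex_ext; rewrite ?ReM ?ImM /= ?sqr_nrm /k; case: (h z0) => x y /=; ring.
have := @local_max_real (fun w => k * h w) z0 r0 (nrm (h z0) ^+ 2) kh.
have d1 w : nrm (w - z0) < r0 -> cdiff (fun w => k * h w) w.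
  move=> /dh dw; apply: (@cdiff_near _ (fun w => 0 + k * h w) _ _ 1) => //.
    by move=> v _; rewrite add0r.
  exact: (@cdiff_comp _ h (fun w => 0 + k * w) _ dw (cdiff_affine _ _ _)).
have d2 w : nrm (w - z0) < r0 -> Re (k * h w) <= nrm (h z0) ^+ 2.
  by move=> wz; rewrite (le_trans (Re_le _)) // nrmM nk expr2 ler_wpM2l ?nrm_ge0 ?hm.
move=> /(_ d1 d2 r rr) E.
have := Re_le (k * h (z0 + r%:C)); rewrite E nrmM nk expr2.
have [->|n0] := eqVneq (nrm (h z0)) 0; first by rewrite nrm_ge0.
by rewrite ler_pM2l // lt_neqAle eq_sym n0 nrm_ge0.
Qed.

(** If the maximum of the modulus over the closure exceeded [c], the points attaining it would form
    a compact set inside [W]. At one of largest real part, [local_max] yields another one further to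
    the right. *)
Theorem maximum_principle W h c : open W -> bounded_set W ->
  {within closure W, continuous h} -> (forall z, W z -> cdiff h z) ->
  (forall z, boundary W z -> nrm (h z) <= c) -> forall z, W z -> nrm (h z) <= c.
Proof.
move=> oW bW ch dh hc z Wz; rewrite leNgt; apply/negP => cz.
have cK := compact_closureC bW.
have cn : {within closure W, continuous (fun z => nrm (h z))}.
  apply/within_continuousCR => p Kp e e0.
  have /within_continuousCC/(_ p Kp e e0)[s s0 hs] := ch.
  exists s => // q Kq /(hs _ Kq); apply: le_lt_trans.
  by rewrite /distR ler_norml ler_nrmB lerNl opprB /distC nrmB ler_nrmB.
have K0 : closure W !=set0 by exists z; exact: subset_closure.
have [p /set_mem Kp pmax] := @compact_EVT_max C R (fun z => nrm (h z)) (closure W) K0 cK cn.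
set M := nrm (h p) in pmax.
have cM : c < M by apply: lt_le_trans cz _; apply: pmax; apply/mem_set; exact: subset_closure.
pose S := [set q | closure W q /\ nrm (h q) = M].
have cS : closed S.
  move=> q Sq; have Kq : closure W q.
    by apply: (@closed_closure _ W); apply: closure_subset Sq => ? [].
  split => //; apply/eqP; rewrite -subr_eq0 -normr_eq0 eq_le normr_ge0 andbT.
  apply/ler_addgt0Pl => e e0; rewrite addr0.
  have /within_continuousCR/(_ q Kq e e0)[s s0 hs] := cn.
  have /closureC/(_ s s0)[v [Kv <-] vq] := Sq.
  by rewrite distrC; apply: ltW; exact: hs.
have SW : S `<=` W.
  move=> q [Kq qM]; apply: contrapT => nW.
  by have := hc q (closureE_open oW Kq nW); rewrite qM leNgt cM.
have bS : bounded_set S by apply: sub_bounded (bounded_closure bW) => ? [].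
have S0 : S !=set0 by exists p.
have cR : {within S, continuous (@Re R)} by exact/continuous_subspaceT/Re_continuous.
have [q /set_mem Sq qmax] := @compact_EVT_max C R (@Re R) S S0 (compactC cS bS) cR.
have /openC/(_ q (SW q Sq))[r r0 hr] := oW.
have [Kq qM] := Sq.
have r2 : 0 < r / 2 < r by rewrite divr_gt0 //=; lra.
have Sr : S (q + (r / 2)%:C).
  split.
    apply: subset_closure; apply: hr; rewrite addrC addKr nrm_real gtr0_norm; by case/andP: r2.
  rewrite -qM; apply: (@local_max h q r) => //; first by move=> w /hr/dh.
  move=> w /hr Ww; rewrite qM; apply: pmax; apply/mem_set; exact: subset_closure.
by have := qmax _ (mem_set Sr); rewrite ReD /=; lra.
Qed.

Lemma within_image_closed W g : bounded_set W -> {within closure W, continuous g} ->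
  closed (g @` closure W).
Proof.
move=> bW cg; apply: compact_closedC; apply: continuous_compact => //.
exact: compact_closureC.
Qed.

(* Openness comes from the maximum principle for 1 / (g - q), where q is a
   hypothetical omitted value close to an attained one. *)
Theorem open_mapping W D g : open W -> bounded_set W ->
  {within closure W, continuous g} -> (forall z, W z -> cdiff g z) ->
  open D -> connected D -> (forall z, boundary W z -> ~ D (g z)) ->
  forall z, W z -> D (g z) -> D `<=` g @` W.
Proof.
move=> oW bW cg dg oD cD nD z Wz Dz p Dp.
suff loc q : D q -> \forall v \near q, D v -> ((g @` W) q <-> (g @` W) v).
  by apply: (connected_locally_constant cD loc Dz Dp); exists z.
move=> Dq.
have KW v : D v -> (g @` closure W) v -> (g @` W) v.
  move=> Dv [y Ky yv]; exists y => //; apply: contrapT => nW.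
  by apply: (nD y); [exact: closureE_open|rewrite yv].
have [gq|ngq] := pselect ((g @` W) q); last first.
  have nK : ~ (g @` closure W) q by move=> /(KW _ Dq).
  have [e e0 he] := openC_setC (within_image_closed bW cg) nK.
  apply/nbhsC; exists e => // v vq Dv; split => // -[y Wy yv].
  by case: (he v vq); exists y => //; exact: subset_closure.
have /openC/(_ q Dq)[e e0 he] := oD.
(* On the boundary of [W] the values of [g] keep distance [e] from [q], hence distance [e / 2] from
   [v], whereas [g] takes the value [q] at a point of [W], at distance less than [e / 2] from
   [v]. *)
apply/nbhsC; exists (e / 2); first by rewrite divr_gt0.
move=> v vq Dv; split => // _; apply: contrapT => ngv.
have nKv : ~ (g @` closure W) v by move=> /(KW _ Dv).
pose h w := (g w - v)^-1.
have gv w : closure W w -> g w != v.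
  by move=> Kw; apply/eqP => E; apply: nKv; exists w.
have ch : {within closure W, continuous h}.
  apply/subspace_continuousP => x Kx; apply: cvgV; first by rewrite subr_eq0 gv.
  apply: cvgB; last exact: cvg_cst.
  exact: (iffLR (subspace_continuousP _ _) cg x Kx).
have dh w : W w -> cdiff h w.
  move=> Ww; apply: cdiff_invB; last exact: dg.
  by apply: gv; exact: subset_closure.
have bh w : boundary W w -> nrm (h w) <= (e / 2)^-1.
  move=> bw; rewrite nrmV lef_pV2 ?posrE ?divr_gt0 //; last first.
    by rewrite nrm_gt0 subr_eq0; apply: gv; case: bw.
  have : e <= nrm (g w - q).
    by rewrite leNgt; apply/negP => /he; exact: nD.
  have := ler_nrm_dist v (g w) q; lra.
have [y Wy yq] := gq.
have := maximum_principle oW bW ch dh bh Wy.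
rewrite nrmV lef_pV2 ?posrE ?divr_gt0 //; last first.
  by rewrite nrm_gt0 subr_eq0; apply: gv; exact: subset_closure.
by rewrite yq nrmB; lra.
Qed.

End MaximumPrinciple.

(** * Continuous logarithms *)

Section Logarithms.
Variable R : realType.
Local Notation C := (cplane R).
Implicit Types (z w p q : C) (x y e r s : R) (u v : C -> C) (S X W D : set C).

(* The plane cut along the nonpositive reals. *)
Definition slit w := 0 < nrm w + Re w.

(** The principal branch. The half-angle formula gives the argument on the whole slit plane by one
    expression. *)
Definition clog w : C := ln (nrm w) +i* (2 * atan (Im w / (nrm w + Re w))).

Lemma slit_neq0 w : slit w -> w != 0.
Proof. by rewrite /slit; apply: contraTneq => ->; rewrite nrm0 addr0 ltxx. Qed.

Lemma clogK w : slit w -> cexp (clog w) = w.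
Proof.
move=> sw; have w0 : 0 < nrm w by rewrite nrm_gt0 slit_neq0.
rewrite /cexp /= lnK ?posrE //; set n := nrm w in sw w0 *.
have d0 : n + Re w != 0 by rewrite gt_eqF.
have E2 : n ^+ 2 = Re w ^+ 2 + Im w ^+ 2 by rewrite /n sqr_nrm.
set t := Im w / (n + Re w).
have c0 : cos (atan t) != 0 by rewrite cos_atan invr_eq0 sqrtr_eq0 -ltNge ltr_pwDl // sqr_ge0.
have c2 : cos (atan t) ^+ 2 = (n + Re w) / (2 * n).
  rewrite cos_atan exprVn sqr_sqrtr ?addr_ge0 ?sqr_ge0 //.
  have -> : 1 + t ^+ 2 = 2 * n / (n + Re w).
    apply: (mulIf (expf_neq0 2 d0)).
    have -> : (1 + t ^+ 2) * (n + Re w) ^+ 2 = (n + Re w) ^+ 2 + Im w ^+ 2.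
      by rewrite /t; field.
    have -> : 2 * n / (n + Re w) * (n + Re w) ^+ 2 = 2 * n * (n + Re w) by field.
    have -> : Im w ^+ 2 = n ^+ 2 - Re w ^+ 2 by rewrite E2; ring.
    by ring.
  by rewrite invf_div.
have sE : sin (atan t) = t * cos (atan t).
  by rewrite -{2}[t]atanK /tan divfK.
have -> : 2 * atan t = atan t *+ 2 by rewrite mulr_natl.
rewrite cos_mulr2n sin_mulr2n sE mulrCA -expr2 c2.
have n0 : n != 0 by rewrite gt_eqF.
apply: complex_ext; rewrite !(ReM, ImM) /= ?mul0r ?subr0 ?addr0 /t; field; by rewrite ?n0 ?d0.
Qed.

Lemma Re_gt0_slit w : 0 < Re w -> slit w.
Proof. by move=> h; rewrite /slit ltr_wpDl // nrm_ge0. Qed.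

Lemma near1_slit w : nrm (w - 1) < 1 -> slit w.
Proof.
move=> h; apply: Re_gt0_slit; have := normRe_le (w - 1); rewrite ReB /= ler_norml.
by move=> /andP[]; lra.
Qed.

Lemma clog_continuous w : slit w -> {for w, continuous clog}.
Proof.
move=> sw; have w0 : 0 < nrm w by rewrite nrm_gt0 slit_neq0.
have cd : {for w, continuous (fun w => nrm w + Re w)}.
  apply: (@continuousD _ R^o C (@nrm R) (@Re R)); [exact: nrm_continuous|exact: Re_continuous].
have c1 : {for w, continuous (fun w => ln (nrm w))}.
  by apply: (@continuous_comp C R R (@nrm R) (@ln R)); [exact: nrm_continuous|exact: continuous_ln].
have c2 : {for w, continuous (fun w => 2 * atan (Im w / (nrm w + Re w)) : R)}.
  apply: (@continuousM R C (fun=> 2) (fun w => atan (Im w / (nrm w + Re w)))).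
    exact: cst_continuous.
  apply: (@continuous_comp C R R (fun w => Im w / (nrm w + Re w)) (@atan R)).
    apply: (@continuousM R C (@Im R) (fun w => (nrm w + Re w)^-1)).
      exact: Im_continuous.
    by apply: (@continuousV R C (fun w => nrm w + Re w)) => //; rewrite gt_eqF.
  exact: continuous_atan.
apply/continuousCC => e e0; have e2 : 0 < e / 2 by rewrite divr_gt0.
have /continuousCR/(_ _ e2)[d1 d10 h1] := c1.
have /continuousCR/(_ _ e2)[d2 d20 h2] := c2.
exists (Num.min d1 d2); first by rewrite lt_min d10.
move=> v; rewrite lt_min => /andP[/h1 k1 /h2 k2].
apply: le_lt_trans (nrm_le_ReIm _) _; rewrite ReB ImB /=; lra.
Qed.

Lemma cexp_surj w : w != 0 -> exists z, cexp z = w.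
Proof.
move=> w0; have [sw|nsw] := pselect (slit w); first by exists (clog w); exact: clogK.
have ns : nrm w + Re w <= 0 by rewrite leNgt; apply/negP.
have wp : 0 < nrm w by rewrite nrm_gt0.
have sN : slit (- w) by rewrite /slit nrmN ReN; lra.
exists (clog (- w) + pi *i); rewrite cexpD clogK //.
have -> : cexp (pi *i) = -1 :> C.
  by rewrite /cexp /= expR0 cospi sinpi; apply: complex_ext; rewrite ?(ReM, ImM) /=; ring.
by rewrite mulrN1 opprK.
Qed.

(** The imaginary part is too small for [sin] to vanish except at 0. Consequently two continuous
    logarithms of one function differ by a locally constant amount. *)
Lemma cexp_eq1 z : nrm z < 1 -> cexp z = 1 -> z = 0.
Proof.
move=> z1 E; have n1 : expR (Re z) = 1 by rewrite -nrm_cexp E nrm1.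
have r0 : Re z = 0 by apply: expR_inj; rewrite expR0.
have : Im (cexp z) = 0 by rewrite E.
rewrite /cexp ImM /= mul0r addr0 n1 mul1r => s0.
apply: complex_ext => //=; have := normIm_le z => iz.
have iz1 : `|Im z| < 1 by exact: le_lt_trans z1.
move: iz1; rewrite ltr_norml => /andP[i1 i2].
case: (ltgtP (Im z) 0) => // i0.
- have : 0 < sin (- Im z) by apply: sin2_gt0; lra.
  by rewrite sinN s0 oppr0 ltxx.
- have : 0 < sin (Im z) by apply: sin2_gt0; lra.
  by rewrite s0 ltxx.
Qed.

(** The logarithm is a total function constrained only on [S], which lets pieces be glued by a case
    distinction. *)
Definition haslog S u :=
  exists l : C -> C, {within S, continuous l} /\ forall z, S z -> cexp (l z) = u z.

Lemma haslog_eq S u v : (forall z, S z -> u z = v z) -> haslog S u -> haslog S v.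
Proof. by move=> uv [l [cl hl]]; exists l; split => // z Sz; rewrite hl ?uv. Qed.

Lemma haslog_sub S X u : X `<=` S -> haslog S u -> haslog X u.
Proof.
move=> XS [l [cl hl]]; exists l; split; first exact: continuous_subspaceW cl.
by move=> z /XS; exact: hl.
Qed.

Lemma haslogM S u v : haslog S u -> haslog S v -> haslog S (fun z => u z * v z).
Proof.
move=> [l [cl hl]] [m [cm hm]]; exists (fun z => l z + m z); split.
  by move=> z; apply: (@continuousD _ _ _ (l : subspace S -> C) m); [exact: cl|exact: cm].
by move=> z Sz; rewrite cexpD hl ?hm.
Qed.

Lemma haslogV S u : haslog S u -> haslog S (fun z => (u z)^-1).
Proof.
move=> [l [cl hl]]; exists (fun z => - l z); split.
  by move=> z; apply: (@continuousN _ _ _ (l : subspace S -> C)); exact: cl.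
by move=> z Sz; rewrite cexpN hl.
Qed.

Lemma haslog_cst S p : p != 0 -> haslog S (fun=> p).
Proof.
move=> /cexp_surj[z zp]; exists (fun=> z); split => //.
by apply: continuous_subspaceT => w; exact: cst_continuous.
Qed.

Lemma haslog_slit S u : {within S, continuous u} -> (forall z, S z -> slit (u z)) ->
  haslog S u.
Proof.
move=> cu su; exists (clog \o u); split; last by move=> z /su/clogK.
apply/subspace_continuousP => z Sz; apply: (@cvg_comp _ _ _ u clog _ (nbhs (u z))).
  exact: (iffLR (subspace_continuousP _ _) cu z Sz).
exact: clog_continuous (su z Sz).
Qed.

Lemma haslog_near1 S u : {within S, continuous u} -> (forall z, S z -> nrm (u z - 1) < 1) ->
  haslog S u.
Proof. by move=> cu u1; apply: haslog_slit => // z /u1; exact: near1_slit. Qed.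

(** The quotient of two members at nearby parameters stays within 1 of the constant 1, where the
    principal branch is available; so having a logarithm is locally constant in the parameter. *)
Lemma haslog_param (T : topologicalType) (E : set T) S (h : T -> C -> C) :
  connected E ->
  (forall t, E t -> {within S, continuous (h t)}) ->
  (forall t z, E t -> S z -> h t z != 0) ->
  (forall t, E t -> \forall t' \near t, E t' ->
     forall z, S z -> nrm (h t' z / h t z - 1) < 1) ->
  forall t t', E t -> E t' -> haslog S (h t) -> haslog S (h t').
Proof.
move=> cE ch h0 hn; apply: (connected_locally_constant cE (P := fun t => haslog S (h t))).
move=> t Et; have := hn t Et; apply: filterS => t' ht' Et'.
have L : haslog S (fun z => h t' z / h t z).
  apply: haslog_near1; last exact: ht'.
  apply/subspace_continuousP => z Sz; apply: cvgM.
    exact: (iffLR (subspace_continuousP _ _) (ch t' Et') z Sz).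
  apply: cvgV; first exact: h0.
  exact: (iffLR (subspace_continuousP _ _) (ch t Et) z Sz).
split=> l.
- apply: haslog_eq (haslogM l L) => z Sz; rewrite mulrCA divff ?mulr1 //; exact: h0.
- apply: haslog_eq (haslogM l (haslogV L)) => z Sz.
  by rewrite invf_div mulrCA divff ?mulr1 //; exact: h0.
Qed.

Lemma sub_within_continuous S p : {within S, continuous (fun z => z - p)}.
Proof.
apply: continuous_subspaceT => z; apply: (@continuousB _ _ _ id (fun=> p)).
  exact: cvg_id.
exact: cst_continuous.
Qed.

(** The pole stays at [q] while the zero moves inside [D] from [q], where the quotient is 1, to
    [p]. *)
Lemma haslog_ratio S D p q : compact S -> connected D -> D `<=` ~` S -> D p -> D q ->
  haslog S (fun z => (z - p) / (z - q)).
Proof.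
move=> cS cD DS Dp Dq.
have nz t z : D t -> S z -> z - t != 0.
  by move=> Dt Sz; rewrite subr_eq0; apply/eqP => zt; apply: (DS t) => //; rewrite -zt.
apply: (@haslog_param C D S (fun t z => (z - t) / (z - q)) _ _ _ _ q) => //.
- move=> t Dt; apply/subspace_continuousP => z Sz; apply: cvgM.
    exact: (iffLR (subspace_continuousP _ _) (@sub_within_continuous S t) z Sz).
  apply: cvgV; first exact: nz.
  exact: (iffLR (subspace_continuousP _ _) (@sub_within_continuous S q) z Sz).
- by move=> t z Dt Sz; rewrite mulf_neq0 ?invr_eq0 ?nz.
- move=> t Dt; have [e e0 he] := compact_dist cS (DS t Dt).
  apply/nbhsC; exists e => // t' tt' Dt' z Sz.
  have -> : (z - t') / (z - q) / ((z - t) / (z - q)) - 1 = (t - t') / (z - t).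
    by field; rewrite !nz.
  rewrite nrmM nrmV ltr_pdivrMr ?nrm_gt0 ?nz // mul1r nrmB (lt_le_trans tt') //.
  exact: he.
- apply: haslog_eq (haslog_cst S (oner_neq0 _)) => z Sz.
  by rewrite divff // nz.
Qed.

(** The zero is moved within [D] to a point [q] of larger modulus than all points of [S]; then
    [(z - q) / - q] is within 1 of 1 on [S]. *)
Lemma haslog_unbounded S D p : compact S -> connected D -> D `<=` ~` S -> D p ->
  ~ bounded_set D -> haslog S (fun z => z - p).
Proof.
move=> cS cD DS Dp uD.
have /bounded_setC[M hM] := compact_boundedC cS.
have [q Dq Mq] : exists2 q, D q & M < nrm q.
  apply: contrapT => nq; apply: uD; apply/bounded_setC; exists M => z Dz.
  by rewrite leNgt; apply/negP => Mz; apply: nq; exists z.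
have [S0|[z0 Sz0]] : S = set0 \/ S !=set0.
- by have [->|/set0P] := eqVneq S set0; [left|right].
- by exists id; rewrite S0; split => //; exact: continuous_subspace0.
have q0 : q != 0.
  by rewrite -nrm_gt0 (le_lt_trans _ Mq) // (le_trans (nrm_ge0 z0)) // hM.
have nz z : S z -> z - q != 0.
  by move=> Sz; rewrite subr_eq0; apply/eqP => zq; apply: (DS q) => //; rewrite -zq.
have L : haslog S (fun z => (z - q) / (- q)).
  apply: haslog_near1.
    apply/subspace_continuousP => z Sz; apply: cvgM; last exact: cvg_cst.
    exact: (iffLR (subspace_continuousP _ _) (@sub_within_continuous S q) z Sz).
  move=> z Sz; have -> : (z - q) / - q - 1 = - (z / q) by field; rewrite q0.
  rewrite nrmN nrmM nrmV ltr_pdivrMr ?nrm_gt0 // mul1r.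
  exact: le_lt_trans (hM z Sz) Mq.
have Nq : - q != 0 by rewrite oppr_eq0.
have := haslogM (haslogM (haslog_ratio cS cD DS Dp Dq) L) (haslog_cst S Nq).
apply: haslog_eq => z Sz; field.
by rewrite q0 nz.
Qed.

Lemma haslog_union X Y u : closed X -> closed Y -> X `&` Y = set0 ->
  haslog X u -> haslog Y u -> haslog (X `|` Y) u.
Proof.
move=> cX cY XY [l [cl hl]] [m [cm hm]].
pose k z := if z \in X then l z else m z.
have kX z : X z -> k z = l z by move=> Xz; rewrite /k mem_set.
have kY z : Y z -> k z = m z.
  by move=> Yz; rewrite /k memNset // => Xz; have : (X `&` Y) z by []; rewrite XY.
exists k; split; last by move=> z [Xz|Yz]; [rewrite kX ?hl|rewrite kY ?hm].
apply: (withinU_continuous cX cY).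
  by apply: subspace_eq_continuous cl => z /set_mem /kX.
by apply: subspace_eq_continuous cm => z /set_mem /kY.
Qed.

Lemma closed_setI_open X Q : closed X -> (forall z, boundary Q z -> ~ X z) -> open Q ->
  closed (X `&` Q).
Proof.
move=> cX bQ oQ; have -> : X `&` Q = X `&` closure Q; last first.
  by apply: closedI => //; exact: closed_closure.
rewrite predeqE => z; split=> -[Xz]; first by split => //; exact: subset_closure.
move=> cz; split => //; apply: contrapT => nQ; apply: (bQ z) => //; exact: closureE_open.
Qed.

(** As the boundary of each [Q] misses [X], its trace on [X] is relatively clopen. The cover can
    therefore be made disjoint by subtraction, and the logarithms on the pieces need not agree. *)
Lemma haslog_cover X u (s : seq (set C)) : closed X ->
  (forall Q, Q \in s -> [/\ open Q, forall z, boundary Q z -> ~ X z & haslog (X `&` Q) u]) ->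
  X `<=` [set z | exists2 Q, Q \in s & Q z] -> haslog X u.
Proof.
move=> cX hs Xs; pose V (r : seq (set C)) := X `&` [set z | exists2 Q : set C, Q \in r & Q z].
have : closed (V s) /\ haslog (V s) u.
  elim: s hs {Xs} => [|Q s IH] hs.
    have -> : V [::] = set0 by rewrite -subset0 => z [_ [Q]].
    split; first exact: closed0.
    by exists id; split => //; exact: continuous_subspace0.
  have [oQ bQ lQ] : [/\ open Q, forall z, boundary Q z -> ~ X z & haslog (X `&` Q) u].
    by apply: hs; rewrite mem_head.
  have [cV lV] : closed (V s) /\ haslog (V s) u.
    by apply: IH => Q' Q's; apply: hs; rewrite in_cons Q's orbT.
  have cQ : closed (X `&` Q) by exact: closed_setI_open.
  have cVQ : closed (V s `\` Q) by rewrite setDE; apply: closedI => //; exact: open_closedC.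
  have -> : V (Q :: s) = (X `&` Q) `|` (V s `\` Q).
    rewrite predeqE => z; split.
      move=> [Xz [Q' ]]; rewrite in_cons; have [Qz|nQz] := pselect (Q z); first by left.
      by move=> /predU1P[->//|Q's Q'z]; right; split => //; split => //; exists Q'.
    move=> [[Xz Qz]|[[Xz [Q' Q's Q'z]] _]]; split => //; first by exists Q; rewrite ?mem_head.
    by exists Q'; rewrite ?in_cons ?Q's ?orbT.
  split; first exact: closedU.
  apply: haslog_union => //; last by apply: haslog_sub lV => z [].
  by rewrite -subset0 => z [[_ Qz] [_]].
by case=> _; apply: haslog_sub => z Xz; split => //; exact: Xs.
Qed.

End Logarithms.

(** * Boundaries carry no logarithm *)

Section Borsuk.
Variable R : realType.
Local Notation C := (cplane R).
Implicit Types (z w p q : C) (x y e r s : R) (u v : C -> C) (S X W D : set C).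

(** Tietze's theorem, applied on [R * R] and carried over by [ofpair]. *)
Lemma real_extension S (f : C -> R) : compact S -> {within S, continuous f} ->
  exists2 g : C -> R, continuous g & forall z, S z -> g z = f z.
Proof.
move=> cS cf; have [M hM] : exists M, forall z, S z -> `|f z| <= M.
  have /compact_bounded[M [_ hM]] := continuous_compact cf cS.
  by exists (M + 1) => z Sz; apply: (hM _ _ (f z)); [rewrite ltrDl|exists z].
pose A := @ofpair R @^-1` S.
have cA : closed A.
  exact: ((continuous_closedP (@ofpair R)).1 (@ofpair_continuous R) S (compact_closedC cS)).
have cfA : {within A, continuous (f \o @ofpair R)}.
  apply/subspace_continuousP => x Ax B nB.
  have /subspace_continuousP/(_ _ Ax B nB) := cf.
  rewrite !nbhs_simpl /= /within /= => h.
  exact: (@ofpair_continuous R _ _ h).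
have M0 : 0 < `|M| + 1 by rewrite ltr_wpDl.
have fM (x : R * R) : A x -> `|(f \o @ofpair R) x| <= `|M| + 1.
  by move=> Ax; apply: le_trans (hM _ Ax) _; have := ler_norm M; lra.
have [g [gf cg _]] := @continuous_bounded_extension (R * R)%type R
   (@pseudometric_normal R (R * R)%type) A cA (f \o @ofpair R) _ M0 cfA fM.
exists (fun z => g (Re z, Im z)).
  move=> z; apply: (@continuous_comp _ _ _ (fun z => (Re z, Im z)) g); last exact: cg.
  exact: (cvg_pair (@Re_continuous R z) (@Im_continuous R z)).
move=> z Sz; have zE : ofpair (Re z, Im z) = z by case: (z).
have Az : A (Re z, Im z) by rewrite /A /= zE.
by rewrite -gf ?inE //= zE.
Qed.

Lemma complex_extension S u : compact S -> {within S, continuous u} ->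
  exists2 v : C -> C, continuous v & forall z, S z -> v z = u z.
Proof.
move=> cS cu.
have c1 : {within S, continuous (fun z => Re (u z))}.
  apply/within_continuousCR => p Sp e e0.
  have /within_continuousCC/(_ p Sp e e0)[d d0 hd] := cu.
  exists d => // q Sq /(hd _ Sq); apply: le_lt_trans.
  by rewrite /distR -ReB; exact: normRe_le.
have c2 : {within S, continuous (fun z => Im (u z))}.
  apply/within_continuousCR => p Sp e e0.
  have /within_continuousCC/(_ p Sp e e0)[d d0 hd] := cu.
  exists d => // q Sq /(hd _ Sq); apply: le_lt_trans.
  by rewrite /distR -ImB; exact: normIm_le.
have [f cf fE] := real_extension cS c1; have [g cg gE] := real_extension cS c2.
exists (fun z => ofpair (f z, g z)).
  move=> z; apply: (@continuous_comp _ _ _ (fun z => (f z, g z)) (@ofpair R)).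
    exact: (cvg_pair (cf z) (cg z)).
  exact: ofpair_continuous.
by move=> z Sz; rewrite fE // gE //; case: (u z).
Qed.

Definition ucircle : set C := [set z | nrm z = 1].

Definition cis (t : R) : C := cos t +i* sin t.

Lemma cis_cexp t : cis t = cexp (t *i).
Proof. by apply: complex_ext; rewrite /cexp /cis /= expR0 ?(ReM, ImM) /=; ring. Qed.

(** Subtracting [t *i] from a logarithm of [cis t] leaves a continuous function whose [cexp] is 1,
    hence a constant; yet it changes by [2 pi i] over a full turn. *)
Lemma circle_id_no_log : ~ haslog ucircle id.
Proof.
move=> [l [cl hl]].
have ci : continuous (fun t : R => t *i : C).
  move=> t; apply/continuousRC => e e0; exists e => // s; apply: le_lt_trans.
  by apply: le_trans (nrm_le_ReIm _) _; rewrite ReB ImB /= subrr normr0 add0r.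
have ccis : continuous cis.
  move=> t B nB; have := @cexp_continuous R (t *i) B; rewrite -cis_cexp => /(_ nB) /ci.
  by rewrite !nbhs_simpl /=; apply: filterS => s /=; rewrite cis_cexp.
have Ucis t : ucircle (cis t) by exact: nrm_cis.
pose m t := l (cis t) - t *i.
have cm : continuous m.
  move=> t; apply: (@continuousB _ _ _ (fun t => l (cis t)) (fun t => t *i : C)); last exact: ci.
  apply/continuousRC => e e0.
  have /within_continuousCC/(_ _ (Ucis t) e e0)[d d0 hd] := cl.
  have /continuousRC/(_ d d0)[r r0 hr] := ccis t.
  by exists r => // s /hr; exact: hd.
have em t : cexp (m t) = 1.
  rewrite cexpB hl; last exact: Ucis.
  by rewrite -cis_cexp divff // -nrm_eq0 nrm_cis oner_eq0.
have cT : connected [set: R] by apply/connected_intervalP.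
have : m (pi *+ 2) = m 0.
  apply: (connected_locally_constant cT (P := fun t => m t = m 0) _ (p := 0)) => //.
  move=> t _; have /continuousRC/(_ 1 ltr01)[d d0 hd] := cm t.
  apply/nbhsR; exists d => // s /hd ms _.
  suff -> : m s = m t by [].
  apply/eqP; rewrite -subr_eq0; apply/eqP/cexp_eq1 => //.
  by rewrite cexpB !em divr1.
rewrite /m /cis cos2pi sin2pi cos0 sin0 => /(congr1 (@Im R)).
by rewrite !ImB /= -mulr_natl; have := pi_gt0 R; lra.
Qed.

(** On the unit circle the maps sending [z] to [u (p + s z)] deform the constant [u p], at [s = 0],
    into [s z] for large [s] without ever vanishing. The identity would inherit a logarithm. *)
Theorem nonvanishing_not_id_at_infinity u p M : continuous u -> (forall z, u z != 0) ->
  ~ (forall z, M < nrm z -> u z = z - p).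
Proof.
move=> cu u0 uM.
pose h (s : R) z := u (p + s%:C * z).
have ci (s : R) : continuous (fun z => p + s%:C * z).
  by move=> z; apply: cdiff_continuous; exact: cdiff_affine.
have ch s : continuous (h s).
  by move=> z; exact: continuous_comp (ci s z) (cu _).
have hlog : forall s t, haslog ucircle (h s) -> haslog ucircle (h t).
  move=> s t.
  have cT : connected [set: R] by apply/connected_intervalP.
  apply: (@haslog_param R R [set: R] ucircle h cT _ _ _ s t I I).
  - by move=> r _; exact/continuous_subspaceT/ch.
  - by move=> r z _ _; exact: u0.
  move=> r _.
  have ccU : compact ucircle.
    apply: compactC; last by apply/bounded_setC; exists 1 => z ->.
    exact: ((continuous_closedP (@nrm R)).1 (@nrm_continuous R) [set 1] (@closed_eq R 1)).
  have /compact_near_coveringP/(_ _ (nbhs r) (fun s z => nrm (h s z / h r z - 1) < 1)) := ccU.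
  move=> K; suff : \forall s \near r, ucircle `<=` [set z | nrm (h s z / h r z - 1) < 1].
    by apply: filterS => s' Us _ z /Us.
  apply: K => z Uz.
  have n0 : 0 < nrm (u (p + r%:C * z)) by rewrite nrm_gt0.
  (* Both values compared lie within a quarter of [nrm v] of [v]: they differ by less than half of
     [nrm v], and the divisor exceeds three quarters of it. *)
  have e0 : 0 < nrm (u (p + r%:C * z)) / 4 by rewrite divr_gt0.
  have /continuousCC/(_ _ e0)[d d0 hd] := cu (p + r%:C * z).
  set v := u (p + r%:C * z) in n0 e0 hd.
  have r1 : 0 < `|r| + 1 by rewrite ltr_wpDl.
  exists ([set z' | nrm (z' - z) < Num.min 1 (d / 2 / (`|r| + 1))],
          [set s | `|s - r| < d / 4]) => /=.
    split; first by apply/nbhsC; eexists; [|move=> w; apply]; rewrite lt_min ltr01 !divr_gt0.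
    by apply/nbhsR; exists (d / 4) => //; rewrite divr_gt0.
  move=> [z' s'] [/=]; rewrite lt_min => /andP[z1 z2] sr; rewrite /h.
  have nz' : nrm z' <= 2.
    rewrite -(subrK z z'); apply: le_trans (ler_nrmD _ _) _.
    by rewrite (Uz : nrm z = 1); lra.
  have k1 : nrm (r%:C * (z' - z)) < d / 2.
    rewrite nrmM nrm_real; move: z2; rewrite ltr_pdivlMr // mulrC; apply: le_lt_trans.
    by rewrite ler_wpM2r ?nrm_ge0 // lerDl.
  have k2 : nrm ((s' - r)%:C * z') <= d / 2.
    rewrite nrmM nrm_real; apply: le_trans (ler_pM _ _ (ltW sr) nz') _; rewrite ?nrm_ge0 //.
    lra.
  have b1 : nrm (u (p + r%:C * z') - v) < nrm v / 4.
    apply: hd; have -> : p + r%:C * z' - (p + r%:C * z) = r%:C * (z' - z) by ring.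
    by lra.
  have b2 : nrm (u (p + s'%:C * z') - v) < nrm v / 4.
    apply: hd; have -> : p + s'%:C * z' - (p + r%:C * z) = (s' - r)%:C * z' + r%:C * (z' - z).
      by rewrite rmorphB; ring.
    by apply: le_lt_trans (ler_nrmD _ _) _; lra.
  set A := u (p + s'%:C * z') in b2 *; set B := u (p + r%:C * z') in b1 *.
  have B0 : B != 0 by exact: u0.
  have -> : A / B - 1 = (A - B) / B by field.
  rewrite nrmM nrmV ltr_pdivrMr ?nrm_gt0 // mul1r.
  have := ler_nrm_dist v A B; have := ler_nrmB v B.
  by rewrite (nrmB v B); lra.
have h0 : haslog ucircle (h 0).
  apply: haslog_eq (haslog_cst ucircle (u0 p)) => z _.
  by rewrite /h mul0r addr0.
(* Large enough for [p + s z] to have modulus above [M] when [z] is on the unit circle. *)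
pose s := `|M| + nrm p + 1.
have s0 : 0 < s by rewrite /s ltr_wpDl // addr_ge0 // nrm_ge0.
have sc0 : s%:C != 0 :> C by rewrite -nrm_eq0 nrm_real normr_eq0 gt_eqF.
apply: circle_id_no_log.
have sV0 : (s%:C)^-1 != 0 :> C by rewrite invr_eq0.
apply: haslog_eq (haslogM (haslog_cst ucircle sV0) (hlog _ s h0)) => z Uz.
rewrite /h uM; first by rewrite addrC addKr mulKf.
apply: (@lt_le_trans _ _ (nrm (s%:C * z) - nrm p)).
  rewrite nrmM nrm_real gtr0_norm // (Uz : nrm z = 1) mulr1 /s.
  by have := ler_norm M; lra.
have -> : p + s%:C * z = s%:C * z - - p by ring.
by rewrite -[nrm p]nrmN; exact: ler_nrmB.
Qed.

(** Let [L] be an extension of the logarithm to the plane. The function [(z - q) * cexp (L z)] on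
    the closure of [W] fits together with [z - p] outside. The result has no zero, since [q] lies
    off the closure and [p] inside [W], but it equals [z - p] near infinity. *)
Theorem boundary_no_log W p q : open W -> bounded_set W -> W p -> ~ closure W q ->
  ~ haslog (boundary W) (fun z => (z - p) / (z - q)).
Proof.
move=> oW bW Wp nq [l [cl hl]].
have [L cL LE] := complex_extension (compact_boundary bW) cl.
pose u z := if z \in closure W then (z - q) * cexp (L z) else z - p.
have uin z : closure W z -> u z = (z - q) * cexp (L z) by move=> Kz; rewrite /u mem_set.
have uout z : ~ W z -> u z = z - p.
  move=> nW; rewrite /u; case: ifPn => // /set_mem Kz.
  have bz : boundary W z by exact: closureE_open.
  have zq0 : z - q != 0 by rewrite subr_eq0; apply/eqP => zq; apply: nq; rewrite -zq.
  by rewrite (LE z bz) (hl z bz); field.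
have cu : continuous u.
  rewrite continuous_subspace_setT -(setUv W).
  have -> : W `|` ~` W = closure W `|` ~` W.
    rewrite predeqE => z; split=> -[|] h; [left; exact: subset_closure|by right| |by right].
    by have [Wz|nWz] := pselect (W z); [left|right].
  apply: withinU_continuous; [exact: closed_closure|exact: open_closedC| |].
  - apply: (@subspace_eq_continuous _ _ _ (fun z => (z - q) * cexp (L z))).
      by move=> z /set_mem Kz; rewrite /from_subspace uin.
    apply: continuous_subspaceT => z; apply: (@continuousM _ _ (fun z => z - q) (fun z => cexp (L z))).
      by apply: (@continuousB _ _ _ id (fun=> q)); [exact: cvg_id|exact: cst_continuous].
    by apply: continuous_comp; [exact: cL|exact: cexp_continuous].
  - apply: (@subspace_eq_continuous _ _ _ (fun z => z - p)).
      by move=> z /set_mem nW; rewrite /from_subspace uout.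
    exact: sub_within_continuous.
have u0 z : u z != 0.
  have [Wz|nWz] := pselect (W z).
    rewrite uin; last exact: subset_closure.
    rewrite mulf_neq0 ?cexp_neq0 // subr_eq0; apply/eqP => zq; apply: nq; rewrite -zq.
    exact: subset_closure.
  by rewrite uout // subr_eq0; apply/eqP => zp; apply: nWz; rewrite zp.
have /bounded_setC[M hM] := bW.
apply: (nonvanishing_not_id_at_infinity (p := p) (M := M) cu u0) => z Mz.
by apply: uout => /hM; rewrite leNgt Mz.
Qed.

End Borsuk.

(** * Column blocks and cycles *)

Section Blocks.
Variable R : realType.
Local Notation C := (cplane R).
Implicit Types (z p q : C) (x y e r s t : R) (S X W D G : set C).

(** A column index and an interval of heights. Columns have a fixed width while heights are free, so
    that blocks of one column can merge into a block. *)
Definition block := (int * (R * R))%type.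
Implicit Types (u v w : block).

Variable h : R.
Hypothesis h0 : 0 < h.

Definition blk u : set C :=
  [set z | [/\ u.1%:~R * h <= Re z <= (u.1 + 1)%:~R * h & u.2.1 <= Im z <= u.2.2]].

Lemma blk_convex u : cconvex (blk u).
Proof.
move=> z w t [/andP[a1 a2] /andP[b1 b2]] [/andP[c1 c2] /andP[d1 d2]] /andP[t0 t1].
have mid (lo hi x x' : R) : lo <= x -> x <= hi -> lo <= x' -> x' <= hi ->
    lo <= x + t * (x' - x) <= hi.
  move=> k1 k2 k3 k4; have -> : x + t * (x' - x) = (1 - t) * x + t * x' by ring.
  have m0 : 0 <= 1 - t by rewrite subr_ge0.
  have l1 := ler_wpM2l m0 k1; have l2 := ler_wpM2l m0 k2.
  have l3 := ler_wpM2l t0 k3; have l4 := ler_wpM2l t0 k4.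
  by lra.
by split; rewrite ?Re_seg ?Im_seg; exact: mid.
Qed.

Lemma blk_connected u : connected (blk u).
Proof.
have [->|/set0P[z uz]] := eqVneq (blk u) set0; first exact: connected0.
apply: (@starlike_connected _ _ z); split => // w t uw t01.
exact: blk_convex.
Qed.

Lemma blk_compact u : compact (blk u).
Proof.
apply: compactC.
  have cRe (A : set R) : closed A -> closed (@Re R @^-1` A : set C).
    by move=> cA; exact: ((continuous_closedP (@Re R : C -> R)).1 (@Re_continuous R) A cA).
  have cIm (A : set R) : closed A -> closed (@Im R @^-1` A : set C).
    by move=> cA; exact: ((continuous_closedP (@Im R : C -> R)).1 (@Im_continuous R) A cA).
  have -> : blk u = (@Re R @^-1` `[u.1%:~R * h, (u.1 + 1)%:~R * h]) `&`
      (@Im R @^-1` `[u.2.1, u.2.2]).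
    by rewrite predeqE => z; split=> -[a b]; split; move: a b; rewrite /= ?in_itv.
  by apply: closedI; [apply: cRe|apply: cIm]; exact: itv_closed.
apply/bounded_setC; exists (`|u.1%:~R * h| + `|(u.1 + 1)%:~R * h| + (`|u.2.1| + `|u.2.2|)).
move=> z [/andP[a1 a2] /andP[b1 b2]]; apply: le_trans (nrm_le_ReIm z) _.
have n1 := ler_norm (u.1%:~R * h); have n2 := ler_norm (- (u.1%:~R * h)).
have n3 := ler_norm ((u.1 + 1)%:~R * h); have n4 := ler_norm (- ((u.1 + 1)%:~R * h)).
have n5 := ler_norm u.2.1; have n6 := ler_norm (- u.2.1).
have n7 := ler_norm u.2.2; have n8 := ler_norm (- u.2.2).
rewrite !normrN in n2 n4 n6 n8.
apply: lerD; rewrite ler_norml; apply/andP; split; lra.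
Qed.

Definition hull u v : block := (u.1, (Num.min u.2.1 v.2.1, Num.max u.2.2 v.2.2)).

Lemma hullP u v z : blk (hull u v) z <->
  [/\ u.1%:~R * h <= Re z <= (u.1 + 1)%:~R * h,
      u.2.1 <= Im z \/ v.2.1 <= Im z & Im z <= u.2.2 \/ Im z <= v.2.2].
Proof.
rewrite /blk /= ge_min le_max; split=> [[a /andP[/orP b /orP c]]|[a b c]]; split => //.
by apply/andP; split; apply/orP.
Qed.

Variable G : set C.

Definition good u := blk u `<=` G /\ blk u !=set0.
(** Such blocks may be traded for their hull, a single convex piece of [G]. *)
Definition linked u v := u.1 = v.1 /\ blk (hull u v) `<=` G.

Lemma linked_sym u v : linked u v -> linked v u.
Proof.
move=> [uv hG]; split=> // z /hullP[a b c]; apply: hG; apply/hullP; split.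
- by rewrite uv.
- by case: b; [right|left].
- by case: c; [right|left].
Qed.

Lemma good_le u : good u -> u.2.1 <= u.2.2.
Proof. by move=> [_ [z [_ /andP[a b]]]]; exact: le_trans b. Qed.

(** The two given hulls overlap in the nonempty block [v] and together cover the third one; an empty
    [v] could leave a gap. *)
Lemma linked_trans v u w : good v -> linked u v -> linked v w -> linked u w.
Proof.
move=> /good_le gv [uv h1] [vw h2]; split; first by rewrite uv.
move=> z /hullP[a b c]; have [zv|vz] := leP (Im z) v.2.2.
  have [zv'|vz'] := leP v.2.1 (Im z).
    by apply: h1; apply/hullP; split=> //; right.
  case: b => b; [apply: h1|apply: h2]; apply/hullP; split => //; [by left|by right| |by right|by left].
  by rewrite -uv.
have vz' : v.2.1 <= Im z by rewrite (le_trans gv) // ltW.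
case: c => c; [apply: h1|apply: h2]; apply/hullP; split => //; [by right|by left| |by left|by right].
by rewrite -uv.
Qed.

Lemma blk_hull_l u v : blk u `<=` blk (hull u v).
Proof. by move=> z [a /andP[b c]]; apply/hullP; split => //; left. Qed.

Lemma blk_hull_r u v : u.1 = v.1 -> blk v `<=` blk (hull u v).
Proof. by move=> uv z [a /andP[b c]]; apply/hullP; split; [rewrite uv|right|right]. Qed.

Lemma linked_refl u : good u -> linked u u.
Proof. by move=> [uG _]; split => // z /hullP[a b c]; apply: uG; split=> //; case: b c => ? [? |?]; apply/andP. Qed.

Lemma good_hull u v : good u -> linked u v -> good (hull u v).
Proof.
move=> [_ [z uz]] [_ hG]; split=> //; exists z; exact: blk_hull_l.
Qed.

Lemma linked_hull u v : linked u v -> linked u (hull u v).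
Proof.
move=> [uv hG]; split => // z /hullP /= [a b c]; apply: hG; split => //=.
apply/andP; split.
  by case: b => // b; rewrite ge_min b.
by case: c => // c; rewrite le_max c.
Qed.

(** Intervals of heights with a common point leave no gap, so the hull is just the union. *)
Lemma meet_linked u v : good u -> good v -> u.1 = v.1 ->
  forall y, u.2.1 <= y <= u.2.2 -> v.2.1 <= y <= v.2.2 -> linked u v.
Proof.
move=> [uG _] [vG _] uv y /andP[u1 u2] /andP[v1 v2]; split => // z /hullP[a b c].
have [zu|zu] := pselect (u.2.1 <= Im z <= u.2.2); first exact: uG.
apply: vG; split; first by rewrite -uv.
apply/andP; split.
- case: b => // b; case: c => c; first by case: zu; rewrite b c.
  rewrite leNgt; apply/negP => k; apply: zu; rewrite b /=; lra.
- case: c => // c; case: b => b; first by case: zu; rewrite b c.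
  rewrite leNgt; apply/negP => k; apply: zu; rewrite c andbT; lra.
Qed.

(** Absence of holes, in the form in which the combinatorics of blocks uses it. *)
Definition logfree := forall S p, compact S -> S `<=` G -> ~ G p ->
  haslog S (fun z => z - p).

Lemma Im_clog_gt0 z : slit z -> 0 < Im z -> 0 < Im (clog z).
Proof.
by move=> sz z0; rewrite /clog /= mulr_gt0 // -(atan0 R); apply: lt_atan; rewrite divr_gt0.
Qed.

Lemma Im_clog_lt0 z : slit z -> Im z < 0 -> Im (clog z) < 0.
Proof.
move=> sz z0; rewrite /clog /= pmulr_rlt0 // -(atan0 R); apply: lt_atan.
by rewrite pmulr_llt0 // invr_gt0.
Qed.

(** The difference of the branches has a constant exponential, and small increments with exponential
    1 vanish by [cexp_eq1]. *)
Lemma branch_constant S (l m : C -> C) (k : C) : connected S ->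
  {within S, continuous l} -> {within S, continuous m} ->
  (forall z, S z -> cexp (l z - m z) = k) ->
  forall z z', S z -> S z' -> l z - m z = l z' - m z'.
Proof.
move=> cS cl cm E z z' Sz Sz'; apply/esym.
apply: (connected_locally_constant cS (P := fun q => l q - m q = l z - m z) _ Sz) => //.
move=> q Sq; have e0 : 0 < 1 / 2 :> R by rewrite divr_gt0.
have /within_continuousCC/(_ q Sq _ e0)[d d0 hd] := cl.
have /within_continuousCC/(_ q Sq _ e0)[d' d'0 hd'] := cm.
apply/nbhsC; exists (Num.min d d'); first by rewrite lt_min d0.
move=> q'; rewrite lt_min => /andP[qd qd'] Sq'.
suff -> : l q' - m q' = l q - m q by [].
apply/eqP; rewrite -subr_eq0; apply/eqP/cexp_eq1.
  have -> : l q' - m q' - (l q - m q) = (l q' - l q) - (m q' - m q) by ring.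
  apply: le_lt_trans (ler_nrmD _ _) _; rewrite nrmN.
  by have := hd _ Sq' qd; have := hd' _ Sq' qd'; rewrite /distC; lra.
by rewrite cexpB E // E // divff // -(E z Sz) cexp_neq0.
Qed.

Lemma blk_column_le u v z : blk u z -> blk v z -> (u.1 <= v.1 + 1)%R.
Proof.
move=> [/andP[a1 _] _] [/andP[_ b2] _].
by rewrite -(ler_int R) -(ler_pM2r h0) (le_trans a1).
Qed.

Lemma int_le_cases (a k : int) : a <= k -> [\/ a = k, a = k - 1 | a + 1 <= k - 1].
Proof.
have [->|ak] := eqVneq a k; first by constructor 1.
have [->|ak1] := eqVneq a (k - 1); first by constructor 2.
by constructor 3; lia.
Qed.

(* The block of maximal column separates the two blocks adjacent to it: a point
   outside G between these two sees only that block to its right, so that a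
   logarithm around it would have to jump. *)
Lemma no_cycle (w : nat -> block) m : logfree -> (3 <= m)%N ->
  (forall i, (i < m)%N -> good (w i)) ->
  (forall i, (i < m)%N -> blk (w i) `&` blk (w (i.+1 %% m)%N) !=set0) ->
  (forall i j, (i < j < m)%N -> ~ linked (w i) (w j)) -> False.
Proof.
move=> lf m3 gw aw nlw.
have m0 : (0 < m)%N by exact: leq_trans m3.
have [i0 i0m hmax] : exists2 i0, (i0 < m)%N & forall i, (i < m)%N -> (w i).1 <= (w i0).1.
  have : exists2 i : 'I_m, true & forall j : 'I_m, true -> (w j).1 <= (w i).1.
    case: (@Order.TotalTheory.arg_maxP _ _ 'I_m (Ordinal m0) predT (fun i => (w i).1)) => // i _ hi.
    by exists i => // j _; exact: hi.
  by move=> [i _ hi]; exists i => // j jm; have := hi (Ordinal jm) isT.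
(* Cyclic reindexing puts the block of maximal column first, with neighbours [v 1] and [v m.-1],
   which are distinct positions because [3 <= m]. *)
pose v i := w ((i + i0) %% m)%N.
have vm i : ((i + i0) %% m < m)%N by rewrite ltn_mod.
have gv i : good (v i) by exact: gw.
have av i : blk (v i) `&` blk (v i.+1) !=set0.
  have := aw _ (vm i); rewrite /v addSn.
  by rewrite -addn1 modnDml addn1.
have nv i j : (i < j < m)%N -> ~ linked (v i) (v j).
  move=> /andP[ij jm].
  have ne : ((i + i0) %% m != (j + i0) %% m)%N.
    by rewrite eqn_modDr !modn_small ?(ltn_trans ij) // ltn_eqF.
  move: ne; rewrite neq_ltn => /orP[] k; first by apply: nlw; rewrite k vm.
  by move=> /linked_sym; apply: nlw; rewrite k vm.
have v0m : v m = v 0 by rewrite /v modnDl add0n modn_small.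
have vmax i : (v i).1 <= (v 0).1.
  by rewrite {2}/v add0n (modn_small i0m); exact: hmax.
clearbody v; clear w gw aw nlw i0 i0m hmax vm.
set k := (v 0).1 in vmax.
pose Rb := v 0; pose v1 := v 1; pose v2 := v m.-1.
have mm : m.-1.+1 = m by rewrite prednK.
have [x1 [Rx1 v1x1]] := av 0.
have [x2 [v2x2 Rx2]] := av m.-1; rewrite mm v0m in Rx2.
have col i q : (0 < i < m)%N -> blk (v 0) q -> blk (v i) q -> (v i).1 = k - 1.
  move=> im b1 b2; have c1 := blk_column_le b1 b2; rewrite -/k in c1.
  have c2 := vmax i; case: (int_le_cases c2) => [c3|//|c3]; last first.
    by exfalso; move: c1 c3; clear; lia.
  exfalso; apply: (nv 0 i im); apply: (@meet_linked _ _ _ _ _ (Im q)) => //.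
    by case: b1.
  by case: b2.
have im1 : (0 < 1 < m)%N by rewrite /= (leq_trans _ m3).
have m1m : (m.-1 < m)%N by rewrite mm.
have im2 : (0 < m.-1 < m)%N by rewrite m1m andbT -ltnS mm; exact: leq_trans m3.
have im12 : (1 < m.-1 < m)%N by rewrite m1m andbT -ltnS mm.
have c1 : v1.1 = k - 1 by exact: (@col 1%N x1).
have c2 : v2.1 = k - 1 by exact: (@col m.-1 x2).
have nl12 : ~ linked v1 v2 by exact: nv.
(* The two neighbours share the column [k - 1] without being linked, so a point outside [G] lies in
   the vertical gap between them. *)
have [p [hp nGp]] : exists p, blk (hull v1 v2) p /\ ~ G p.
  apply: contrapT => np; apply: nl12; split; first by rewrite c1 c2.
  by move=> z hz; apply: contrapT => nz; apply: np; exists z.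
have inG i z : blk (v i) z -> G z by apply: (gv i).1.
have nb i : ~ blk (v i) p by move=> /inG.
move: hp => /hullP; rewrite c1 => -[/andP[pR1 pR2] pl pr].
rewrite subrK in pR2.
have sides : (v1.2.2 < Im p < v2.2.1) \/ (v2.2.2 < Im p < v1.2.1).
  have n1 := nb 1%N; have n2 := nb m.-1.
  have k1 : ~ (v1.2.1 <= Im p <= v1.2.2).
    by move=> b; apply: n1; split=> //; rewrite -/v1 c1 pR1 subrK.
  have k2 : ~ (v2.2.1 <= Im p <= v2.2.2).
    by move=> b; apply: n2; split=> //; rewrite -/v2 c2 pR1 subrK.
  have := good_le (gv 1%N); have := good_le (gv m.-1); rewrite -/v1 -/v2 => l1 l2.
  have [q1|q1] := leP v1.2.1 (Im p); last first.
    right; apply/andP; split; last by [].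
    case: pl => pl; first lra.
    by rewrite ltNge; apply/negP => q; apply: k2; apply/andP.
  have [q2|q2] := leP (Im p) v1.2.2; first by case: k1; apply/andP.
  left; apply/andP; split; first by [].
  case: pr => pr; first lra.
  by rewrite ltNge; apply/negP => q; apply: k2; apply/andP.
have Rp y : (v 0).2.1 <= y <= (v 0).2.2 -> Im p = y -> Re p < k%:~R * h.
  move=> yR yp; rewrite lt_neqAle pR2 andbT; apply/eqP => E; apply: (nb 0).
  split; last by rewrite yp.
  by rewrite -/k E lexx /= ler_pM2r // ler_int lerDl.
have [s1 s2] : (v1.2.1 <= Im x1 <= v1.2.2) /\ (v2.2.1 <= Im x2 <= v2.2.2).
  by split; [case: v1x1|case: v2x2].
have pin : (v 0).2.1 <= Im p <= (v 0).2.2.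
  have [_ r1] := Rx1; have [_ r2] := Rx2; case: sides; lra.
have Rpk := Rp _ pin erefl.
pose S := [set z | exists2 i, (i < m)%N & blk (v i) z].
have cS : compact S.
  have -> : S = \bigcup_(i in `I_m) blk (v i) by rewrite predeqE => z; split=> -[i ? ?]; exists i.
  rewrite bigcup_mkord; apply: bigsetU_compact => i _; exact: blk_compact.
have SG : S `<=` G by move=> z [i _ /inG].
have [l [cl El]] := lf S p cS SG nGp.
have cli i : (i < m)%N -> {within blk (v i), continuous l}.
  by move=> im; apply: continuous_subspaceW cl => z zi; exists i.
have Eli i z : (i < m)%N -> blk (v i) z -> cexp (l z) = z - p.
  by move=> im zi; apply: El; exists i.
(* The horizontal ray from [p] to the right meets no block but [v 0]: in column [k] such a block
   would be linked to [v 0], in column [k - 1] it would contain [p], and further left only [p]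
   itself could be hit. *)
have slitN i z : (0 < i < m)%N -> blk (v i) z -> slit (p - z).
  move=> im zi; rewrite /slit ltNge; apply/negP => ns.
  have n1 := normRe_le (p - z); have n2 := ler_norm (- Re (p - z)).
  rewrite normrN in n2.
  have nE : nrm (p - z) = - Re (p - z) by apply/eqP; rewrite eq_le; lra.
  have I0 : Im (p - z) = 0.
    by apply/eqP; rewrite -sqrf_eq0; have := sqr_nrm (p - z); rewrite nE sqrrN => q; apply/eqP; lra.
  have zp : Im z = Im p by move: I0; rewrite ImB; lra.
  have rzp : Re p <= Re z by have := nrm_ge0 (p - z); rewrite nE ReB; lra.
  have [/andP[a1 a2] b] := zi; rewrite zp in b.
  have ck := vmax i.
  case: (int_le_cases ck) => [ik|ik|ik3].
  - by apply: (nv 0 i im); apply: (@meet_linked _ _ _ _ _ (Im p)).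
  - by apply: (nb i); rewrite ik in a1 a2 *; split=> //; apply/andP; split; rewrite ?ik // subrK.
  have rk3 : ((v i).1 + 1)%:~R * h <= (k - 1)%:~R * h by rewrite ler_pM2r // ler_int.
  have pz : p = z by apply: complex_ext => //; lra.
  by apply: (nb i); rewrite pz.
have slitR z : blk (v 0) z -> slit (z - p).
  move=> [/andP[a1 _] _]; apply: Re_gt0_slit; rewrite ReB; rewrite -/k in a1; lra.
have cN i : (0 < i < m)%N -> {within blk (v i), continuous (fun z => clog (p - z))}.
  move=> im; apply/subspace_continuousP => z zi.
  apply: (@cvg_comp _ _ _ (fun z => p - z) (@clog R) _ (nbhs (p - z))).
    have : {for z, continuous (fun z : C => p - z)}.
      by apply: (@continuousB _ _ _ (fun=> p) id); [exact: cst_continuous|exact: cvg_id].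
    by move=> cz; apply: cvg_within_filter; exact: cz.
  by apply: clog_continuous; exact: slitN zi.
have cP : {within blk (v 0), continuous (fun z => clog (z - p))}.
  apply/subspace_continuousP => z zi.
  apply: (@cvg_comp _ _ _ (fun z => z - p) (@clog R) _ (nbhs (z - p))).
    have : {for z, continuous (fun z : C => z - p)}.
      by apply: (@continuousB _ _ _ id (fun=> p)); [exact: cvg_id|exact: cst_continuous].
    by move=> cz; apply: cvg_within_filter; exact: cz.
  by apply: clog_continuous; exact: slitR.
have constN i z z' : (0 < i < m)%N -> blk (v i) z -> blk (v i) z' ->
    l z - clog (p - z) = l z' - clog (p - z').
  move=> im; move: z z'; apply: (@branch_constant _ l (fun z => clog (p - z)) (-1) (@blk_connected (v i))).
  - by apply: cli; case/andP: im.
  - exact: cN.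
  - move=> q qi; have sq := slitN i q im qi.
    rewrite cexpB (Eli i) //; last by case/andP: im.
    rewrite clogK // -opprB mulNr divff //; exact: slit_neq0.
have chain i z z' : (0 < i < m)%N -> blk (v 1) z -> blk (v i) z' ->
    l z - clog (p - z) = l z' - clog (p - z').
  elim: i z' => [//|i IH] z' im z1 zi'.
  have [i1|i1] := posnP i; first by rewrite i1 in zi'; exact: (constN 1%N).
  have [q [qi qi']] := av i.
  rewrite (IH q) //; last by rewrite i1 ltnW //; case/andP: im.
  exact: (constN i.+1).
have constR z z' : blk (v 0) z -> blk (v 0) z' ->
    l z - clog (z - p) = l z' - clog (z' - p).
  move: z z'; apply: (@branch_constant _ l (fun z => clog (z - p)) 1 (@blk_connected (v 0))).
  - exact: cli.
  - exact: cP.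
  - move=> q qi; have sq := slitR q qi.
    by rewrite cexpB (Eli 0) // clogK // divff //; exact: slit_neq0.
have E1 := constR _ _ Rx1 Rx2.
have E2 := chain _ _ _ im2 v1x1 v2x2.
have sx1 := slitR _ Rx1; have sx2 := slitR _ Rx2.
have tx1 : slit (p - x1) by exact: (slitN 1%N).
have tx2 : slit (p - x2) by exact: (slitN m.-1).
(* Compared with [l] along the chain and inside [v 0], the two branches have the same difference at
   [x1] and at [x2]. But these points lie on opposite sides of the height of [p], where the
   imaginary part of this difference has opposite signs. *)
have EI : Im (clog (p - x1)) - Im (clog (x1 - p)) = Im (clog (p - x2)) - Im (clog (x2 - p)).
  have := congr1 (@Im R) E1; have := congr1 (@Im R) E2; rewrite !ImB; lra.
case: sides => sd.
- have a1 : Im (x1 - p) < 0 by rewrite ImB; lra.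
  have a2 : 0 < Im (p - x1) by rewrite ImB; lra.
  have a3 : 0 < Im (x2 - p) by rewrite ImB; lra.
  have a4 : Im (p - x2) < 0 by rewrite ImB; lra.
  have := Im_clog_lt0 sx1 a1; have := Im_clog_gt0 tx1 a2.
  have := Im_clog_gt0 sx2 a3; have := Im_clog_lt0 tx2 a4; lra.
- have a1 : 0 < Im (x1 - p) by rewrite ImB; lra.
  have a2 : Im (p - x1) < 0 by rewrite ImB; lra.
  have a3 : Im (x2 - p) < 0 by rewrite ImB; lra.
  have a4 : 0 < Im (p - x2) by rewrite ImB; lra.
  have := Im_clog_gt0 sx1 a1; have := Im_clog_lt0 tx1 a2.
  have := Im_clog_lt0 sx2 a3; have := Im_clog_gt0 tx2 a4; lra.
Qed.

End Blocks.

(** * Homotopy moves *)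

Section Homotopy.
Variable R : realType.
Local Notation C := (cplane R).
Implicit Types (z p q : C) (e r s t a b : R) (S D G A : set C) (c d : R -> C).

Definition path_in G c := forall t, 0 <= t <= 1 -> G (c t).

Lemma seg_joint (T : topologicalType) (f g : T -> C) (k : T -> R) :
  continuous f -> continuous g -> continuous k ->
  continuous (fun x => seg (f x) (g x) (k x)).
Proof.
move=> cf cg ck x; apply: (@continuousD _ _ _ f (fun x => (k x)%:C * (g x - f x))).
  exact: cf.
apply: (@continuousM _ _ (fun x => (k x)%:C : C) (fun x => g x - f x)).
  apply: (@continuous_comp _ _ _ k (fun y : R => y%:C : C)); first exact: ck.
  apply/continuousRC => e e0; exists e => // y.
  by rewrite -rmorphB /= nrm_real.
by apply: continuousB; [exact: cg|exact: cf].
Qed.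

Lemma closed_rectangle (A B : set R) : closed A -> closed B -> closed (A `*` B).
Proof.
move=> cA cB; have -> : A `*` B = (@fst R R) @^-1` A `&` (@snd R R) @^-1` B by [].
by apply: closedI; apply: preimage_closed => // p _; [exact: cvg_fst|exact: cvg_snd].
Qed.

Lemma square_cover : `[(0 : R), 1] `*` `[(0 : R), 1] =
  (`[(0 : R), 1 / 2] `*` `[(0 : R), 1]) `|` (`[1 / 2, (1 : R)] `*` `[(0 : R), 1]).
Proof.
rewrite predeqE => -[x y]; split => /=; rewrite !in_itv /=.
- move=> [/andP[x0 x1] yI]; have [h|h] := leP x (1 / 2); [left|right]; split => //=; rewrite ?x0 ?h ?(ltW h) ?x1 //.
- by move=> [] [/andP[x0 x1] yI]; split => //; lra.
Qed.

(** The straight-line homotopy from [c] to [d] fills the first half of the parameter interval, and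
    the contraction of [d], at double speed, the second. *)
Lemma null_homotopic_step G c d : continuous c -> continuous d ->
  (forall t s, 0 <= t <= 1 -> 0 <= s <= 1 -> G (seg (c t) (d t) s)) ->
  c 0 = d 0 -> c 1 = c 0 -> d 1 = d 0 ->
  null_homotopic_in G d -> null_homotopic_in G c.
Proof.
move=> cc cd Gs c0d c1 d1 [H [cH GH H0 H1 Hs]].
have in01 (x : R) : (x \in `[0, 1]) = (0 <= x <= 1) by rewrite in_itv.
pose K (p : R * R) : C := if p.1 <= 1 / 2 then seg (c p.2) (d p.2) (2 * p.1) else H (2 * p.1 - 1, p.2).
have Khalf t : t \in `[0, 1] -> H (2 * (1 / 2) - 1, t) = d t.
  by move=> t01; rewrite -H0 //; congr (H (_, _)); field.
exists K; split.
- rewrite square_cover; apply: withinU_continuous.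
  + by apply: closed_rectangle; exact: itv_closed.
  + by apply: closed_rectangle; exact: itv_closed.
  + apply: (@subspace_eq_continuous _ _ _ (fun p : R * R => seg (c p.2) (d p.2) (2 * p.1))).
      by move=> [x y] /set_mem[/=]; rewrite in_itv /= => /andP[x0 x1] _; rewrite /K /from_subspace /=; case: ifPn => // /negP[].
    apply: continuous_subspaceT; apply: seg_joint.
    * by move=> p; apply: continuous_comp; [exact: cvg_snd|exact: cc].
    * by move=> p; apply: continuous_comp; [exact: cvg_snd|exact: cd].
    * move=> p; apply: (@continuousM R (R * R)%type (fun=> 2) fst); [exact: cst_continuous|exact: cvg_fst].
  + apply: (@subspace_eq_continuous _ _ _ (fun p : R * R => H (2 * p.1 - 1, p.2))).
      move=> [x y] /set_mem[/=]; rewrite !in_itv /= => /andP[x0 x1] yI; rewrite /K /from_subspace /=.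
      case: ifPn => // x2; have -> : x = 1 / 2 by apply/eqP; rewrite eq_le x2 x0.
      rewrite Khalf ?in_itv //.
      have -> : 2 * (1 / 2) = 1 :> R by field.
      by rewrite seg1.
    apply/subspace_continuousP => -[x y] [/= xI yI].
    move: xI yI; rewrite !in_itv /= => xI yI.
    have HI : ((`[(0 : R), 1] `*` `[(0 : R), 1]) (2 * x - 1, y)).
      by split => /=; rewrite in_itv //=; lra.
    have /subspace_continuousP/(_ _ HI) := cH => cHx B nB.
    have nb : nbhs (2 * x - 1, y)
      (fun p : R * R => (`[(0 : R), 1] `*` `[(0 : R), 1]) p -> B (H p)) := cHx B nB.
    have k1 : {for (x, y), continuous (fun p : R * R => 2 * p.1 - 1)}.
      by apply: cvgB; [apply: cvgM; [exact: cvg_cst|exact: cvg_fst]|exact: cvg_cst].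
    have k2 : {for (x, y), continuous (@snd R R)} by exact: cvg_snd.
    have ca : {for (x, y), continuous (fun p : R * R => (2 * p.1 - 1, p.2))} by exact: (cvg_pair k1 k2).
    change (nbhs (x, y) (fun p : R * R => (`[1 / 2, (1 : R)] `*` `[(0 : R), 1]) p ->
      B (H (2 * p.1 - 1, p.2)))).
    have nb2 : nbhs (x, y) (fun p : R * R =>
      (`[(0 : R), 1] `*` `[(0 : R), 1]) (2 * p.1 - 1, p.2) -> B (H (2 * p.1 - 1, p.2))) := ca _ nb.
    move: nb2; apply: (@filterS (R * R)%type (nbhs (x, y))) => -[x' y'] /= hB [x'I y'I].
    apply: hB; move: x'I y'I; rewrite !in_itv /= => x'I y'I; split => //=; rewrite ?in_itv //=; lra.
- move=> s t; rewrite !in01 => s01 t01; rewrite /K /=.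
  case: ifPn => s2; first by apply: Gs => //; lra.
  by apply: GH; rewrite in01 //; rewrite -ltNge in s2; lra.
- move=> t t01; rewrite /K /=; case: ifPn => [_|/negP[]]; first by rewrite mulr0 seg0.
  by rewrite divr_ge0.
- move=> t t01; rewrite /K /=.
  have -> : (1 <= 1 / 2 :> R) = false by apply/negbTE; rewrite -ltNge; lra.
  by rewrite c0d -(H1 t t01); congr (H (_, _)); ring.
- move=> s; rewrite in01 => s01; rewrite /K /=; case: ifPn => s2.
    by rewrite d1 c1 -c0d !segxx.
  by rewrite c0d; apply: Hs; rewrite in01 //; rewrite -ltNge in s2; lra.
Qed.

(** Contracting towards [c 0] keeps the base point fixed. *)
Lemma null_homotopic_convex G A c : continuous c -> cconvex A -> A `<=` G ->
  (forall t, 0 <= t <= 1 -> A (c t)) -> c 1 = c 0 -> null_homotopic_in G c.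
Proof.
move=> cc vA AG Ac c1.
exists (fun p : R * R => seg (c p.2) (c 0) p.1); split.
- apply: continuous_subspaceT; apply: seg_joint.
  + by move=> p; apply: continuous_comp; [exact: cvg_snd|exact: cc].
  + by move=> p; exact: cst_continuous.
  + by move=> p; exact: cvg_fst.
- move=> s t; rewrite !in_itv /= => s01 t01; apply/AG/vA => //; apply: Ac => //.
  by rewrite lexx ler01.
- by move=> t _ /=; rewrite seg0.
- by move=> t _ /=; rewrite seg1.
- by move=> s _ /=; rewrite c1 segxx.
Qed.

Definition clip a b t := Num.max a (Num.min b t).

Lemma clip_continuous a b : continuous (clip a b).
Proof.
move=> t; apply: (@continuous_max R R (fun=> a) (fun t => Num.min b t)); first exact: cst_continuous.
by apply: (@continuous_min R R (fun=> b) id); [exact: cst_continuous|exact: cvg_id].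
Qed.

Lemma clip_in a b t : a <= t <= b -> clip a b t = t.
Proof. by move=> /andP[h1 h2]; rewrite /clip (min_idPr h2) (max_idPr h1). Qed.

Lemma clip_lt a b t : a <= b -> t <= a -> clip a b t = a.
Proof. by move=> ab ta; rewrite /clip (min_idPr (le_trans ta ab)) (max_idPl ta). Qed.

Lemma clip_gt a b t : a <= b -> b <= t -> clip a b t = b.
Proof. by move=> ab bt; rewrite /clip (min_idPl bt) (max_idPr ab). Qed.

(** Between [a] and [b] the path is replaced by its chord. The change is written as a correction
    that vanishes elsewhere, so continuity follows by composition, without gluing. *)
Definition straighten c a b t : C :=
  c t + (seg (c a) (c b) ((clip a b t - a) / (b - a)) - c (clip a b t)).

Lemma straighten_out c a b t : a <= b -> t <= a \/ b <= t -> straighten c a b t = c t.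
Proof.
move=> ab [ta|bt]; rewrite /straighten; [rewrite clip_lt //|rewrite clip_gt //].
  by rewrite subrr mul0r seg0 subrr addr0.
have [->|ab0] := eqVneq a b; first by rewrite subrr mul0r seg0 subrr addr0.
by rewrite divff ?subr_eq0 1?eq_sym // seg1 subrr addr0.
Qed.

Lemma straighten_in c a b t : a <= t <= b ->
  straighten c a b t = seg (c a) (c b) ((t - a) / (b - a)).
Proof. by move=> tab; rewrite /straighten clip_in // addrC subrK. Qed.

Lemma clip_ratio a b t : a <= t <= b -> 0 <= (t - a) / (b - a) <= 1.
Proof.
move=> /andP[at_ tb]; have ab := le_trans at_ tb.
have [->|nab] := eqVneq a b; first by rewrite subrr invr0 mulr0 lexx ler01.
have ba : 0 < b - a by rewrite subr_gt0 lt_neqAle nab.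
by rewrite divr_ge0 ?subr_ge0 // ler_pdivrMr // mul1r lerD2r.
Qed.

Lemma straighten_continuous c a b : continuous c -> continuous (straighten c a b).
Proof.
move=> cc t.
apply: (@continuousD _ _ _ c (fun t => seg (c a) (c b) ((clip a b t - a) / (b - a)) - c (clip a b t))).
  exact: cc.
apply: (@continuousB _ _ _ (fun t => seg (c a) (c b) ((clip a b t - a) / (b - a))) (fun t => c (clip a b t))).
  apply: (@continuous_comp _ _ _ (fun t => (clip a b t - a) / (b - a)) (seg (c a) (c b))); last exact: seg_continuous.
  apply: (@continuousM R R (fun t => clip a b t - a) (fun=> (b - a)^-1)); last exact: cst_continuous.
  by apply: (@continuousB R R^o R (clip a b) (fun=> a)); [exact: clip_continuous|exact: cst_continuous].
by apply: continuous_comp; [exact: clip_continuous|exact: cc].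
Qed.

Lemma straighten_step G A c a b : continuous c -> path_in G c -> c 1 = c 0 ->
  0 <= a -> a <= b -> b <= 1 -> cconvex A -> A `<=` G ->
  (forall t, a <= t <= b -> A (c t)) ->
  let d := straighten c a b in
  [/\ continuous d, path_in G d, d 1 = d 0, d 0 = c 0 &
      null_homotopic_in G d -> null_homotopic_in G c].
Proof.
move=> cc Gc c1 a0 ab b1 vA AG Ac d.
have cd : continuous d by exact: straighten_continuous.
have Aa : A (c a) by apply: Ac; rewrite lexx.
have Ab : A (c b) by apply: Ac; rewrite lexx ab.
have Ad t : a <= t <= b -> A (d t).
  by move=> tab; rewrite /d straighten_in //; apply: vA => //; exact: clip_ratio.
have d0 : d 0 = c 0 by rewrite /d straighten_out //; left.
have d1 : d 1 = c 1 by rewrite /d straighten_out //; right.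
have dout t : ~ (a <= t <= b) -> d t = c t.
  move=> tab; rewrite /d straighten_out //.
  have [h|h] := leP t a; [by left|right; rewrite leNgt; apply/negP => k; apply: tab].
  by rewrite (ltW h) ltW.
split => //; [|by rewrite d1 d0| ].
- move=> t t01; have [tab|tab] := pselect (a <= t <= b); first exact/AG/Ad.
  by rewrite dout //; exact: Gc.
- apply: null_homotopic_step => //; last by rewrite d1 d0.
  move=> t s t01 s01; have [tab|tab] := pselect (a <= t <= b).
    by apply/AG/vA => //; [exact: Ac|exact: Ad].
  by rewrite dout // segxx; exact: Gc.
Qed.

End Homotopy.

(** * Reduction of loops of blocks *)

Section LoopReduction.
Variable R : realType.
Local Notation C := (cplane R).
Implicit Types (z p q : C) (e r s t a b : R) (S D A : set C) (c d : R -> C).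
Implicit Types (u v w : block R) (l : seq (block R * R)).
Variables (h : R) (G : set C).
Hypotheses (h0 : 0 < h) (lf : logfree G).

Local Notation blk := (blk h).
Local Notation good := (good h G).
Local Notation linked := (linked h G).

(** Take the shortest span between linked positions. A span of 3 or more would close up to a cycle
    of pairwise unlinked blocks, against [no_cycle]. *)
Lemma reducible_walk (w : nat -> block R) n : (1 <= n)%N ->
  (forall i, (i <= n)%N -> good (w i)) ->
  (forall i, (i < n)%N -> blk (w i) `&` blk (w i.+1) !=set0) ->
  linked (w 0%N) (w n) ->
  exists i, ((i < n)%N /\ linked (w i) (w i.+1)) \/
            ((i.+1 < n)%N /\ linked (w i) (w i.+2)).
Proof.
move=> n1 gw mw ln.
pose P (d : nat) := `[< (0 < d)%N /\ exists i, (i + d <= n)%N /\ linked (w i) (w (i + d)%N) >].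
have exP : exists k, P k by exists n; apply/asboolP; split => //; exists 0%N.
case: (ex_minnP exP) => d /asboolP[d0 [i [idn li]]] dmin.
have [d3|d3] := leqP 3 d; last first.
  exists i; have [d1|d1] := eqVneq d 1%N.
    by left; rewrite d1 addn1 in li idn.
  have d2 : d = 2%N by lia.
  by right; rewrite d2 addn2 in li idn.
(* The block at [i + d] is absorbed into the first one, which leaves exactly [d] blocks; a further
   link would give a span shorter than [d]. *)
exfalso; pose v j := if j == 0%N then hull (w i) (w (i + d)%N) else w (i + j)%N.
have gi : good (w i) by apply: gw; lia.
have lih := linked_hull li.
apply: (@no_cycle R h h0 G v d lf d3).
- move=> j jd; rewrite /v; case: eqP => _; first exact: good_hull.
  by apply: gw; lia.
- move=> j jd; have [jl|jl] := eqVneq j.+1 d.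
    rewrite jl modnn /v eqxx; have -> : (j == 0)%N = false by lia.
    have [|z [z1 z2]] := mw (i + j)%N; first by lia.
    exists z; split => //; apply: blk_hull_r; first by case: li.
    by rewrite -jl addnS.
  rewrite modn_small; last by lia.
  have [|z [z1 z2]] := mw (i + j)%N; first by lia.
  exists z; rewrite /v /= addnS; split => //.
  case: eqP => // j0; rewrite j0 addn0 in z1; exact: blk_hull_l.
- move=> j k /andP[jk kd]; have k0 : (k == 0)%N = false by lia.
  rewrite /v k0; case: eqP => [j0|j0] L.
    have : P k.
      apply/asboolP; split; first by lia.
      exists i; split; first by lia.
      by apply: linked_trans L; [exact: good_hull|].
    by move=> /dmin; lia.
  have : P (k - j)%N.
    apply/asboolP; split; first by lia.
    exists (i + j)%N; split; first by lia.
    by have -> : (i + j + (k - j) = i + k)%N by lia.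
  by move=> /dmin; lia.
Qed.

(** Each entry is a block with the time at which the path may leave it: [l] encodes a subdivision of
    the time from [s] to [e] with a block for each part. *)
Fixpoint pieces c s l e : Prop :=
  if l is (u, r) :: l' then
    [/\ s <= r, blk u `<=` G, forall t, s <= t <= r -> blk u (c t) & pieces c r l' e]
  else s = e.

Lemma pieces_le c s l e : pieces c s l e -> s <= e.
Proof.
elim: l s => [s -> //|[u r] l IH s /= [sr _ _ /IH]]; exact: le_trans.
Qed.

Lemma pieces_cat c s l1 l2 e :
  pieces c s (l1 ++ l2) e <-> exists2 r, pieces c s l1 r & pieces c r l2 e.
Proof.
elim: l1 s => [|[u r] l IH] s /=; first by split=> [H|[r -> //]]; exists s.
split=> [[sr uG cu /IH[r' h1 h2]]|[r' [sr uG cu h1] h2]]; first by exists r'.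
by split => //; apply/IH; exists r'.
Qed.

Lemma pieces_ext c d s l e : (forall t, s <= t <= e -> c t = d t) ->
  pieces c s l e -> pieces d s l e.
Proof.
elim: l s => [//|[u r] l IH] s cd /= [sr uG cu hl]; have re := pieces_le hl.
split => //.
  move=> t /andP[t1 t2]; have <- : c t = d t by apply: cd; rewrite t1 (le_trans t2).
  by apply: cu; rewrite t1.
by apply: IH hl => t /andP[t1 t2]; apply: cd; rewrite t2 (le_trans sr).
Qed.

Lemma pieces_good c s l e x0 i : pieces c s l e -> (i < size l)%N ->
  good (nth x0 l i).1.
Proof.
elim: l s i => [//|[u r] l IH] s [|i] /= [sr uG cu hl] il.
  by split => //; exists (c s); apply: cu; rewrite lexx.
exact: IH hl il.
Qed.

Lemma pieces_meet c s l e x0 i : pieces c s l e -> (i.+1 < size l)%N ->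
  blk (nth x0 l i).1 `&` blk (nth x0 l i.+1).1 !=set0.
Proof.
elim: l s i => [//|[u r] [//|[v r'] l] IH] s [|i] /= hl il.
  move: hl => [sr uG cu [rr' vG cv _]]; exists (c r); split.
    by apply: cu; rewrite sr lexx.
  by apply: cv; rewrite lexx.
by move: hl => [sr uG cu hl]; exact: (IH _ i hl).
Qed.

Lemma pieces_in_G c s l e : pieces c s l e -> (0 < size l)%N ->
  forall t, s <= t <= e -> G (c t).
Proof.
elim: l s => [//|[u r] l IH] s /= [sr uG cu hl] _ t /andP[t1 t2].
have [tr|tr] := leP t r; first by apply/uG/cu; rewrite t1.
case: l IH hl => [_ /= re|a l IH hl]; first by rewrite -re leNgt tr in t2.
by apply: IH hl _ _ _ => //; rewrite (ltW tr).
Qed.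

Let d0 : block R * R := ((0, (0, 0)), 0).

(* The walk stays closed in the graph of blocks modulo linked. *)
Definition closed_walk l := linked (head d0 l).1 (last d0 l).1.

(** The merged block is linked to both ends of the stretch it replaces, so the first and last blocks
    change at most to linked ones. *)
Lemma closed_walk_merge l1 l2 l3 (x y : block R * R) u r :
  linked x.1 u -> linked y.1 u ->
  good (head d0 (l1 ++ x :: l2 ++ y :: l3)).1 ->
  good (last d0 (l1 ++ x :: l2 ++ y :: l3)).1 ->
  closed_walk (l1 ++ x :: l2 ++ y :: l3) -> closed_walk (l1 ++ (u, r) :: l3).
Proof.
rewrite /closed_walk !last_cat /= last_cat /= => xu yu gh gl cw.
apply: (@linked_trans _ h G _ _ _ gh); first last.
  apply: (linked_trans gl cw); case: l3 gl {gh cw} => [//|z l3] /= gl; exact: linked_refl.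
by case: l1 gh {gl cw} => [|z l1] /= gh; [exact: linked_sym|exact: linked_refl].
Qed.

Lemma drop_nth_split l i : (i < size l)%N ->
  l = take i l ++ nth d0 l i :: drop i.+1 l.
Proof. by move=> il; rewrite -drop_nth // cat_take_drop. Qed.

(** Induction on the number of blocks. By [reducible_walk] there are linked blocks that are
    consecutive, and these merge, or that have one block between them, which a chord bypasses. A
    single block is contracted by convexity. *)
Lemma loop_null_homotopic n c l : (size l <= n)%N -> (0 < size l)%N ->
  continuous c -> c 1 = c 0 -> pieces c 0 l 1 -> closed_walk l ->
  null_homotopic_in G c.
Proof.
elim: n c l => [|n IH] c l ln l0 cc c1 pl cw; first by rewrite leqNgt l0 in ln.
have Gc : path_in G c by move=> t t01; exact: pieces_in_G pl l0 t t01.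
case: (ltngtP (size l) 1%N) => [|l2|l1]; first by rewrite ltnS leqNgt l0.
  have gl i : (i < size l)%N -> good (nth d0 l i).1 by exact: pieces_good pl.
  have sl : (size l).-1.+1 = size l by rewrite prednK.
  have [i hi] : exists i, ((i < (size l).-1)%N /\ linked (nth d0 l i).1 (nth d0 l i.+1).1) \/
      ((i.+1 < (size l).-1)%N /\ linked (nth d0 l i).1 (nth d0 l i.+2).1).
    apply: (reducible_walk (w := fun i => (nth d0 l i).1)).
    - by rewrite -ltnS sl.
    - by move=> i il; apply: gl; rewrite -sl ltnS.
    - by move=> i il; apply: pieces_meet pl _; rewrite -sl ltnS.
    - by rewrite nth0 nth_last.
  have gh : good (head d0 l).1 by rewrite -nth0; exact: gl.
  have gla : good (last d0 l).1 by rewrite -nth_last; apply: gl; rewrite prednK.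
  case: hi => -[il li].
  - have i1 : (i.+1 < size l)%N by rewrite -sl ltnS.
    have i2 : (i < size l)%N by exact: ltnW.
    have E : l = take i l ++ nth d0 l i :: [::] ++ nth d0 l i.+1 :: drop i.+2 l.
      by rewrite [LHS](drop_nth_split i2) (drop_nth d0 i1).
    have gi := gl _ i2; have gj := gl _ i1.
    have xu := linked_hull li.
    have yu := linked_trans gi (linked_sym li) xu.
    rewrite E in gh gla cw.
    move: (closed_walk_merge (nth d0 l i.+1).2 xu yu gh gla cw) => cw'.
    apply: (IH c _ _ _ cc c1 _ cw').
    + by rewrite -ltnS (leq_trans _ ln) // [in ltnRHS]E !size_cat /= !addnS.
    + by rewrite size_cat /= addnS.
    move: pl; rewrite {1}E => /pieces_cat[r p1 /=].
    case: (nth d0 l i) (nth d0 l i.+1) li gi => [x r1] [y r2] /= [exy hG] _.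
    move=> [r01 xG cx [r12 yG cy p3]]; apply/pieces_cat; exists r => //=; split => //.
      exact: le_trans r12.
    move=> t /andP[t1 t2]; have [tr|tr] := leP t r1.
      by apply: blk_hull_l; apply: cx; rewrite t1.
    by apply: blk_hull_r => //; apply: cy; rewrite (ltW tr).
  - have i0 : (i.+2 < size l)%N by rewrite -sl ltnS.
    have i1 : (i.+1 < size l)%N by exact: ltnW.
    have i2 : (i < size l)%N by exact: ltnW.
    have E : l = take i l ++ nth d0 l i :: [:: nth d0 l i.+1] ++ nth d0 l i.+2 :: drop i.+3 l.
      by rewrite [LHS](drop_nth_split i2) (drop_nth d0 i1) (drop_nth d0 i0).
    have gi := gl _ i2; have gj := gl _ i0.
    have xu := linked_hull li.
    have yu := linked_trans gi (linked_sym li) xu.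
    rewrite E in gh gla cw.
    move: (closed_walk_merge (nth d0 l i.+2).2 xu yu gh gla cw) => cw'.
    have sz : (size (take i l ++ (hull (nth d0 l i).1 (nth d0 l i.+2).1, (nth d0 l i.+2).2)
        :: drop i.+3 l) <= n)%N.
      rewrite -ltnS (leq_trans _ ln) // [in ltnRHS]E !size_cat /= !addnS ltnS; lia.
    have sz0 : (0 < size (take i l ++ (hull (nth d0 l i).1 (nth d0 l i.+2).1, (nth d0 l i.+2).2)
        :: drop i.+3 l))%N by rewrite size_cat /= addnS.
    move: pl; rewrite {1}E => /pieces_cat[r p1 /=] p2.
    move: cw' sz sz0 p2; clear E gh gla cw xu yu gi gj.
    case: (nth d0 l i) (nth d0 l i.+1) (nth d0 l i.+2) li => [x r1] [y r2] [z r3] /= [exz hG].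
    move=> cw' sz sz0 [r01 xG cx [r12 yG cy [r23 zG cz p4]]].
    have r0 := pieces_le p1; have r31 := pieces_le p4.
    have [] := @straighten_step R G (blk y) c r1 r2 cc Gc c1 (le_trans r0 r01) r12
      (le_trans r23 r31) (@blk_convex _ h y) yG cy.
    set d := straighten c r1 r2 => cd Gd d1 d0E; apply.
    apply: (IH d _ sz sz0 cd d1 _ cw').
    apply/pieces_cat; exists r.
      apply: pieces_ext p1 => t /andP[_ tr]; rewrite /d straighten_out //.
      by left; exact: le_trans r01.
    split => //=.
    + exact: le_trans r01 (le_trans r12 r23).
    + move=> t /andP[t1 t2]; have [tr|tr] := leP t r1.
        by rewrite /d straighten_out; [apply: blk_hull_l; apply: cx; rewrite t1|by []|by left].
      have [tr2|tr2] := leP r2 t.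
        by rewrite /d straighten_out; [apply: blk_hull_r => //; apply: cz; rewrite tr2|by []|by right].
      have tI : r1 <= t <= r2 by rewrite !ltW.
      rewrite /d straighten_in //; apply: blk_convex; last exact: clip_ratio.
        by apply: blk_hull_l; apply: cx; rewrite r01 lexx.
      by apply: blk_hull_r => //; apply: cz; rewrite lexx.
    + apply: pieces_ext p4 => t /andP[t1 _]; rewrite /d straighten_out //.
      by right; exact: le_trans t1.
case: l l1 pl {IH ln l0 cw} => [//|[u r] [|//]] _ /= [_ uG cu re].
by apply: (null_homotopic_convex cc (@blk_convex _ h u) uG) => // t t01; apply: cu; rewrite re.
Qed.

End LoopReduction.

(** * Simple connectivity *)

Section SimplyConnected.
Variable R : realType.
Local Notation C := (cplane R).
Implicit Types (z p q : C) (e r s t a b h : R) (S D A K G : set C) (c d : R -> C).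
Implicit Types (u v w : block R) (l : seq (block R * R)).

(** A near-covering argument with [r] tending to 0 from the right; asking the local hypothesis for
    all small [r] takes the place of monotonicity of [P]. *)
Lemma compact_uniform (X : topologicalType) (K : set X) (P : R -> X -> Prop) : compact K ->
  (forall x, K x -> exists2 e, 0 < e & \forall y \near x, forall r, 0 < r < e -> P r y) ->
  exists2 r, 0 < r & forall x, K x -> P r x.
Proof.
move=> /compact_near_coveringP cK hP.
have : \forall r \near (0 : R)^'+, K `<=` P r.
  apply: (cK R (0 : R)^'+ P) => x /hP[e e0 he].
  exists ([set y | forall r, 0 < r < e -> P r y], [set r | 0 < r < e]) => /=.
    split; first exact: he.
    near=> r; apply/andP; split; near: r; [exact: nbhs_right_gt|exact: nbhs_right_lt].
  by move=> [y r] /= [h1 h2]; exact: h1.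
move=> hK; near (0 : R)^'+ => r; exists r.
  by near: r; exact: nbhs_right_gt.
by near: r; exact: hK.
Unshelve. all: by end_near. Qed.

Lemma compact_open_margin K G : compact K -> open G -> K `<=` G ->
  exists2 r, 0 < r & forall z, K z -> cball z r `<=` G.
Proof.
move=> cK /openC oG KG; apply: (compact_uniform cK (P := fun r z => cball z r `<=` G)).
move=> z /KG/oG[e e0 he]; exists (e / 2); first by rewrite divr_gt0.
apply/nbhsC; exists (e / 2); first by rewrite divr_gt0.
move=> z' z'z r /andP[r0 re] w /= wz'; apply: he.
by have := ler_nrm_dist z' w z; move: wz'; rewrite /cball /=; lra.
Qed.

Lemma uniform_on_segment c e : continuous c -> 0 < e ->
  exists2 r, 0 < r & forall s t, 0 <= t <= 1 -> `|s - t| < r -> nrm (c s - c t) < e.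
Proof.
move=> cc e0.
have [|r r0 hr] := @compact_uniform R `[0, 1] (fun r t => forall s, `|s - t| < r -> nrm (c s - c t) < e)
  (@segment_compact _ 0 1).
  move=> t _; have e2 : 0 < e / 2 by rewrite divr_gt0.
  have /continuousRC/(_ _ e2)[d d0 hd] := cc t.
  exists (d / 2); first by rewrite divr_gt0.
  apply/nbhsR; exists (d / 2); first by rewrite divr_gt0.
  move=> t' t't r /andP[r0 rd] s st'.
  have h1 : nrm (c t' - c t) < e / 2 by apply: hd; lra.
  have h2 : nrm (c s - c t) < e / 2.
    by apply: hd; have := ler_distD t' s t; lra.
  by have := ler_nrm_dist (c t) (c s) (c t'); rewrite (nrmB (c t) (c t')); lra.
by exists r => // s t t01; apply: hr; rewrite /= in_itv.
Qed.

Lemma seg_between (x y s : R) : 0 <= s <= 1 -> Num.min x y <= x + s * (y - x) <= Num.max x y.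
Proof.
move=> /andP[s0 s1]; have [xy|yx] := leP x y; apply/andP; split.
- by rewrite lerDl mulr_ge0 // subr_ge0.
- rewrite -lerBrDl -[leRHS]mul1r ler_wpM2r // subr_ge0 //.
- by rewrite -lerBlDl -[leLHS]mul1r -subr_ge0 -mulrBl mulr_le0 //; [rewrite subr_le0|rewrite subr_le0 ltW].
- by rewrite gerDl mulr_ge0_le0 // subr_le0 ltW.
Qed.

Lemma floor_column h (x : R) : 0 < h -> exists k : int, k%:~R * h <= x <= (k + 1)%:~R * h.
Proof.
move=> h0; exists (Num.floor (x / h)); apply/andP; split.
  by rewrite -ler_pdivlMr // floor_le.
by rewrite -ler_pdivrMr // ltW // floorD1_gt.
Qed.

(** A segment shorter than the column width crosses at most one line between columns. The blocks
    used stay within [2 * h] horizontally and [h] vertically of [p], which the radius [4 * h]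
    covers. *)
Lemma segment_two_blocks h G p q : 0 < h -> nrm (q - p) < h -> cball p (4 * h) `<=` G ->
  exists u v s0, [/\ 0 <= s0 <= 1, blk h u `<=` G, blk h v `<=` G,
    forall s, 0 <= s <= s0 -> blk h u (seg p q s) &
    forall s, s0 <= s <= 1 -> blk h v (seg p q s)].
Proof.
move=> h0 pqh bG; have [k /andP[kp pk]] := floor_column (Re p) h0.
have dR : `|Re q - Re p| < h by rewrite -ReB; exact: le_lt_trans (normRe_le _) pqh.
have dI : `|Im q - Im p| < h by rewrite -ImB; exact: le_lt_trans (normIm_le _) pqh.
move: dR dI; rewrite !ltr_norml => /andP[R1 R2] /andP[I1 I2].
pose u (j : int) : block R := (j, (Num.min (Im p) (Im q), Num.max (Im p) (Im q))).
have kh : (k + 1)%:~R * h = k%:~R * h + h by rewrite rmorphD /= mulrDl mul1r.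
have uG (j : int) : k%:~R * h - h <= j%:~R * h <= k%:~R * h + h -> blk h (u j) `<=` G.
  move=> /andP[j1 j2] z [/andP[z1 z2] /= zI]; apply: bG.
  have jh : (j + 1)%:~R * h = j%:~R * h + h by rewrite rmorphD /= mulrDl mul1r.
  apply: le_lt_trans (nrm_le_ReIm _) _; rewrite ReB ImB.
  have aR : `|Re z - Re p| <= 2 * h by rewrite ler_norml; lra.
  have aI : `|Im z - Im p| <= h.
    move: zI; rewrite ge_min le_max ler_norml => /andP[/orP[a|a] /orP[b|b]]; lra.
  lra.
have Is s : 0 <= s <= 1 -> Num.min (Im p) (Im q) <= Im (seg p q s) <= Num.max (Im p) (Im q).
  by rewrite Im_seg; exact: seg_between.
have [qk|qk] := pselect (k%:~R * h <= Re q <= (k + 1)%:~R * h).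
  exists (u k), (u k), 1; rewrite ler01 lexx; split => //; try by apply: uG; lra.
    move=> s s01; split; last exact: Is.
    rewrite Re_seg; have /andP[b1 b2] := seg_between (Re p) (Re q) s01.
    move: b1 b2; rewrite ge_min le_max => /orP b1 /orP b2.
    by apply/andP; split; [case: b1|case: b2]; lra.
  move=> s /andP[s1 s1']; have -> : s = 1 by lra.
  by rewrite seg1; split => //=; rewrite ge_min le_max lexx !orbT.
(* [X] is the abscissa of the line crossed and [j] the column entered; this treats crossings to the
   right and to the left alike. *)
have main (X : R) (j : int) : Re q != Re p ->
    0 <= (X - Re p) / (Re q - Re p) <= 1 ->
    k%:~R * h - h <= j%:~R * h <= k%:~R * h + h ->
    (forall s, 0 <= s <= (X - Re p) / (Re q - Re p) ->
      k%:~R * h <= Re p + s * (Re q - Re p) <= (k + 1)%:~R * h) ->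
    (forall s, (X - Re p) / (Re q - Re p) <= s <= 1 ->
      j%:~R * h <= Re p + s * (Re q - Re p) <= (j + 1)%:~R * h) ->
    exists u v s0, [/\ 0 <= s0 <= 1, blk h u `<=` G, blk h v `<=` G,
      forall s, 0 <= s <= s0 -> blk h u (seg p q s) &
      forall s, s0 <= s <= 1 -> blk h v (seg p q s)].
  move=> qp s01 jk b1 b2; exists (u k), (u j), ((X - Re p) / (Re q - Re p)).
  split => //; try by apply: uG; lra.
  - move=> s /andP[s0 s1]; split; first by rewrite Re_seg; apply: b1; rewrite s0.
    by apply: Is; lra.
  - move=> s /andP[s0 s1]; split; first by rewrite Re_seg; apply: b2; rewrite s0.
    by apply: Is; lra.
have [qgt|qle] := ltP ((k + 1)%:~R * h) (Re q).
  have pq : 0 < Re q - Re p by lra.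
  have jh : (k + 1 + 1)%:~R * h = k%:~R * h + h + h by rewrite rmorphD /= mulrDl kh mul1r.
  apply: (main ((k + 1)%:~R * h) (k + 1)); first by rewrite -subr_eq0 gt_eqF.
  - by rewrite divr_ge0 ?ler_pdivrMr ?mul1r //; lra.
  - lra.
  - move=> s /andP[s0]; rewrite ler_pdivlMr // => s1.
    have := mulr_ge0 s0 (ltW pq); lra.
  - move=> s /andP[]; rewrite ler_pdivrMr // => s0 s1.
    have : s * (Re q - Re p) <= Re q - Re p by rewrite -[leRHS]mul1r ler_pM2r.
    lra.
have qlt : Re q < k%:~R * h.
  by rewrite ltNge; apply/negP => kq; apply: qk; rewrite kq.
have pq : Re q - Re p < 0 by lra.
have jh : (k - 1)%:~R * h = k%:~R * h - h by rewrite rmorphB /= mulrBl mul1r.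
apply: (main (k%:~R * h) (k - 1)); first by rewrite -subr_eq0 lt_eqF.
- apply/andP; split; first by apply: mulr_le0; rewrite ?invr_le0 ?(ltW pq) // subr_le0.
  by rewrite ler_ndivrMr // mul1r; lra.
- lra.
- move=> s /andP[s0]; rewrite ler_ndivlMr // => s1.
  have := mulr_ge0_le0 s0 (ltW pq); lra.
- move=> s /andP[]; rewrite ler_ndivrMr // => s0 s1.
  have : Re q - Re p <= s * (Re q - Re p) by rewrite -[leLHS]mul1r ler_nM2r.
  by rewrite subrK; lra.
Qed.

Lemma segment_pieces h G p q c a b : 0 < h -> nrm (q - p) < h -> cball p (4 * h) `<=` G ->
  a < b -> (forall t, a <= t <= b -> c t = seg p q ((t - a) / (b - a))) ->
  exists l, pieces h G c a l b.
Proof.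
move=> h0 pqh bG ab cE.
have [u [v [s0 [/andP[s00 s01] uG vG hu hv]]]] := segment_two_blocks h0 pqh bG.
have ba : 0 < b - a by rewrite subr_gt0.
pose m := a + s0 * (b - a).
have am : a <= m by rewrite lerDl mulr_ge0 // ltW.
have mb : m <= b by rewrite /m -lerBrDl -[leRHS]mul1r ler_wpM2r // ltW.
exists [:: (u, m); (v, b)]; split => //; last split => //.
- move=> t /andP[at_ tm]; rewrite cE ?at_ ?(le_trans tm) //; apply: hu.
  by rewrite divr_ge0 ?subr_ge0 ?(ltW ab) // ler_pdivrMr // lerBlDl.
- move=> t /andP[mt tb]; rewrite cE ?tb ?(le_trans am) //; apply: hv.
  by rewrite !(ler_pdivrMr, ler_pdivlMr) // lerBrDl mt mul1r lerD2r.
Qed.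

(** Chords are put in from left to right. Beyond [n / N] the path is still [c], so the estimates for
    [c] remain available for the next chord. *)
Lemma refine h G N c r : 0 < h -> continuous c -> path_in G c -> c 1 = c 0 -> (0 < N)%N ->
  N%:R^-1 < r ->
  (forall s t, 0 <= t <= 1 -> `|s - t| < r -> nrm (c s - c t) < h) ->
  (forall t, 0 <= t <= 1 -> cball (c t) (4 * h) `<=` G) ->
  forall n, (n <= N)%N -> exists d l, [/\ continuous d, path_in G d, d 1 = d 0,
    forall t, n%:R / N%:R <= t -> d t = c t &
    pieces h G d 0 l (n%:R / N%:R) /\ (null_homotopic_in G d -> null_homotopic_in G c)].
Proof.
move=> h0 cc Gc c1 N0 Nr hc bG; have NR : 0 < N%:R :> R by rewrite ltr0n.
elim=> [|n IH] nN; first by exists c, [::]; split => //; rewrite mul0r.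
have [d [l [cd Gd d1 dc [pl hd]]]] := IH (ltnW nN).
set a := n%:R / N%:R in dc pl; set b := n.+1%:R / N%:R.
have a0 : 0 <= a by rewrite divr_ge0.
have abN : b - a = N%:R^-1 by rewrite /a /b -mulrBl -natrB ?subSnn ?mul1r // leqnSn.
have ab : a < b by rewrite -subr_gt0 abN invr_gt0.
have b1 : b <= 1 by rewrite ler_pdivrMr // mul1r ler_nat.
have a01 : 0 <= a <= 1 by rewrite a0 (le_trans (ltW ab)).
have near_a t : a <= t <= b -> nrm (c t - c a) < h.
  move=> /andP[at_ tb]; apply: hc => //; rewrite ger0_norm ?subr_ge0 //.
  by apply: le_lt_trans Nr; rewrite -abN lerD2r.
have h4 : h < 4 * h by lra.
have [] := @straighten_step R G (cball (c a) (4 * h)) d a b cd Gd d1 a0 (ltW ab) b1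
   (@cball_convex _ _ _) (bG _ a01).
  move=> t tab; rewrite dc; last by case/andP: tab.
  by rewrite /cball /= (lt_trans (near_a t tab)).
set d' := straighten d a b => cd' Gd' d1' d0' hd'.
have dE t : a <= t <= b -> d' t = seg (c a) (c b) ((t - a) / (b - a)).
  by move=> tab; rewrite /d' straighten_in // !dc // ltW.
have cba : nrm (c b - c a) < h by apply: near_a; rewrite lexx ltW.
have [l2 pl2] := segment_pieces h0 cba (bG _ a01) ab dE.
exists d', (l ++ l2); split => //.
- by move=> t bt; rewrite /d' straighten_out ?(ltW ab) //; [rewrite dc // (le_trans (ltW ab))|right].
- split; last by move=> /hd'.
  apply/pieces_cat; exists a => //; apply: pieces_ext pl => t /andP[_ ta].
  by rewrite /d' straighten_out ?(ltW ab) //; left.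
Qed.

Theorem logfree_simply_connected G : open G -> logfree G ->
  forall c, loop_in G c -> null_homotopic_in G c.
Proof.
move=> oG lf c0 [cc0 Gc0 c01].
(* A loop is continuous only within the unit interval; freezing it outside gives a path continuous
   on the whole line. *)
pose c t := c0 (clip 0 1 t).
have cE t : t \in `[0, 1] -> c t = c0 t by rewrite in_itv /= => t01; rewrite /c clip_in.
have z01 : (0 : R) \in `[0, 1] by rewrite in_itv /= lexx ler01.
have o01 : (1 : R) \in `[0, 1] by rewrite in_itv /= lexx ler01.
suff [H [h1 h2 h3 h4 h5]] : null_homotopic_in G c.
  by exists H; split => //; [move=> t t01; rewrite h3 // cE| move=> t t01; rewrite h4 // cE|
    move=> s s01; rewrite -(cE 0) //; exact: h5].
have clip01 t : 0 <= clip 0 1 t <= (1 : R).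
  by rewrite /clip le_max lexx /= ge_max ler01 ge_min lexx.
have cc : continuous c.
  move=> t; apply/continuousRC => e e0.
  have /within_continuousRC/(_ (clip 0 1 t) _ e e0)[|r r0 hr] := cc0.
    by rewrite /= in_itv /=; exact: clip01.
  have cl : {for t, continuous (@clip R 0 1)} by exact: clip_continuous.
  have /nbhsR[s s0 hs] : nbhs t [set u | `|clip 0 1 u - clip 0 1 t| < r].
    by apply: (cl [set u | `|u - clip 0 1 t| < r]); apply/nbhsR; exists r.
  exists s => // u /hs; apply: hr; rewrite /= in_itv /=; exact: clip01.
have Gc : path_in G c.
  by move=> t t01; rewrite cE ?in_itv //; apply: Gc0; rewrite in_itv.
have c1 : c 1 = c 0 by rewrite !cE.
have cK : compact (c @` `[0, 1]).
  by apply: continuous_compact; [exact: continuous_subspaceT|exact: segment_compact].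
have KG : c @` `[0, 1] `<=` G by move=> _ [t /= + <-]; rewrite in_itv /=; exact: Gc.
have [r r0 hr] := compact_open_margin cK oG KG.
pose h := r / 4; have h0 : 0 < h by rewrite divr_gt0.
have h4 : 4 * h = r by rewrite /h; field.
have [r1 r10 hr1] := uniform_on_segment cc h0.
pose N := (Num.bound r1^-1).+1.
have N0 : (0 < N)%N by [].
have Nr : N%:R^-1 < r1.
  rewrite invf_plt ?posrE ?ltr0n //; apply: lt_trans (archi_boundP _) _.
    by rewrite invr_ge0 ltW.
  by rewrite ltr_nat.
have [|d [l [cd Gd d1 _ [pl hd]]]] := refine h0 cc Gc c1 N0 Nr hr1 _ (leqnn N).
  by move=> t t01; rewrite h4; apply: hr; exists t => //=; rewrite in_itv.
apply: hd; rewrite divff ?pnatr_eq0 // in pl.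
case: l pl => [/= /eqP|[u s] l pl]; first by rewrite eq_sym oner_eq0.
have gu := pieces_good ((u, s) : block R * R) pl (isT : (0 < size ((u, s) :: l))%N).
rewrite /= in gu.
have ud : blk h u (d 0).
  by case: pl => [s0 _ k _]; apply: k; rewrite lexx.
(* The first block is repeated at the end, on the degenerate interval at time 1, so that the walk
   ends where it began. *)
apply: (@loop_null_homotopic R h G h0 lf (size (rcons ((u, s) :: l) (u, 1))) d _ (leqnn _)) => //.
- rewrite -cats1; apply/pieces_cat; exists 1 => //=; split=> //; first exact: gu.1.
  move=> t t1; have -> : t = 1 by apply/eqP; rewrite eq_le andbC.
  by rewrite d1.
- rewrite /closed_walk /= last_rcons; exact: linked_refl.
Qed.

End SimplyConnected.

(** * Filling *)

Section Fill.
Variable R : realType.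
Local Notation C := (cplane R).
Implicit Types (z p q : C) (M e r : R) (L S D V G A : set C).

(** Stated by components instead of logarithms, since bounded components are what the open mapping
    theorem transports along iterates. *)
Definition noholes G := forall S p, compact S -> S `<=` G -> ~ G p ->
  ~ bounded_set (connected_component (~` S) p).

Lemma planeT_connected : connected [set: C].
Proof. by apply: (@starlike_connected _ _ 0); split. Qed.

Lemma planeT_unbounded : ~ bounded_set [set: C].
Proof.
move=> /bounded_setC[M hM]; have /hM : [set: C] (`|M| + 1)%:C by [].
by rewrite nrm_real ger0_norm ?addr_ge0 // => ?; have := ler_norm M; lra.
Qed.

Lemma boundary_nonempty V : open V -> bounded_set V -> V !=set0 -> boundary V !=set0.
Proof.
move=> oV bV V0; apply: contrapT => nb.
have cV : closed V.
  by move=> z cz; apply: contrapT => nV; apply: nb; exists z; exact: closureE_open.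
apply: planeT_unbounded; suff <- : V = setT by [].
by apply: planeT_connected => //; exists V; rewrite ?setTI.
Qed.

Lemma component_open_setC S p : compact S -> open (connected_component (~` S) p).
Proof. by move=> /compact_closedC/closed_openC oS; exact: open_component. Qed.

Lemma component_mem S p : ~ S p -> connected_component (~` S) p p.
Proof. by move=> nS; exact: connected_component_refl. Qed.

(* G is a component of the interior of L together with the bounded components
   of its complement. *)
Lemma fill_domain L D q : compact L -> open D -> connected D -> D `<=` ~` L -> D 0 -> D q ->
  bounded_set (connected_component (~` L) q) ->
  exists G, [/\ open G, bounded_set G, connected G & D `<=` G /\
     boundary G `<=` L] /\ noholes G.
Proof.
move=> cL oD cD DL D0 Dq bq.
pose U := [set p | ~ L p /\ ~ bounded_set (connected_component (~` L) p)].
pose T := ~` U; pose G := connected_component (interior T) 0.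
have oL : open (~` L) by apply: closed_openC; exact: compact_closedC.
have GT : G `<=` T by move=> z /connected_component_sub/interior_subset.
have openT A : open A -> A `<=` T -> A `<=` interior T.
  by move=> oA AT z Az; rewrite /interior /=; apply: filterS AT _; exact: open_nbhs_nbhs.
have comp z p : connected_component (~` L) z p -> ~ U z -> ~ U p.
  move=> zp nz [nLp ubp]; apply: nz; split.
    have [//|nLz] := pselect (~ L z).
    by have := connected_component_out (A := ~` L) (x := z); move=> /(_ nLz) E; rewrite E in zp.
  by rewrite (same_connected_component zp).
have oG : open G by apply: open_component; exact: open_interior.
have bT : bounded_set T.
  have /bounded_setC[M hM] := compact_boundedC cL.
  apply/bounded_setC; exists `|M| => p Tp; rewrite leNgt; apply/negP => Mp.
  apply: Tp; split.
    by move=> /hM; have := ler_norm M; lra.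
  apply: unbounded_component Mp => // w /hM; have := ler_norm M; lra.
have DT : D `<=` interior T.
  apply: openT => // p Dp; apply: (comp q).
    exact: (connected_component_max Dq DL cD Dp).
  by move=> [].
have DG : D `<=` G by exact: connected_component_max.
have cG : connected G by exact: component_connected.
have bG : bounded_set G by apply: sub_bounded bT.
exists G; split; first split => //.
  split => // x bx; apply: contrapT => nLx.
  have /openC/(_ x nLx)[e e0 he] := oL.
  have [/closureC/(_ e e0)[g Gg gx] _] := bx.
  have BT : cball x e `<=` interior T.
    apply: openT; first exact: cball_open.
    move=> y By; apply: (comp g); last exact: GT.
    by apply: (connected_component_max (B := cball x e)) => //; exact: cball_connected.
  apply: (boundary_open oG bx).
  apply: (component_absorb (@cball_connected _ x e) BT); last exact: cball_center.
  by exists g.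
move=> S p cS SG nGp bV; set V := connected_component _ p in bV.
have nSp : ~ S p by move=> /SG.
have oV : open V by exact: component_open_setC.
have Vp : V p by exact: component_mem.
have VS : V `<=` ~` S by exact: connected_component_sub.
(* If [V] met an unbounded component of the complement of [L], that component, which avoids [S]
   because [S] lies in [T], would be contained in the bounded set [V]. *)
have VT : V `<=` interior T.
  apply: openT => // q' Vq' [nLq ubq]; apply: (ubq).
  set A := connected_component _ q'.
  have AS : A `<=` ~` S.
    move=> s As Ss; have nUs : ~ U s by apply: GT; exact: SG.
    exact: (comp s q' (connected_component_sym As) nUs).
  apply: sub_bounded bV; apply: component_absorb => //; first exact: component_connected.
  by exists q'; split => //; exact: component_mem.
(* The boundary of [V] lies in [S], hence in [G]. So [V] meets [G] and is absorbed by it, although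
   [p] is not in [G]. *)
have [x bx] : boundary V !=set0 by apply: boundary_nonempty => //; exists p.
have Sx : S x.
  apply: contrapT => nSx.
  by apply: (@boundary_component _ (~` S) p _ x bx) => //; apply: closed_openC; exact: compact_closedC.
have /openC/(_ x (SG x Sx))[e e0 he] := oG.
have [/closureC/(_ e e0)[v Vv vx] _] := bx.
have cV : connected V by exact: component_connected.
apply: nGp; apply: (component_absorb cV VT _ Vp).
by exists v; split => //; exact: he.
Qed.

End Fill.

(** * Connectedness of the escaping set *)

Section Dynamics.
Variable R : realType.
Local Notation C := (cplane R).
Implicit Types (z p q : C) (M e r : R) (L S D V G A X : set C).
Variable f : C -> C.
Hypothesis df : forall z, cdiff f z.

Let itf n z : C := iter n f z.

Let itf_diff n z : cdiff (itf n) z.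
Proof. exact: cdiff_iter. Qed.

Let itf_continuous n : continuous (itf n).
Proof. by move=> z; exact/cdiff_continuous/itf_diff. Qed.

Lemma escapingP z : escaping_set f z <->
  forall M, exists N, forall n, (N <= n)%N -> M < nrm (itf n z).
Proof.
split=> [h M|h A [m [mr mA]]].
  have : nbhs (+oo : set_system R[i]) [set x | M%:C < x].
    by exists M%:C; split => //; rewrite complex_real.
  move=> /h [N _ hN]; exists N => n /hN /=.
  by rewrite norm_nrm ltcR.
have /complex_realP[k kE] := mr; have [N hN] := h k.
exists N => // n /= /hN kn; apply: mA.
by rewrite kE norm_nrm ltcR.
Qed.

Lemma escaping_iter n z : escaping_set f (itf n z) <-> escaping_set f z.
Proof.
have E m : itf m (itf n z) = itf (m + n) z by rewrite /itf iterD.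
split=> /escapingP h; apply/escapingP => M; have [N hN] := h M.
  exists (N + n)%N => m Nm; have -> : m = (m - n + n)%N by lia.
  by rewrite -E; apply: hN; lia.
by exists N => m Nm; rewrite E; apply: hN; lia.
Qed.

(** Continuity sends boundary points of the preimage to boundary points of [G], and escaping is
    unaffected by finitely many iterations. *)
Lemma boundary_preimage n G : open G -> boundary G `<=` escaping_set f ->
  boundary (itf n @^-1` G) `<=` escaping_set f.
Proof.
move=> oG bG x bx; apply/(escaping_iter n); apply: bG.
have oP : open (itf n @^-1` G) by exact: ((continuousP (itf n)).1 (@itf_continuous n) G oG).
apply: closureE_open => //; last exact: (boundary_open oP bx).
apply/closureC => e e0; have /continuousCC/(_ e e0)[d d0 hd] := @itf_continuous n x.
have [/closureC/(_ d d0)[w Gw wx] _] := bx.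
by exists (itf n w) => //; exact: hd.
Qed.

(* If S enclosed p then, by the open mapping theorem, G would enclose itf n p. *)
Lemma unbounded_pullback n G S p : noholes G -> compact S -> ~ S p ->
  (forall z, S z -> G (itf n z)) -> ~ G (itf n p) ->
  ~ bounded_set (connected_component (~` S) p).
Proof.
move=> nhG cS nSp SG nGp; set A := connected_component _ p => bA.
have oS : open (~` S) by apply: closed_openC; exact: compact_closedC.
have oA : open A by exact: open_component.
pose S' := itf n @` S.
have cS' : compact S'.
  by apply: continuous_compact => //; apply: continuous_subspaceT; exact: itf_continuous.
have S'G : S' `<=` G by move=> _ [z Sz <-]; exact: SG.
have := nhG S' (itf n p) cS' S'G nGp; set V := connected_component _ (itf n p); apply.
have nS'p : ~ S' (itf n p) by move=> /S'G.
have VA : V `<=` itf n @` A.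
  apply: (open_mapping oA bA _ _ _ _ _ (z := p)).
  - by apply: continuous_subspaceT; exact: itf_continuous.
  - by move=> z _; exact: itf_diff.
  - exact: component_open_setC.
  - exact: component_connected.
  - move=> z bz Vz; apply: (connected_component_sub Vz); exists z => //.
    by apply: contrapT => nSz; exact: (boundary_component oS bz).
  - exact: component_mem.
  - exact: component_mem.
have cK : compact (itf n @` closure A).
  apply: continuous_compact; last exact: compact_closureC.
  by apply: continuous_subspaceT; exact: itf_continuous.
apply: sub_bounded (compact_boundedC cK) => z /VA[y Ay <-].
by exists y => //; exact: subset_closure.
Qed.

Definition web_domain M G := [/\ open G, bounded_set G, connected G & cball 0 M `<=` G /\
  boundary G `<=` escaping_set f] /\ noholes G.

Section Connectedness.
Hypothesis webs : forall M, exists G, web_domain M G.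

(** The boundary of the preimage escapes, so [X] avoids it and the trace on [X] is compact. Its
    image lies in [G] while that of [p] does not, and [unbounded_pullback] applies. *)
Lemma log_pullback n G X p : open G -> boundary G `<=` escaping_set f -> noholes G ->
  compact X -> X `&` escaping_set f = set0 -> escaping_set f p -> ~ G (itf n p) ->
  haslog (X `&` (itf n @^-1` G)) (fun w => w - p).
Proof.
move=> oG bG nhG cX XE Ep nGp; set Y := _ `&` _.
have oQ : open (itf n @^-1` G) by exact: ((continuousP (itf n)).1 (@itf_continuous n) G oG).
have cY : compact Y.
  apply: (subclosed_compact _ cX); last by move=> z [].
  apply: closed_setI_open => //; first exact: compact_closedC.
  by move=> z /(boundary_preimage oG bG) Ez Xz; have : (X `&` escaping_set f) z by []; rewrite XE.
have nYp : ~ Y p by move=> [Xp _]; have : (X `&` escaping_set f) p by []; rewrite XE.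
apply: (haslog_unbounded (D := connected_component (~` Y) p) cY).
- exact: component_connected.
- exact: connected_component_sub.
- exact: component_mem.
- by apply: (unbounded_pullback nhG cY nYp (n := n)) => // z [].
Qed.

(** A nonescaping orbit returns infinitely often to some disc. A web domain around this disc is
    bounded, so [p] and [q] have left it for good by the time of a late return. *)
Lemma nonescaping_return p q z : escaping_set f p -> escaping_set f q -> ~ escaping_set f z ->
  exists n G M, [/\ web_domain M G, G (itf n z), ~ G (itf n p) & ~ G (itf n q)].
Proof.
move=> /escapingP Ep /escapingP Eq nEz.
have [M hM] : exists M, forall N, exists2 n, (N <= n)%N & nrm (itf n z) <= M.
  apply: contrapT => nM; apply: nEz; apply/escapingP => M; apply: contrapT => nN; apply: nM.
  exists M => N; apply: contrapT => nn; apply: nN; exists N => n Nn.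
  by rewrite ltNge; apply/negP => k; apply: nn; exists n.
have [G wG] := webs (M + 1); have [[oG /bounded_setC[B hB] cG [sG bG]] nhG] := wG.
have [N1 h1] := Ep B; have [N2 h2] := Eq B.
have [n nN nM] := hM (maxn N1 N2); exists n, G, (M + 1); split => //.
- by apply: sG; rewrite /cball /= subr0; lra.
- by move=> /hB; rewrite leNgt h1 // (leq_trans (leq_maxl _ _) nN).
- by move=> /hB; rewrite leNgt h2 // (leq_trans (leq_maxr _ _) nN).
Qed.

(** Preimages of web domains cover [X] by relatively clopen pieces, finitely many of which
    suffice. *)
Lemma haslog_nonescaping X p q : compact X -> X `&` escaping_set f = set0 ->
  escaping_set f p -> escaping_set f q -> haslog X (fun w => (w - p) / (w - q)).
Proof.
move=> cX XE Ep Eq.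
have nX z : X z -> ~ escaping_set f z.
  by move=> Xz Ez; have : (X `&` escaping_set f) z by []; rewrite XE.
have /choice[Q hQ] : forall z, exists Q : set C, X z ->
    [/\ Q z, open Q, forall w, boundary Q w -> ~ X w &
        haslog (X `&` Q) (fun w => (w - p) / (w - q))].
  move=> z; have [Xz|nXz] := pselect (X z); last by exists set0.
  have [n [G [M [[[oG _ _ [_ bG]] nhG] Gz nGp nGq]]]] := nonescaping_return Ep Eq (nX z Xz).
  exists (itf n @^-1` G) => _; split => //.
  - exact: ((continuousP (itf n)).1 (@itf_continuous n) G oG).
  - by move=> w /(boundary_preimage oG bG) Ew Xw; exact: (nX w).
  - by apply: haslogM; [exact: log_pullback|apply: haslogV; exact: log_pullback].
have := cX; rewrite compact_cover => /(_ C X Q) [z Xz|z Xz|D DX XD].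
- by have [] := hQ z Xz.
- by exists z => //; have [] := hQ z Xz.
apply: (@haslog_cover _ X _ [seq Q z | z <- finmap.enum_fset D]).
- exact: compact_closedC.
- move=> _ /mapP[z zD ->]; have /hQ[_ h1 h2 h3] : X z by have := DX z zD; rewrite inE.
  by split.
- by move=> w /XD[z /= zD Qz]; exists (Q z) => //; apply: map_f.
Qed.

Theorem escaping_connected : connected (escaping_set f).
Proof.
set E := escaping_set f; move=> B B0 [P oP BP] [K cK BK]; apply: contrapT => BE.
have [b Bb] := B0.
have BsE : B `<=` E by rewrite BP => z [].
have [b' Eb' nBb'] : exists2 b', E b' & ~ B b'.
  apply: contrapT => nb; apply: BE; rewrite predeqE => z; split; first exact: BsE.
  by move=> Ez; apply: contrapT => nBz; apply: nb; exists z.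
(* Radii of at most half the distance to the escaping points outside [B] keep these points off the
   closure of [U]. *)
pose U := [set z | exists2 c, B c & exists2 r, nrm (z - c) < r &
  forall c', E c' -> ~ B c' -> 2 * r <= nrm (c' - c)].
have oU : open U.
  apply/openC => z [c Bc [r zr hr]]; exists (r - nrm (z - c)); first by rewrite subr_gt0.
  move=> w wz; exists c => //; exists r => //.
  by have := ler_nrm_dist z w c; lra.
have BU : B `<=` U.
  move=> c Bc; have Oc : P c by move: Bc; rewrite BP => -[].
  have /openC/(_ c Oc)[r r0 hr] := oP; exists c => //; exists (r / 2).
    by rewrite subrr nrm0 divr_gt0.
  move=> c' Ec' nBc'; rewrite leNgt; apply/negP => k; apply: nBc'; rewrite BP; split => //.
  by apply: hr; lra.
have clU c' : E c' -> ~ B c' -> ~ closure U c'.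
  move=> Ec' nBc' cUc'; have nKc' : ~ K c' by move=> Kc'; apply: nBc'; rewrite BK.
  have [s s0 hs] := openC_setC cK nKc'.
  have s2 : 0 < s / 2 by rewrite divr_gt0.
  have /closureC/(_ _ s2)[x [c Bc [r xr hr]] xc'] := cUc'.
  have Kc : K c by move: Bc; rewrite BK => -[].
  apply: (hs c _ Kc); have := hr c' Ec' nBc'.
  by have := ler_nrm_dist x c' c; rewrite (nrmB c' x) (nrmB c c'); lra.
have bU x : boundary U x -> ~ E x.
  move=> bx Ex; have [Bx|nBx] := pselect (B x).
    by apply: (boundary_open oU bx); exact: BU.
  by apply: (clU x Ex nBx); case: bx.
have [G [[oG bG cG [sG eG]] nhG]] := webs (nrm b + nrm b' + 1).
have Gb : G b by apply: sG; rewrite /cball /= subr0; have := nrm_ge0 b'; lra.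
have Gb' : G b' by apply: sG; rewrite /cball /= subr0; have := nrm_ge0 b; lra.
pose W := U `&` G.
have oW : open W by exact: openI.
have bW : bounded_set W by apply: sub_bounded bG => z [].
have nW : ~ closure W b'.
  by move=> cW; apply: (clU b' Eb' nBb'); apply: closure_subset cW => z [].
apply: (boundary_no_log oW bW (conj (BU b Bb) Gb) nW).
have cP := compact_boundary bW.
have cbU : compact (boundary W `&` boundary U).
  by apply: (compact_closedI cP); exact: closed_boundary.
have cbG : compact (boundary W `&` boundary G).
  by apply: (compact_closedI cP); exact: closed_boundary.
(* The logarithm has a different origin on each part; the parts are disjoint because the first has
   no escaping point and the second only escaping ones. *)
have PE : boundary W `<=` (boundary W `&` boundary U) `|` (boundary W `&` boundary G).
  move=> x bx; have [cx _] := bx.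
  have cUx : closure U x by apply: closure_subset cx => z [].
  have cGx : closure G x by apply: closure_subset cx => z [].
  have [Gx|nGx] := pselect (G x); last by right; exact: (conj bx (closureE_open oG cGx nGx)).
  left; apply: (conj bx); apply: (closureE_open oU cUx) => Ux.
  exact: (boundary_open oW bx (conj Ux Gx)).
apply: (haslog_sub PE); apply: haslog_union.
- exact: compact_closedC.
- exact: compact_closedC.
- by rewrite -subset0 => x [[_ /bU nEx] [_ /eG Ex]]; exact: nEx.
- apply: (haslog_nonescaping cbU _ (BsE b Bb) Eb').
  by rewrite -subset0 => x [[_ /bU nEx] Ex]; exact: nEx.
- apply: (haslog_ratio cbG cG _ Gb Gb') => x Gx [_ bx]; exact: (boundary_open oG bx Gx).
Qed.

End Connectedness.

End Dynamics.

(** * Construction of the web *)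

Lemma divergesP (R : realType) (a : nat -> R) : a n @[n --> \oo] --> +oo ->
  forall M, exists N, forall n, (N <= n)%N -> M < a n.
Proof.
move=> h M; have nM : nbhs (+oo : set_system R) [set x | M < x].
  by exists M; split => //; exact: num_real.
by have [N _ hN] := h _ nM; exists N => n Nn; exact: hN.
Qed.

Lemma noholes_logfree (R : realType) (G : set (cplane R)) : noholes G -> logfree G.
Proof.
move=> nhG S p cS SG nGp; apply: (haslog_unbounded (D := connected_component (~` S) p) cS).
- exact: component_connected.
- exact: connected_component_sub.
- by apply: component_mem => /SG.
- exact: nhG.
Qed.

Lemma web_domain_simply_connected (R : realType) (f : cplane R -> cplane R) M
  (G : set (cplane R)) : 0 < M -> web_domain f M G -> simply_connected_domain G.
Proof.
move=> M0 [[oG _ cG [sG _]] nhG]; split.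
  by split => //; exists 0; apply: sG; exact: cball_center.
by move=> c; apply: logfree_simply_connected => //; exact: noholes_logfree.
Qed.

Section Webs.
Variables (R : realType) (f : cplane R -> cplane R) (a : nat -> R).
Local Notation C := (cplane R).
Implicit Types (z p : C) (K O : set C).
Hypothesis df : forall z, cdiff f z.
Hypothesis a_oo : a n @[n --> \oo] --> +oo.

Lemma aboveP z : escaping_above f a z <-> forall n, (0 < n)%N -> a n <= nrm (iter n f z).
Proof.
by split=> h n /h; rewrite norm_nrm lecR.
Qed.

Lemma above_escaping z : escaping_above f a z -> escaping_set f z.
Proof.
move=> /aboveP hz; apply/(escapingP f) => M; have [N hN] := divergesP a_oo M.
exists (maxn N 1) => n; rewrite geq_max => /andP[Nn n0].
exact: lt_le_trans (hN n Nn) (hz n n0).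
Qed.

Lemma closed_above : closed (escaping_above f a).
Proof.
move=> z cz; apply/aboveP => n n0; apply/ler_addgt0Pl => e e0.
have /continuousCC/(_ e e0)[d d0 hd] := cdiff_continuous (cdiff_iter n df z).
have /closureC/(_ d d0)[w /aboveP/(_ n n0) aw wz] := cz.
by have := ler_nrmB (iter n f w) (iter n f z); have := hd w wz; lra.
Qed.

Lemma iter_modn (p : nat) z j : iter p f z = z -> iter j f z = iter (j %% p) f z.
Proof.
move=> pz; have E q : iter (q * p) f z = z.
  by elim: q => [//|q IH]; rewrite mulSn addnC iterD pz.
by rewrite {1}(divn_eq j p) addnC iterD E.
Qed.

Lemma cover_disc K n z (r : R) : open K -> bounded_set K ->
  boundary K `<=` escaping_above f a -> (0 < n)%N -> r <= a n ->
  K z -> nrm (iter n f z) < r -> cball 0 r `<=` iter n f @` K.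
Proof.
move=> oK bK EK n0 ra Kz zr; apply: (open_mapping oK bK _ _ _ _ _ Kz).
- apply: continuous_subspaceT => w; exact/cdiff_continuous/cdiff_iter.
- by move=> w _; exact: cdiff_iter.
- exact: cball_open.
- exact: cball_connected.
- move=> w /EK/aboveP/(_ n n0) aw; rewrite /cball /= subr0 => wr.
  by have := le_lt_trans aw wr; rewrite ltNge ra.
- by rewrite /cball /= subr0.
Qed.

Lemma webs_exist : (forall n, (0 < n)%N -> exists O,
     periodic_cycle f O /\ O `<=` ball (0 : C) (a n)%:C) ->
  (exists K, is_component (~` escaping_above f a) K /\ bounded_set K) ->
  forall M, exists G, web_domain f M G.
Proof.
move=> hcycle [K [[x0 nEx0 KE] bK]] M.
have oE : open (~` escaping_above f a) by exact: closed_openC closed_above.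
have oK : open K by rewrite KE; exact: open_component.
have EK : boundary K `<=` escaping_above f a.
  by rewrite KE => z /(boundary_component oE) nnz; apply: contrapT.
have Kx0 : K x0 by rewrite KE; exact: connected_component_refl.
have [m m0 mx0] : exists2 m, (0 < m)%N & nrm (iter m f x0) < a m.
  apply: contrapT => nm; apply: nEx0; apply/aboveP => n n0.
  by rewrite leNgt; apply/negP => k; apply: nm; exists n.
have [Y [[p [q [q0 pq YE]]] Yball]] := hcycle m m0.
have orb j : nrm (iter j f p) < a m.
  have : Y (iter j f p) by rewrite YE (iter_modn j pq); exists (j %% q)%N => //=; rewrite ltn_mod.
  by move=> /Yball; rewrite /ball /= sub0r normrN norm_nrm ltcR.
have [k Kk kp] : (iter m f @` K) p.
  apply: (cover_disc oK bK EK m0 (lexx _) Kx0 mx0).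
  by rewrite /cball /= subr0; exact: orb 0%N.
have orbk n : (m <= n)%N -> nrm (iter n f k) < a m.
  by move=> mn; rewrite -(subnK mn) iterD kp.
(* Besides [M], the radius [a n] must exceed [a m], which bounds the orbit of [k] from time [m] on,
   and 0, so that the disc contains the origin. *)
have [N hN] := divergesP a_oo (Num.max (a m) (Num.max M 0)).
pose n := maxn N m.
have mn : (m <= n)%N by exact: leq_maxr.
have n0 : (0 < n)%N by exact: leq_trans m0 mn.
have := hN n (leq_maxl _ _); rewrite !gt_max => /and3P[amn Mn an0].
have cf : continuous (iter n f) by move=> z; exact/cdiff_continuous/cdiff_iter.
pose L := iter n f @` boundary K.
have cL : compact L.
  apply: continuous_compact; first exact: continuous_subspaceT.
  exact: compact_boundary.
have DL : cball 0 (a n) `<=` ~` L.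
  move=> w; rewrite /cball /= subr0 => wn [z /EK/aboveP/(_ n n0) az zw].
  by move: wn; rewrite -zw ltNge az.
have Dk : cball 0 (a n) (iter n f k).
  by rewrite /cball /= subr0; exact: lt_trans (orbk n mn) amn.
(* The component avoids the image of the boundary of [K], so the open mapping theorem covers it by
   the bounded image of [K]. *)
have bk : bounded_set (connected_component (~` L) (iter n f k)).
  have cKc : compact (iter n f @` closure K).
    by apply: continuous_compact; [exact: continuous_subspaceT|exact: compact_closureC].
  apply: sub_bounded (compact_boundedC cKc) => w Vw.
  have [z Kz <-] : (iter n f @` K) w; last by exists z => //; exact: subset_closure.
  apply: (open_mapping oK bK _ _ _ _ _ Kk) Vw.
  - exact: continuous_subspaceT.
  - by move=> z _; exact: cdiff_iter.
  - exact: component_open_setC.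
  - exact: component_connected.
  - by move=> z bz /connected_component_sub; apply; exists z.
  - by apply: component_mem; exact: DL.
have [G [[oG bG cG [DG GL]] nhG]] := fill_domain cL (@cball_open _ 0 (a n))
  (@cball_connected _ 0 (a n)) DL (@cball_center _ 0 _ an0) Dk bk.
exists G; split; last exact: nhG.
split; [exact: oG|exact: bG|exact: cG|split].
  by move=> w wM; apply: DG; apply: lt_trans Mn.
move=> w /GL[z /EK/above_escaping Ez <-].
exact/(escaping_iter f n z).
Qed.

End Webs.

Lemma webs_spiders_web (R : realType) (f : cplane R -> cplane R) :
  (forall z, cdiff f z) -> (forall M, exists G, web_domain f M G) ->
  spiders_web (escaping_set f).
Proof.
move=> df webs; split; first exact: escaping_connected.
have /choice[W hW] := webs.
have /choice[B hB] : forall M, exists B, forall z, W M z -> nrm z <= B.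
  by move=> M; apply/bounded_setC; have [[]] := hW M.
(* Each radius exceeds the bound of the previous domain, which gives the nesting, and the index,
   which gives the exhaustion. *)
pose fix r n : R := if n is n.+1 then Num.max (B (r n)) n%:R + 1 else 1.
have r0 n : 0 < r n.
  by case: n => [|n] /=; rewrite ?ltr01 // ltr_wpDl // le_max ler0n orbT.
exists (fun n => W (r n)); split.
- move=> n; split; first by have [[]] := hW (r n).
  exact: web_domain_simply_connected (r0 n) (hW (r n)).
- move=> n z /hB zB; have [[_ _ _ [+ _]] _] := hW (r n.+1); apply.
  rewrite /cball /= subr0 (le_lt_trans zB) //.
  by rewrite (@le_lt_trans _ _ (Num.max (B (r n)) n%:R)) ?le_max ?lexx // ltrDl.
- by move=> n; have [[_ _ _ []]] := hW (r n).
- rewrite predeqE => z; split => // _; pose n := Num.bound (nrm z).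
  have zn : nrm z < n%:R by exact: archi_boundP (nrm_ge0 z).
  exists n.+1 => //; have [[_ _ _ [+ _]] _] := hW (r n.+1); apply.
  rewrite /cball /= subr0 (lt_le_trans zn) //.
  by rewrite (@le_trans _ _ (Num.max (B (r n)) n%:R)) ?le_max ?lexx ?orbT // lerDl.
Qed.

Theorem theorem1p3 (R : realType) (f : cplane R -> cplane R) (a : nat -> R)
  (hf : transcendental_entire f)
  (a_gt0 : forall n, (0 < n)%N -> 0 < a n)
  (a_oo : a n @[n --> \oo] --> +oo)
  (hcycle : forall n, (0 < n)%N ->
     exists O : set (cplane R),
       periodic_cycle f O /\ O `<=` ball (0 : cplane R) (a n)%:C)
  (hcomp : exists K : set (cplane R),
     is_component (~` escaping_above f a) K /\ bounded_set K) :
  spiders_web (escaping_set f).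
Proof.
have df z : cdiff f z by apply: derivable_cdiff; exact: hf.1.
by apply: webs_spiders_web => //; exact: webs_exist a_oo hcycle hcomp.
Qed.
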